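(* For $n\in\mathbb{N}$ let $(U_j^{(n)})_{j\in\mathbb{N}}$ be independent random variables, each uniformly distributed on $[n]=\{1,\dots,n\}$, and put $Y_n(m):=\log{\rm lcm}(U_1^{(n)},\dots,U_m^{(n)})$ (with $Y_n(0)=0$). For $y\ge0$ put $$c_n(y):=\sum_{p\le n,\ p \text{ prime}}\log p\,\bigl(1-(1-n^{-1}\lfloor n/p\rfloor)^y\bigr).$$ Let $(m_n)$ be a sequence of positive integers and $(B(t))_{t\ge0}$ a standard Brownian motion. (i) If $m_n\le n^{1/2}$ for all sufficiently large $n$ and $m_n\to\infty$, then $$\left(\frac{Y_n(\lfloor m_n t\rfloor)-c_n(\lfloor m_n t\rfloor)}{\sqrt{2^{-1}m_n}\,\log m_n}\right)_{t\ge0}\to (B(t))_{t\ge0}$$ in the sense of finite-dimensional distributions as $n\to\infty$. (ii) If $m_n>n^{1/2}$ for all sufficiently large $n$ and $m_n=o(n)$, then $$\left(\frac{Y_n(\lfloor m_n t\rfloor)-c_n(\lfloor m_n t\rfloor)}{\sqrt{2^{-1}m_n(\log n-\log m_n)(3\log m_n-\log n)}}\right)_{t\ge0}\to (B(t))_{t\ge0}$$ in the sense of finite-dimensional distributions as $n\to\infty$.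
   Context: ${\rm lcm}$ denotes least common multiple. Convergence of finite-dimensional distributions means that for every $k$ and $0\le t_1<\dots<t_k$ the vector of values at $t_1,\dots,t_k$ converges in distribution. *)

(* Defs.v *)
From HB Require Import structures.
From mathcomp Require Import all_boot all_order all_algebra.
From mathcomp Require Import all_classical all_reals all_analysis.
Set Implicit Arguments. Unset Strict Implicit. Unset Printing Implicit Defensive.
Import Order.TTheory GRing.Theory Num.Theory.
Import numFieldTopology.Exports numFieldNormedType.Exports.
Local Open Scope classical_set_scope.
Local Open Scope ring_scope.

Section Defs.
Variable R : realType.

Definition mutually_independent {d d'} {T : measurableType d}
  {V : measurableType d'} {I : eqType} (P : probability T R) (X : I -> T -> V) :=
  forall (J : seq I) (A : I -> set V), uniq J ->
    (forall i, i \in J -> measurable (A i)) ->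
    P (\bigcap_(i in [set i | i \in J]) (X i @^-1` A i))
      = (\prod_(i <- J) P (X i @^-1` A i))%E.

Definition uniform_on_range {d} {T : measurableType d} (P : probability T R)
  (n : nat) (X : T -> nat) :=
  forall k : nat, P (X @^-1` [set k]) = (if (1 <= k <= n)%N then n%:R^-1 else 0)%:E.

Definition iid_uniform {d} {T : measurableType d} (P : probability T R)
  (n : nat) (U : nat -> T -> nat) :=
  (forall j, measurable_fun setT (U j)) /\
  mutually_independent P U /\
  (forall j, uniform_on_range P n (U j)).

Definition standard_BM {d} {T : measurableType d} (P : probability T R)
  (B : R -> T -> R) :=
  (forall t, 0 <= t -> measurable_fun setT (B t)) /\
  {ae P, forall x, B 0 x = 0} /\
  {ae P, forall x, {within [set t : R | 0 <= t], continuous (fun t => B t x)}} /\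
  (forall (k : nat) (t : 'I_k.+1 -> R), 0 <= t ord0 ->
     (forall i j : 'I_k.+1, (i < j)%N -> t i < t j) ->
     mutually_independent P
       (fun (i : 'I_k) (x : T) => B (t (lift ord0 i)) x - B (t (widen_ord (leqnSn k) i)) x)) /\
  (* Gaussian increments: B t - B s ~ N(0, t - s) (normal_prob takes the std deviation) *)
  (forall s t : R, 0 <= s -> s < t -> forall A : set R, measurable A ->
     P ((fun x => B t x - B s x) @^-1` A) = normal_prob 0 (Num.sqrt (t - s)) A).

Definition fdd_cvg {d : nat -> measure_display} {T : forall n, measurableType (d n)}
  (P : forall n, probability (T n) R) (X : forall n, R -> T n -> R)
  {dB} {TB : measurableType dB} (PB : probability TB R) (B : R -> TB -> R) :=
  forall (k : nat) (t : 'I_k -> R),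
    (forall i, 0 <= t i) -> (forall i j : 'I_k, (i < j)%N -> t i < t j) ->
    forall f : 'rV[R]_k -> R, continuous f -> (exists M : R, forall v, `|f v| <= M) ->
      (fun n => \int[P n]_x (f (\row_i X n (t i) x))%:E)%E @ \oo -->
        (\int[PB]_x (f (\row_i B (t i) x))%:E)%E.

Definition Ylcm {T : Type} (U : nat -> T -> nat) (m : nat) (x : T) : R :=
  ln ((\big[lcmn/1%N]_(j < m) U j.+1 x)%:R).

(* c_n(y) = sum_{p <= n prime} log p (1 - (1 - n^{-1} floor(n/p))^y), for integer y >= 0
   (the only arguments at which it is used). *)
Definition cn (n y : nat) : R :=
  \sum_(p < n.+1 | prime p) ln (p%:R) * (1 - (1 - (n %/ p)%:R / n%:R) ^+ y).

Definition lcm_process {T : Type} (U : nat -> T -> nat) (n mn : nat) (a : R)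
  (t : R) (x : T) : R :=
  (Ylcm U (Num.truncn (mn%:R * t)) x - cn n (Num.truncn (mn%:R * t))) / a.

End Defs.

(* Main.v *)
Require Import Defs.
From HB Require Import structures.
From mathcomp Require Import all_boot all_order all_algebra.
From mathcomp Require Import all_classical all_reals all_analysis.
From mathcomp Require Import measurable_realfun ring lra zify.
Set Implicit Arguments.
Unset Strict Implicit.
Unset Printing Implicit Defensive.
Import Order.TTheory GRing.Theory Num.Theory.
Import numFieldTopology.Exports numFieldNormedType.Exports.
Local Open Scope classical_set_scope.
Local Open Scope ring_scope.

(** Write [Y - c_n] as the contribution of prime powers, which is [O(sqrt m)] in mean, plus the
    fluctuation of [W], plus a sum of i.i.d. centred terms [h (U_j) - E h], where
    [h u] is the sum of [log p] over the primes [p > m] dividing [u] and [W] is the sum over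
    [p <= n] of [log p (1_(p divides some U_j) - 1_(p > m) #{j : p | U_j})].  By the Efron-Stein inequality
    [W] has variance [O(m (1 + log m))], which is negligible at the scale of the theorem.  When
    [m ^ 2 <= n], [h u] is up to an [L^2]-bounded error [log n] minus the sum of [log p] over the
    primes [p <= m] dividing [u], whose variance is [log^2 m / 2]; when [m ^ 2 > n] an integer
    [u <= n] has at most one prime divisor larger than [m], and [h] has variance
    [(log n - log m) (3 log m - log n) / 2].  The i.i.d. sums are compared with the increments of
    Brownian motion on the mesh of step [1 / m] by Lindeberg's exchange method, applied to
    Lipschitz test functions smoothed by a double moving average; bounded continuous test
    functions are approximated from below by their Lipschitz inf-convolutions. *)

(** * Chebyshev and Mertens estimates *)

Section PrimeSums.
Context {R : realType}.
Implicit Types (n p a b : nat) (x : R).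

(** The cut at [p = m] is where a prime changes behaviour. About [m t] samples are drawn: a prime
    well below [m] divides some sample with high probability, so its indicator hardly fluctuates,
    while a prime well above [m] is seldom hit twice, so its indicator is nearly the number of its
    multiples in the sample, which is additive. Primes of size about [m] obey neither rule and
    produce the error of [W]. In the first regime this error loses one factor [log m] against the
    squared normalization; in the second that normalization is of order [m log n (log n - log m)]
    and the gain is only [log n - log m], whence the role of [m = o(n)]. Bounded errors in Mertens'
    estimates are therefore affordable, and Chebyshev's elementary bound is the only input on
    primes. In the first regime [h] must be traded for the small primes because its natural bound
    [log n] may be far larger than [log m], which would ruin the third moment. All expectations over
    samples become finite averages over lists, where Efron-Stein and the exchange are inductions,
    and one sample is matched with one Brownian mesh step. *)

Lemma lnn_ge0 n : 0 <= ln (n%:R : R).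
Proof.
case: n => [|n]; first by rewrite ln0.
by apply: ln_ge0; rewrite ler1n.
Qed.

Lemma ler_lnn a b : (0 < a)%N -> (a <= b)%N -> ln (a%:R : R) <= ln b%:R.
Proof. by move=> a0 ab; rewrite ler_ln ?posrE ?ltr0n ?ler_nat //; apply: leq_trans ab. Qed.

Lemma ln_le_subr1 x : 0 < x -> ln x <= x - 1.
Proof. by move=> x0; rewrite -{1}(subrK 1 x) addrC; apply: le_ln1Dx; lra. Qed.

Lemma lnS_sub n : (0 < n)%N -> ln (n.+1%:R : R) - ln n%:R <= n%:R^-1.
Proof.
move=> n0; have n0' : (0 : R) < n%:R by rewrite ltr0n.
rewrite -ln_div ?posrE ?ltr0n //; apply: (le_trans (ln_le_subr1 _)).
  by rewrite divr_gt0 ?ltr0n.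
by rewrite -natr1 mulrDl divff ?gt_eqF // mul1r addrAC subrr add0r.
Qed.

Lemma lnn_leS n : ln (n%:R : R) <= ln n.+1%:R.
Proof. by case: n => [|n]; [rewrite ln0 ?lnn_ge0|apply: ler_lnn]. Qed.

(** Extended by zero off the primes, so that prime sums run over intervals of naturals, which can be
    cut and widened freely. *)
Definition lp p : R := if prime p then ln p%:R else 0.

Lemma lp_ge0 p : 0 <= lp p.
Proof. by rewrite /lp; case: ifP => // _; exact: lnn_ge0. Qed.

Lemma lp_le_ln p : lp p <= ln p%:R.
Proof. by rewrite /lp; case: ifP => // _; exact: lnn_ge0. Qed.

Definition theta n : R := \sum_(0 <= p < n.+1) lp p.

Lemma theta_ge0 n : 0 <= theta n.
Proof. by apply: sumr_ge0 => p _; exact: lp_ge0. Qed.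

Lemma ler_sum_nat_widen (F : nat -> R) a b c d : (a <= c)%N -> (d <= b)%N ->
  (forall p, (a <= p < b)%N -> 0 <= F p) ->
  \sum_(c <= p < d) F p <= \sum_(a <= p < b) F p.
Proof.
move=> ac db F0; have [dc|cd] := leqP d c.
  by rewrite big_geq // big_nat; exact: sumr_ge0.
rewrite (big_cat_nat ac (leq_trans (ltnW cd) db)) /=.
rewrite (big_cat_nat (ltnW cd) db) /= addrCA lerDl.
rewrite addr_ge0 //; rewrite big_nat; apply: sumr_ge0 => p /andP[h1 h2]; apply: F0; lia.
Qed.

Lemma ler_theta a b : (a <= b)%N -> theta a <= theta b.
Proof. by move=> ab; apply: ler_sum_nat_widen => // p _; exact: lp_ge0. Qed.

Lemma lnn_prod (I : Type) (r : seq I) (Q : pred I) (F : I -> nat) :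
  (forall i, Q i -> 0 < F i)%N ->
  ln ((\prod_(i <- r | Q i) F i)%N%:R : R) = \sum_(i <- r | Q i) ln (F i)%:R.
Proof.
move=> F0; elim: r => [|i r IH]; first by rewrite !big_nil ln1.
rewrite !big_cons; case: ifP => // Qi.
rewrite natrM lnM ?posrE ?ltr0n ?F0 ?IH //.
exact: prodn_cond_gt0.
Qed.

Lemma lnn_logn n b : (0 < n)%N -> (n <= b)%N ->
  ln (n%:R : R) = \sum_(0 <= p < b.+1) lp p * (logn p n)%:R.
Proof.
move=> n0 nb; rewrite -{1}[n]partnT // (widen_partn _ nb).
rewrite lnn_prod; last first.
  move=> p _; rewrite lognE expn_gt0; case: ifP => //; last by rewrite orbT.
  by move=> /andP[/prime_gt0 ->].
rewrite big_mkcond; apply: eq_big_nat => p _ /=.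
rewrite /lp lognE; case: (boolP (prime p)) => [pp|] /=; last by rewrite ln1 mul0r.
rewrite n0 /=; case: ifP => [pn|]; last by rewrite ln1 mulr0.
by rewrite natrX lnXn ?ltr0n ?prime_gt0 // mulr_natr.
Qed.

Lemma prime_dvd_central p k : prime p -> (k < p <= k.*2)%N -> (p %| 'C(k.*2, k))%N.
Proof.
move=> pp /andP[kp pk].
have kk : (k <= k.*2)%N by rewrite -addnn leq_addr.
have := bin_fact kk; rewrite -addnn addnK => E.
have ndk : ~~ (p %| k`!)%N.
  elim: k kp {pk kk E} => [|k IH] kp; first by rewrite fact0 dvdn1; case: p pp kp => [|[|]].
  by rewrite factS Euclid_dvdM // negb_or IH ?(ltnW kp) // gtnNdvd.
have : (p %| (k + k)`!)%N by rewrite dvdn_fact // prime_gt0 // addnn.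
by rewrite -E !Euclid_dvdM // (negbTE ndk) !orbF addnn.
Qed.

(** Chebyshev's argument: every prime in [(k, 2k]] divides the central binomial coefficient, which
    is at most [2 ^ (2k)]. *)
Lemma theta_double k : (0 < k)%N -> theta k.*2 <= theta k + k.*2%:R * ln 2.
Proof.
move=> k0; have kk : (k <= k.*2)%N by rewrite -addnn leq_addr.
rewrite /theta (@big_cat_nat _ _ _ k.+1 _ k.*2.+1) //= lerD2l.
have C0 : (0 < 'C(k.*2, k))%N by rewrite bin_gt0.
have Cu : ('C(k.*2, k) <= 2 ^ k.*2)%N.
  have := expnDn 1 1 k.*2; rewrite addn1 => ->.
  have kl : (k < k.*2.+1)%N by rewrite ltnS.
  rewrite (bigD1 (Ordinal kl)) //= !exp1n !muln1; exact: leq_addr.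
have : ln ('C(k.*2, k)%:R : R) <= k.*2%:R * ln 2.
  rewrite mulr_natl -lnXn // -natrX; exact: ler_lnn.
apply: le_trans.
set b := maxn k.*2 'C(k.*2, k).
rewrite (@lnn_logn _ b) ?leq_maxr //.
apply: (@le_trans _ _ (\sum_(k.+1 <= i < k.*2.+1) lp i * (logn i 'C(k.*2, k))%:R)); last first.
  apply: ler_sum_nat_widen; rewrite ?ltnS ?leq_maxl // => p _.
  by rewrite mulr_ge0 ?lp_ge0.
rewrite !big_nat; apply: ler_sum => p /andP[kp pk].
rewrite {1}/lp; case: (boolP (prime p)) => [pp|]; last by rewrite mulr_ge0 ?lp_ge0.
rewrite {1}/lp pp ler_peMr ?lnn_ge0 // ler1n logn_gt0 mem_primes pp C0 /=.
by rewrite prime_dvd_central // kp -ltnS.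
Qed.

(** Doubling with [ln 2 <= 1] gives [2 * 2 ^ j] at powers of two, and some power of two above [n] is
    at most [2 n]. *)
Lemma theta_le n : theta n <= 4 * n%:R.
Proof.
case: n => [|n]; first by rewrite /theta big_nat1 /lp /= mulr0.
have ln2 : ln (2 : R) <= 1 by apply: (le_trans (ln_le_subr1 _)) => //; lra.
have two j : theta (2 ^ j) <= 2 * (2 ^ j)%:R.
  elim: j => [|j IH].
    by rewrite expn0 /theta !big_nat_recl // big_geq // /lp /= !addr0 mulr1.
  have : theta (2 ^ j.+1) <= theta (2 ^ j) + (2 ^ j.+1)%:R * ln 2.
    by rewrite expnS mul2n; apply: theta_double; rewrite expn_gt0.
  move/le_trans; apply.
  have : (2 ^ j.+1)%:R * ln 2 <= (2 ^ j.+1)%:R :> R by rewrite ler_piMr.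
  by rewrite expnS natrM; lra.
have /andP[lo hi] := trunc_log_bounds (isT : 1 < 2)%N (isT : 0 < n.+1)%N.
apply: (le_trans (ler_theta (ltnW hi))); apply: (le_trans (two _)).
by rewrite -!natrM ler_nat expnS mulnA leq_mul2l.
Qed.

(** Summation by parts against Chebyshev's bound: under a decreasing weight, [lp] may be replaced by
    the constant 4, up to a boundary term at [a]. *)
Lemma sum_lp_comparison (w : nat -> R) a b : (a <= b)%N ->
  (forall p, (a <= p)%N -> 0 <= w p) ->
  (forall p, (a <= p)%N -> w p.+1 <= w p) ->
  \sum_(a <= p < b) lp p * w p <= 4 * (a%:R * w a + \sum_(a <= p < b) w p).
Proof.
move=> ab w0 wd; have [->|ab'] := eqVneq a b.
  by rewrite !big_geq // addr0 !mulr_ge0 // w0.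
have {ab ab'} ab : (a < b)%N by rewrite ltn_neqAle ab'.
pose T k := \sum_(a <= p < (a + k).+1) lp p.
have Tb k : T k <= 4 * (a + k).+1%:R.
  apply: (@le_trans _ _ (theta (a + k))).
    by apply: ler_sum_nat_widen => // p _; exact: lp_ge0.
  by apply: (le_trans (theta_le _)); rewrite ler_pM2l // ler_nat.
suff H k : \sum_(a <= p < (a + k).+1) lp p * w p + (4 * (a + k).+1%:R - T k) * w (a + k)%N
   <= 4 * (a%:R * w a + \sum_(a <= p < (a + k).+1) w p).
  have := H (b.-1 - a)%N.
  have -> : (a + (b.-1 - a))%N = b.-1 by lia.
  have -> : b.-1.+1 = b by lia.
  apply: le_trans; rewrite lerDl mulr_ge0 ?w0 //; last by lia.
  rewrite subr_ge0; have := Tb (b.-1 - a)%N.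
  have -> : (a + (b.-1 - a))%N = b.-1 by lia.
  by have -> : b.-1.+1 = b by lia.
elim: k => [|k IH].
  rewrite addn0 /T !addn0 !big_nat1 -natr1; lra.
rewrite addnS /T addnS !(big_nat_recr (a + k).+1) /=; try by lia.
rewrite -/(T k).
have := Tb k; have := wd (a + k)%N (leq_addr _ _); have := w0 (a + k).+1 ltac:(lia).
move: IH; rewrite -[(a + k).+2%:R]natr1.
set S := \sum_(_ <= _ < _) _; set S' := \sum_(_ <= _ < _) _.
set W := w (a + k)%N; set W' := w (a + k).+1; set l := lp _; set t := T k.
set c : R := (a + k).+1%:R.
move=> IH W'0 WW ct.
have : (4 * c - t) * W' <= (4 * c - t) * W by rewrite ler_wpM2l // subr_ge0.
lra.
Qed.


Lemma lnn_fact_le n : (0 < n)%N -> ln ((n`!)%:R : R) <= n%:R * ln n%:R.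
Proof.
move=> n0; rewrite mulr_natl -lnXn ?ltr0n // -natrX ler_lnn ?fact_gt0 //.
elim: n {n0} => // n IH; rewrite factS expnS leq_mul2l /=.
apply: (leq_trans IH); case: n {IH} => // n; by rewrite leq_exp2r.
Qed.

Lemma lnn_fact_ge n : (0 < n)%N -> n%:R * ln n%:R - n%:R + 1 <= ln ((n`!)%:R : R).
Proof.
elim: n => // -[_ _|n IH _]; first by rewrite factS fact0 muln1 ln1 mulr0 add0r addNr.
have := IH isT; rewrite (factS n.+1) natrM lnM ?posrE ?ltr0n ?fact_gt0 //.
have := lnS_sub (isT : 0 < n.+1)%N.
rewrite -(@ler_pM2l _ n.+1%:R) ?ltr0n // mulfV ?pnatr_eq0 //.
set l := ln n.+1%:R; set l' := ln n.+2%:R; rewrite -(natr1 n.+1).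
set N := n.+1%:R; lra.
Qed.

Lemma legendre n : (0 < n)%N -> ln ((n`!)%:R : R) =
  \sum_(0 <= p < n.+1) lp p * (\sum_(1 <= k < n.+1) n %/ p ^ k)%:R.
Proof.
move=> n0; have nf : (n <= n`!)%N by case: n n0 => // n _; rewrite factS leq_pmulr ?fact_gt0.
rewrite (lnn_logn (fact_gt0 n) (leqnn _)) (@big_cat_nat _ _ _ n.+1) //=.
rewrite [X in _ + X]big1_seq ?addr0; last first.
  move=> p /andP[_]; rewrite mem_index_iota => /andP[np _].
  rewrite /lp; case: ifP => [pp|]; last by rewrite mul0r.
  rewrite logn_fact // big_nat big1 ?mulr0 // => k /andP[k0 _]; rewrite divn_small //.
  by apply: (leq_trans np); rewrite -{1}(expn1 p) leq_pexp2l // prime_gt0.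
apply: eq_big_nat => p _; rewrite /lp; case: ifP => [pp|]; last by rewrite !mul0r.
by rewrite logn_fact.
Qed.

Lemma sum_geometric2 (x : R) b : 0 <= x -> 2 * x <= 1 ->
  \sum_(2 <= k < b) x ^+ k <= 2 * x ^+ 2.
Proof.
move=> x0 x1; have [b2|b2] := leqP b 2.
  by rewrite big_geq // mulr_ge0 // exprn_ge0.
suff : \sum_(2 <= k < b) x ^+ k + 2 * x ^+ b <= 2 * x ^+ 2.
  by apply: le_trans; rewrite lerDl mulr_ge0 // exprn_ge0.
rewrite -(subnK (ltnW b2)); elim: (b - 2)%N => [|j IH]; first by rewrite add0n big_geq // add0r.
rewrite addSn big_nat_recr /= ?leq_addl //; apply: le_trans IH.
rewrite -addrA lerD2l exprS; have : 0 <= x ^+ (j + 2) by rewrite exprn_ge0.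
set y := x ^+ _ => y0; have : 2 * x * y <= 1 * y by rewrite ler_wpM2r.
lra.
Qed.

Lemma sum_inv_sqr a b : (0 < a)%N -> \sum_(a <= p < b) (p%:R ^+ 2)^-1 <= 2 / a%:R :> R.
Proof.
move=> a0; have [ba|ab] := leqP b a; first by rewrite big_geq // divr_ge0.
have H k : \sum_(a <= p < (a + k).+1) (p%:R ^+ 2)^-1 <= 2 / a%:R - (a + k)%:R^-1 :> R.
  elim: k => [|k IH].
    rewrite addn0 big_nat1 mulr_natl mulr2n addrK.
    rewrite lef_pV2 ?posrE ?exprn_gt0 ?ltr0n // expr2 ler_peMl //; last by rewrite ler1n.
  rewrite addnS big_nat_recr /=; last by lia.
  apply: (le_trans (lerD IH (lexx _))).
  rewrite -addrA lerD2l -natr1.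
  have : (0 : R) < (a + k)%:R by rewrite ltr0n addn_gt0 a0.
  move: (_%:R) => x x0.
  rewrite -subr_ge0; have -> : - (x + 1)^-1 - (- x^-1 + ((x + 1) ^+ 2)^-1) = (x * (x + 1) ^+ 2)^-1.
    by field; rewrite !gt_eqF //; lra.
  by rewrite invr_ge0 mulr_ge0 ?sqr_ge0 // ltW.
have := H (b.-1 - a)%N.
have -> : (a + (b.-1 - a))%N = b.-1 by lia.
have -> : b.-1.+1 = b by lia.
by move/le_trans; apply; rewrite lerBlDr lerDl.
Qed.

Lemma sum_lp_inv_sqr a b : (0 < a)%N ->
  \sum_(a <= p < b) lp p / p%:R ^+ 2 <= 12 / a%:R.
Proof.
move=> a0; have [ba|ab] := leqP b a; first by rewrite big_geq // divr_ge0.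
apply: (le_trans (@sum_lp_comparison (fun p => (p%:R ^+ 2)^-1) a b (ltnW ab) _ _)).
- by move=> p _; rewrite invr_ge0 sqr_ge0.
- move=> p ap; have p0 : (0 < p)%N by lia.
  by rewrite lef_pV2 ?posrE ?exprn_gt0 ?ltr0n // lerXn2r ?nnegrE // ler_nat.
have := sum_inv_sqr b a0.
have -> : a%:R * (a%:R ^+ 2)^-1 = a%:R^-1 :> R by field; rewrite pnatr_eq0; lia.
lra.
Qed.

Lemma sum_lp2_inv_sqr a b : (0 < a)%N ->
  \sum_(a <= p < b) lp p ^+ 2 / p%:R ^+ 2 <= 12 * (1 + ln a%:R) / a%:R.
Proof.
move=> a0.
pose S c := \sum_(c <= p < b) lp p / p%:R ^+ 2.
pose V c := \sum_(c <= p < b) lp p * ln p%:R / p%:R ^+ 2.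
(* Downward induction on the lower end: from [c] to [c + 1] the reference logarithm moves by at most
   [1 / c], against a tail [S] of at most [12 / (c + 1)], and the product telescopes. *)
have H k c : (0 < c)%N -> (c + k = b)%N -> V c - ln c%:R * S c <= 12 / c%:R.
  elim: k c => [|k IH] c c0 cb.
    by rewrite /V /S !big_geq ?mulr0 ?subr0 ?divr_ge0 //; lia.
  have := IH c.+1 isT ltac:(lia).
  rewrite /V /S (@big_ltn _ _ _ c b) /=; last by lia.
  rewrite (@big_ltn _ _ _ c b) /=; last by lia.
  rewrite -/(V c.+1) -/(S c.+1).
  have h1 := lnS_sub c0.
  have h2 : 0 <= S c.+1 <= 12 / c.+1%:R.
    rewrite sum_lp_inv_sqr // andbT; apply: sumr_ge0 => p _.
    by rewrite mulr_ge0 ?lp_ge0 // invr_ge0 sqr_ge0.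
  have h3 : (ln c.+1%:R - ln c%:R) * S c.+1 <= c%:R^-1 * (12 / c.+1%:R).
    case/andP: h2 => h2 h2'; apply: ler_pM => //.
    by rewrite subr_ge0; exact: lnn_leS.
  have h4 : c%:R^-1 * (12 / c.+1%:R) = 12 / c%:R - 12 / c.+1%:R :> R.
    rewrite -(natr1 c); have : (0 : R) < c%:R by rewrite ltr0n.
    by move: (c%:R) => x x0; field; rewrite !gt_eqF //; lra.
  rewrite h4 in h3; move: h3.
  set l := ln _; set l' := ln _; set s := S _; set v := V _.
  set x := lp c; set y := _ / c.+1%:R; set z := _ / c%:R => h3 h5.
  have -> : x * l' / c%:R ^+ 2 + v - l' * (x / c%:R ^+ 2 + s) = v - l' * s by ring.
  lra.
have [ba|ab] := leqP b a.
  by rewrite big_geq // divr_ge0 // mulr_ge0 // addr_ge0 // lnn_ge0.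
have /= := H (b - a)%N a a0 ltac:(lia).
have SV := sum_lp_inv_sqr b a0; rewrite -/(S a) in SV.
have h : ln a%:R * S a <= ln a%:R * (12 / a%:R) by rewrite ler_wpM2l ?lnn_ge0.
have : \sum_(a <= p < b) lp p ^+ 2 / p%:R ^+ 2 <= V a.
  apply: ler_sum => p _; rewrite ler_wpM2r ?invr_ge0 ?sqr_ge0 // expr2 ler_wpM2l ?lp_ge0 //.
  exact: lp_le_ln.
have -> : 12 * (1 + ln a%:R) / a%:R = 12 / a%:R + ln a%:R * (12 / a%:R) :> R by ring.
lra.
Qed.

(** [n] times the sum is compared with [ln n!], itself [n ln n] up to [n]. Removing the floors in
    Legendre's formula costs [theta n <= 4 n]; the powers [p ^ k] with [k >= 2] cost at most
    [24 n]. *)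
Lemma mertens n : (0 < n)%N -> `|\sum_(0 <= p < n.+1) lp p / p%:R - ln n%:R| <= 26.
Proof.
move=> n0; have n0' : (0 : R) < n%:R by rewrite ltr0n.
set M := \sum_(_ <= _ < _) _.
have up : n%:R * M <= n%:R * ln n%:R + 4 * n%:R.
  apply: (@le_trans _ _ (ln ((n`!)%:R) + theta n)); last first.
    by rewrite lerD ?lnn_fact_le ?theta_le.
  rewrite legendre // /theta -big_split /= /M mulr_sumr.
  apply: ler_sum_nat => p /= _.
  rewrite -[X in _ + X]mulr1 -mulrDr [leLHS]mulrCA ler_wpM2l ?lp_ge0 //.
  have [->|p0] := posnP p; first by rewrite invr0 mulr0.
  rewrite ler_pdivrMr ?ltr0n // natr1 -natrM ler_nat.
  apply: (@leq_trans ((n %/ p).+1 * p)%N); first by apply: ltnW; rewrite ltn_ceil.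
  rewrite leq_mul2r ltnS; apply/orP; right.
  rewrite big_ltn // expn1; exact: leq_addr.
have lo : ln ((n`!)%:R) <= n%:R * M + n%:R * (2 * (12 / 1%:R)).
  apply: (@le_trans _ _ (n%:R * M + n%:R * (2 * \sum_(1 <= p < n.+1) lp p / p%:R ^+ 2))); last first.
    by rewrite lerD2l ler_pM2l // ler_pM2l // sum_lp_inv_sqr.
  rewrite legendre // /M !mulr_sumr.
  rewrite big_ltn // {1}/lp /= mul0r add0r [in leRHS]big_ltn // {1}/lp /= mul0r mulr0 add0r.
  rewrite -big_split /=; apply: ler_sum_nat => p /andP[p0 _].
  have -> : n%:R * (lp p / p%:R) + n%:R * (2 * (lp p / p%:R ^+ 2))
          = lp p * (n%:R * (p%:R^-1 + 2 * p%:R^-1 ^+ 2)) by rewrite exprVn; ring.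
  rewrite /lp; case: ifP => [pp|]; last by rewrite !mul0r.
  rewrite ler_wpM2l ?lnn_ge0 // natr_sum.
  apply: (@le_trans _ _ (\sum_(1 <= k < n.+1) n%:R * p%:R^-1 ^+ k)).
    apply: ler_sum_nat => k _; rewrite exprVn -natrX ler_pdivlMr ?ltr0n ?expn_gt0 ?prime_gt0 //.
    by rewrite -natrM ler_nat leq_trunc_div.
  rewrite -mulr_sumr ler_pM2l // big_ltn // expr1 lerD2l sum_geometric2 //.
  by rewrite ler_pdivrMr ?ltr0n // mul1r ler_nat prime_gt1.
have := lnn_fact_ge n0 => lo'.
have E : n%:R * (M - ln n%:R) = n%:R * M - n%:R * ln n%:R by rewrite mulrBr.
rewrite ler_norml -(ler_pM2l n0') -[X in _ && X](ler_pM2l n0') E; move: up lo lo'; rewrite divr1.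
set u := n%:R * M; set v := n%:R * ln _ => up lo lo'; apply/andP; split; lra.
Qed.

(** Summation by parts from [mertens]. One step changes the quantity in [H] by
    [(l' - l) * ((l' + l) / 2 - m)], where [m] is within 26 of [l], so the errors telescope to
    [30 ln n]; replacing [M n] by [ln n] costs another [26 ln n]. *)
Lemma mertens2 n : (0 < n)%N ->
  `|\sum_(0 <= p < n.+1) lp p ^+ 2 / p%:R - ln n%:R ^+ 2 / 2| <= 60 * ln n%:R.
Proof.
move=> n0.
pose M k := \sum_(0 <= p < k.+1) lp p / p%:R.
pose S k := \sum_(0 <= p < k.+1) lp p ^+ 2 / p%:R.
have H : `|S n - M n * ln n%:R + ln n%:R ^+ 2 / 2| <= 30 * ln n%:R.
  elim: n n0 => // -[_ _|n IH _].
    rewrite /S /M !big_nat_recl // !big_geq // /lp /= !ln1.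
    by rewrite !(mulr0, expr0n, mul0r, addr0, subr0) normr0.
  have {IH} := IH isT.
  rewrite /S /M !(@big_nat_recr _ _ _ n.+2) //= -/(S n.+1) -/(M n.+1).
  have -> : lp n.+2 ^+ 2 = lp n.+2 * ln n.+2%:R by rewrite /lp; case: ifP => _; [rewrite expr2|rewrite expr0n mul0r].
  have := @mertens n.+1 isT; rewrite -/(M n.+1).
  have := @lnS_sub n.+1 isT.
  have : n.+1%:R^-1 <= 1 :> R by rewrite invf_le1 ?ltr0n // ler1n.
  move: (n.+1%:R^-1) => i.
  have := lnn_leS n.+1.
  set l := ln _; set l' := ln _; set m := M _; set s := S _; set x := lp _; set q := n.+2%:R.
  move=> ll l1 l2 /ler_normlP[m1 m2] /ler_normlP[s1 s2].
  have d0 : 0 <= l' - l by lra.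
  have e1 : (l' - l) * ((l' + l) / 2 - m) <= (l' - l) * 30 by rewrite ler_wpM2l //; lra.
  have e2 : (l' - l) * (-30) <= (l' - l) * ((l' + l) / 2 - m) by rewrite ler_wpM2l //; lra.
  have E : s + x * l' / q - (m + x / q) * l' + l' ^+ 2 / 2
    = (s - m * l + l ^+ 2 / 2) + (l' - l) * ((l' + l) / 2 - m) by field.
  rewrite E; apply/ler_normlP; split; lra.
have := mertens n0; rewrite -/(M n) -/(S n) => /ler_normlP[m1 m2].
have l0 := @lnn_ge0 n.
have e1 : (M n - ln n%:R) * ln n%:R <= 26 * ln n%:R by rewrite ler_wpM2r.
have e2 : (ln n%:R - M n) * ln n%:R <= 26 * ln n%:R by rewrite ler_wpM2r //; lra.
move/ler_normlP: H => [h1 h2].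
apply/ler_normlP; split; lra.
Qed.

(** For [u] uniform on [[n]], [ln n - ln u] is close to an exponential variable, whose second moment
    is 2. The induction expands the square in the increment of the logarithm, and
    [n ln n - ln n! <= n - 1] controls the cross term. *)
Lemma sum_lnn_dev n : (0 < n)%N ->
  \sum_(1 <= u < n.+1) (ln n%:R - ln u%:R) ^+ 2 <= 2 * n%:R :> R.
Proof.
elim: n => // -[_ _|n IH _]; first by rewrite big_nat1 subrr expr0n /= mulr1.
rewrite big_nat_recr //= subrr expr0n addr0 /=.
set l := ln (n.+1%:R : R); set l' := ln (n.+2%:R : R).
have -> : \sum_(1 <= u < n.+2) (l' - ln u%:R) ^+ 2 =
   \sum_(1 <= u < n.+2) (l - ln u%:R) ^+ 2
   + 2 * (l' - l) * (n.+1%:R * l - ln ((n.+1)`!)%:R) + n.+1%:R * (l' - l) ^+ 2.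
    have -> : ln ((n.+1)`!)%:R = \sum_(1 <= u < n.+2) ln u%:R :> R.
    by rewrite fact_prod !big_add1 !big_mkord lnn_prod.
  have -> : n.+1%:R * l = \sum_(1 <= u < n.+2) l by rewrite sumr_const_nat subSS subn0 mulr_natl.
  have -> : n.+1%:R * (l' - l) ^+ 2 = \sum_(1 <= u < n.+2) (l' - l) ^+ 2 by rewrite sumr_const_nat subSS subn0 mulr_natl.
  rewrite -sumrB mulr_sumr -!big_split /=; apply: eq_bigr => u _; ring.
have N0 : (0 : R) < n.+1%:R by rewrite ltr0n.
have h1 := @lnS_sub n.+1 isT; rewrite -/l -/l' in h1.
have h0 : 0 <= l' - l by rewrite subr_ge0; exact: lnn_leS.
have h2 := @lnn_fact_ge n.+1 isT; rewrite -/l in h2.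
have h3 : n.+1%:R * (l' - l) <= 1 by rewrite -(ler_pM2l N0) mulfV ?gt_eqF // in h1.
have e1 : (l' - l) * (n.+1%:R * l - ln ((n.+1)`!)%:R) <= (l' - l) * (n.+1%:R - 1).
  by rewrite ler_wpM2l //; lra.
have e2 : n.+1%:R * (l' - l) ^+ 2 <= l' - l by rewrite expr2 mulrA ler_piMl.
have := IH isT; rewrite -[n.+2%:R]natr1; move: h3 e1 e2.
set x := n.+1%:R * (l' - l); set d := l' - l; set y := d * _; set z := _ * d ^+ 2.
set s := \sum_(_ <= _ < _) _.
have -> : (d * (n.+1%:R - 1)) = x - d by rewrite /x -/d; ring.
have -> : 2 * d * (n.+1%:R * l - ln ((n.+1)`!)%:R) = 2 * y by rewrite /y; ring.
rewrite -/d in h0; lra.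
Qed.


Lemma sum_min_inv_sqr (x : R) b : 0 <= x ->
  \sum_(1 <= p < b) Num.min 1 (x / p%:R ^+ 2) <= 3 * Num.sqrt x.
Proof.
move=> x0; set s := Num.sqrt x; have s0 : 0 <= s by rewrite sqrtr_ge0.
have sx : x = s ^+ 2 by rewrite sqr_sqrtr.
(* Up to [sqrt x] the terms are bounded by 1, beyond it by the tail of [x / p ^ 2]. *)
pose r := Num.truncn s; have [r1 r2] := andP (truncn_itv s0); rewrite -/r in r1 r2.
have F0 p : 0 <= Num.min 1 (x / p%:R ^+ 2).
  by rewrite le_min ler01 mulr_ge0 // invr_ge0 sqr_ge0.
have sr0 : 0 < r.+1%:R :> R by rewrite ltr0n.
apply: (@le_trans _ _ (\sum_(1 <= p < maxn b r.+1) Num.min 1 (x / p%:R ^+ 2))).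
  by apply: ler_sum_nat_widen; rewrite ?leq_maxl.
rewrite (@big_cat_nat _ _ _ r.+1) ?leq_maxr //=.
have h1 : \sum_(1 <= p < r.+1) Num.min 1 (x / p%:R ^+ 2) <= s.
  apply: le_trans r1; apply: (@le_trans _ _ (\sum_(1 <= p < r.+1) 1)).
    by apply: ler_sum => p _; rewrite ge_min lexx.
  by rewrite sumr_const_nat subSS subn0.
have h2 : \sum_(r.+1 <= p < maxn b r.+1) Num.min 1 (x / p%:R ^+ 2) <= 2 * s.
  apply: (@le_trans _ _ (\sum_(r.+1 <= p < maxn b r.+1) x * (p%:R ^+ 2)^-1)).
    by apply: ler_sum => p _; rewrite ge_min lexx orbT.
  rewrite -mulr_sumr; apply: (@le_trans _ _ (x * (2 / r.+1%:R))).
    by rewrite ler_wpM2l // sum_inv_sqr.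
  rewrite mulrA ler_pdivrMr // sx mulrC -mulrA ler_pM2l // expr2 ler_wpM2l //.
  exact: ltW.
by apply: (le_trans (lerD h1 h2)); lra.
Qed.

Lemma sum_inv_sqrt3 b : \sum_(1 <= p < b) (Num.sqrt p%:R ^+ 3)^-1 <= 3 :> R.
Proof.
have [b1|b1] := leqP b 1; first by rewrite big_geq.
suff : \sum_(1 <= p < b) (Num.sqrt p%:R ^+ 3)^-1 <= 3 - 2 * (Num.sqrt b.-1%:R)^-1 :> R.
  by move/le_trans; apply; rewrite gerBl mulr_ge0 // invr_ge0 sqrtr_ge0.
have -> : b = (b.-2.+2) by lia.
elim: (b.-2) => [|k IH]; first by rewrite big_nat1 /= sqrtr1 expr1n invr1; lra.
rewrite big_nat_recr //=; apply: (le_trans (lerD IH (lexx _))) => /=.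
have : 0 < Num.sqrt (k.+1%:R : R) by rewrite sqrtr_gt0 ltr0n.
have : Num.sqrt (k.+1%:R : R) < Num.sqrt k.+2%:R by rewrite ltr_sqrt ?ltr0n // ltr_nat.
have : Num.sqrt (k.+2%:R : R) ^+ 2 = Num.sqrt k.+1%:R ^+ 2 + 1 by rewrite !sqr_sqrtr ?ler0n // natr1.
move: (Num.sqrt _) => t; move: (Num.sqrt _) => s st s_t s0.
have t0 : 0 < t by lra.
rewrite -subr_ge0.
have -> : 3 - 2 * t^-1 - (3 - 2 * s^-1 + t ^- 3) = ((t - s) * 2 * t ^+ 2 - s) / (s * t ^+ 3).
  by field; rewrite !gt_eqF.
apply: mulr_ge0; last by rewrite invr_ge0 mulr_ge0 ?exprn_ge0 // ltW.
have e : (t - s) * (t + s) = 1 by rewrite -subr_sqr st; ring.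
have : s * ((t - s) * (t + s)) <= t * ((t - s) * (t + t)).
  apply: ler_pM; rewrite ?mulr_ge0 //; try lra.
  by rewrite ler_wpM2l; lra.
rewrite e; lra.
Qed.

Lemma sum_geometric_ge0 (x : R) a b : 0 <= x -> 4 * x <= 3 ->
  \sum_(a <= k < b) x ^+ k <= 4 * x ^+ a.
Proof.
move=> x0 x1; have [b2|b2] := leqP b a.
  by rewrite big_geq // mulr_ge0 // exprn_ge0.
suff : \sum_(a <= k < b) x ^+ k + 4 * x ^+ b <= 4 * x ^+ a.
  by apply: le_trans; rewrite lerDl mulr_ge0 // exprn_ge0.
rewrite -(subnK (ltnW b2)); elim: (b - a)%N => [|j IH]; first by rewrite add0n big_geq // add0r.
rewrite addSn big_nat_recr /= ?leq_addl //; apply: le_trans IH.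
rewrite -addrA lerD2l exprS; have : 0 <= x ^+ (j + a) by rewrite exprn_ge0.
set y := x ^+ _ => y0; have : 4 * x * y <= 3 * y by rewrite ler_wpM2r.
lra.
Qed.

(** With [x] the number of samples, [min 1 (x / p ^ k)] bounds the probability that [p ^ k] divides
    one of them. For [k >= 3] the minimum is at most [sqrt (x / p ^ k)], a geometric sequence of
    ratio [p ^ (-1/2) <= 3/4] with sum at most [4 sqrt x / p ^ (3/2)]; together with the term
    [k = 2] this gives the decreasing weight [w]. The constant is [80 = 4 * (5 + 3 + 12)]. *)
Lemma sum_lp_min_powers (x : R) b K : 1 <= x ->
  \sum_(1 <= p < b) lp p * (\sum_(2 <= k < K) Num.min 1 (x / p%:R ^+ k)) <= 80 * Num.sqrt x.
Proof.
move=> x1; set s := Num.sqrt x; have x0 : 0 <= x by lra.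
have s1 : 1 <= s by rewrite -sqrtr1 ler_wsqrtr.
have s0 : 0 <= s by lra.
have sx : x = s ^+ 2 by rewrite sqr_sqrtr.
pose w p : R := Num.min 1 (x / p%:R ^+ 2) + 4 * s * (Num.sqrt p%:R ^+ 3)^-1.
have [b1|b1] := leqP b 1; first by rewrite big_geq // mulr_ge0 // sqrtr_ge0.
apply: (@le_trans _ _ (\sum_(1 <= p < b) lp p * w p)).
  apply: ler_sum_nat => p /andP[p1 pb].
  rewrite {1 2}/lp; case: ifP => [pp|]; last by rewrite !mul0r.
  rewrite ler_wpM2l ?lnn_ge0 // /w.
  have p2 := prime_gt1 pp.
  have [K2|K2] := leqP K 2.
    rewrite big_geq // addr_ge0 ?mulr_ge0 ?invr_ge0 ?exprn_ge0 ?sqrtr_ge0 //.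
    by rewrite le_min ler01 mulr_ge0 // invr_ge0 sqr_ge0.
  rewrite big_ltn // lerD2l.
  set q := Num.sqrt p%:R.
  have q0 : 0 < q by rewrite sqrtr_gt0 ltr0n ltnW.
  have qp : p%:R = q ^+ 2 by rewrite sqr_sqrtr.
  apply: (@le_trans _ _ (\sum_(3 <= k < K) s * q^-1 ^+ k)).
    apply: ler_sum => k _; rewrite qp -exprM mulnC exprM sx -exprVn -exprMn -exprVn.
    set y := s * _; have y0 : 0 <= y by rewrite mulr_ge0 ?exprn_ge0 ?invr_ge0 // ltW.
    rewrite ge_min; have [y1|y1] := lerP 1 y; first by [].
    by rewrite expr2 ler_piMl ?orbT // ltW.
  rewrite -mulr_sumr -mulrA mulrCA ler_wpM2l //.
  rewrite -exprVn; apply: sum_geometric_ge0; first by rewrite invr_ge0 ltW.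
  have : 1 <= q * (3 / 4).
    rewrite -(@ler_sqr _ 1) ?nnegrE ?mulr_ge0 ?ltW // exprMn -qp.
    have : (2 : R) <= p%:R by rewrite ler_nat.
    lra.
  by move=> h; rewrite ler_pdivrMr //; lra.
apply: (le_trans (@sum_lp_comparison w 1 b (ltnW b1) _ _)).
- move=> p p1; rewrite addr_ge0 // ?le_min ?ler01 ?mulr_ge0 ?invr_ge0 ?exprn_ge0 ?sqrtr_ge0 //.
- move=> p p1; have p0 : (0 : R) < p%:R by rewrite ltr0n.
  have pS : (p%:R : R) <= p.+1%:R by rewrite ler_nat.
  rewrite lerD // ?ler_wpM2l ?mulr_ge0 //; last first.
  + rewrite lef_pV2 ?posrE ?exprn_gt0 ?sqrtr_gt0 ?ltr0n //.
    by rewrite lerXn2r ?nnegrE ?sqrtr_ge0 // ler_wsqrtr.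
  rewrite le_min ge_min lexx /= ge_min ler_wpM2l ?orbT //.
  by rewrite lef_pV2 ?posrE ?exprn_gt0 ?ltr0n // lerXn2r ?nnegrE.
rewrite /w big_split -mulr_sumr /= sqrtr1 expr1n !divr1 mul1r.
have := sum_min_inv_sqr b x0; rewrite -/s.
have h : 4 * s * (\sum_(1 <= p < b) (Num.sqrt p%:R ^+ 3)^-1) <= 4 * s * 3.
  by rewrite ler_wpM2l ?sum_inv_sqrt3 ?mulr_ge0.
have : Num.min 1 x <= 1 by rewrite ge_min lexx.
lra.
Qed.

End PrimeSums.

(** * Iterated expectations over uniform samples *)

(* The expectation of [G] at a list of [N] independent variables, each with
   expectation operator [A]. *)
Fixpoint iterE {R : realType} {V : Type} (A : (V -> R) -> R) (N : nat)
    (G : seq V -> R) : R :=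
  if N is N'.+1 then A (fun v => iterE A N' (fun s => G (v :: s))) else G [::].

Definition avg {R : realType} (n : nat) (f : nat -> R) : R :=
  (\sum_(1 <= u < n.+1) f u) / n%:R.

Notation iterU n := (iterE (avg n)).

Section Averages.
Context {R : realType}.
Implicit Types (n N a b : nat) (f g : nat -> R) (F G : seq nat -> R).

Lemma iterE_cat (V : Type) (A : (V -> R) -> R) a b (G : seq V -> R) :
  iterE A (a + b) G = iterE A a (fun s => iterE A b (fun t => G (s ++ t))).
Proof. by elim: a G => [|a IH] G //=; congr (A _); apply/funext => v; rewrite IH. Qed.

Lemma avgD n f g : avg n (fun u => f u + g u) = avg n f + avg n g.
Proof. by rewrite /avg big_split mulrDl. Qed.

Lemma avgZ n (c : R) f : avg n (fun u => c * f u) = c * avg n f.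
Proof. by rewrite /avg -mulr_sumr mulrA. Qed.

Lemma avgB n f g : avg n (fun u => f u - g u) = avg n f - avg n g.
Proof. by rewrite /avg sumrB mulrBl. Qed.

Lemma avg_cst n (c : R) : (0 < n)%N -> avg n (fun=> c) = c.
Proof.
by move=> n0; rewrite /avg sumr_const_nat subn1 /= -[c *+ n]mulr_natr mulfK // pnatr_eq0 -lt0n.
Qed.

Lemma eq_avg n f g : (forall u, (0 < u <= n)%N -> f u = g u) -> avg n f = avg n g.
Proof. by move=> fg; rewrite /avg; congr (_ / _); apply: eq_big_nat => u; rewrite ltnS => /fg. Qed.

Lemma ler_avg n f g : (forall u, (0 < u <= n)%N -> f u <= g u) -> avg n f <= avg n g.
Proof.
by move=> fg; rewrite /avg ler_wpM2r ?invr_ge0 // ler_sum_nat // => u; rewrite ltnS => /fg.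
Qed.

Lemma avg_sum (I : Type) (r : seq I) n (f : I -> nat -> R) :
  avg n (fun u => \sum_(i <- r) f i u) = \sum_(i <- r) avg n (f i).
Proof. by rewrite /avg exchange_big mulr_suml. Qed.

Lemma avg_ge0 n f : (forall u, (0 < u <= n)%N -> 0 <= f u) -> 0 <= avg n f.
Proof.
move=> f0; rewrite /avg mulr_ge0 ?invr_ge0 // big_nat; apply: sumr_ge0 => u.
by rewrite ltnS => /f0.
Qed.

Lemma iterUD n N F G : iterU n N (fun s => F s + G s) = iterU n N F + iterU n N G.
Proof.
elim: N F G => //= N IH F G; rewrite -avgD; congr (avg n _); apply/funext => v; exact: IH.
Qed.

Lemma iterUZ n N (c : R) F : iterU n N (fun s => c * F s) = c * iterU n N F.
Proof.
elim: N F => //= N IH F; rewrite -avgZ; congr (avg n _); apply/funext => v; exact: IH.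
Qed.

Lemma iterUB n N F G : iterU n N (fun s => F s - G s) = iterU n N F - iterU n N G.
Proof.
elim: N F G => //= N IH F G; rewrite -avgB; congr (avg n _); apply/funext => v; exact: IH.
Qed.

Lemma iterU_cst n N (c : R) : (0 < n)%N -> iterU n N (fun=> c) = c.
Proof. by move=> n0; elim: N => //= N ->; rewrite avg_cst. Qed.

Lemma iterU_sum (I : Type) (r : seq I) n N (F : I -> seq nat -> R) :
  iterU n N (fun s => \sum_(i <- r) F i s) = \sum_(i <- r) iterU n N (F i).
Proof.
elim: N F => //= N IH F; rewrite -avg_sum; congr (avg n _); apply/funext => v; exact: IH.
Qed.

Lemma ler_iterU n N F G :
  (forall s, size s = N -> all (fun u => 0 < u <= n)%N s -> F s <= G s) ->
  iterU n N F <= iterU n N G.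
Proof.
elim: N F G => /= [|N IH] F G FG; first exact: FG.
by apply: ler_avg => u u1; apply: IH => s sN sn; apply: FG => //=; rewrite ?sN // u1.
Qed.

Lemma eq_iterU n N F G :
  (forall s, size s = N -> all (fun u => 0 < u <= n)%N s -> F s = G s) ->
  iterU n N F = iterU n N G.
Proof. by move=> FG; apply/eqP; rewrite eq_le !ler_iterU // => s s1 s2; rewrite FG. Qed.

Lemma iterU_ge0 n N F :
  (forall s, size s = N -> all (fun u => 0 < u <= n)%N s -> 0 <= F s) ->
  0 <= iterU n N F.
Proof.
move=> F0; rewrite -(mul0r (iterU n N (fun=> 0))) -iterUZ; apply: ler_iterU => s s1 s2.
by rewrite mul0r F0.
Qed.

Lemma avg_iterU n N (G : nat -> seq nat -> R) :
  avg n (fun u => iterU n N (G u)) = iterU n N (fun s => avg n (G^~ s)).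
Proof.
rewrite /avg -iterU_sum [RHS](_ : _ = iterU n N (fun s => n%:R^-1 * \sum_(1 <= u < n.+1) G u s)).
  by rewrite iterUZ mulrC.
by congr (iterE _ _ _); apply/funext => s; rewrite mulrC.
Qed.

Lemma iterU_norm n N F : `|iterU n N F| <= iterU n N (fun s => `|F s|).
Proof.
apply/ler_normlP; split; last by apply: ler_iterU => s _ _; exact: ler_norm.
rewrite -mulN1r -iterUZ; apply: ler_iterU => s _ _; rewrite mulN1r -normrN; exact: ler_norm.
Qed.

Lemma avg_sqr_le n f (c : R) : (0 < n)%N ->
  avg n (fun u => f u ^+ 2) - avg n f ^+ 2 <= avg n (fun u => (f u - c) ^+ 2).
Proof.
move=> n0; have -> : avg n (fun u => (f u - c) ^+ 2) =
    avg n (fun u => f u ^+ 2) - 2 * c * avg n f + c ^+ 2.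
  rewrite -avgZ -avgB -[c ^+ 2 in RHS](@avg_cst n) // -avgD.
  by congr (avg n _); apply/funext => u; ring.
by rewrite -subr_ge0; have := sqr_ge0 (avg n f - c); rewrite sqrrB; lra.
Qed.

Lemma iterU_jensen n N F : (0 < n)%N -> iterU n N F ^+ 2 <= iterU n N (fun s => F s ^+ 2).
Proof.
move=> n0; rewrite -subr_ge0.
have := @iterU_ge0 n N (fun s => (F s - iterU n N F) ^+ 2) (fun s _ _ => sqr_ge0 _).
have -> : iterU n N (fun s => (F s - iterU n N F) ^+ 2) =
    iterU n N (fun s => F s ^+ 2) - 2 * iterU n N F * iterU n N F + iterU n N F ^+ 2.
  rewrite -iterUZ -iterUB -[X in _ = _ + X](@iterU_cst n N) // -iterUD.
  by congr (iterE _ _ _); apply/funext => u; ring.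
by rewrite -[2 * _ * _]mulrA -expr2; lra.
Qed.

(** The reference value for a coordinate is [G] with that coordinate deleted, not resampled, which
    is why [G] lives on lists of every length. The induction conditions on the first entry: the
    variance of the conditional mean is at most its mean square distance to the mean of [G] over
    lists shorter by one, and Jensen moves the square inside. *)
Lemma efron_stein n N G : (0 < n)%N ->
  iterU n N (fun s => G s ^+ 2) - iterU n N G ^+ 2 <=
  \sum_(0 <= j < N) iterU n j (fun s => iterU n (N - j.+1) (fun t =>
     avg n (fun u => (G (s ++ u :: t) - G (s ++ t)) ^+ 2))).
Proof.
move=> n0; elim: N G => [|N IH] G; first by rewrite big_geq //= subrr.
rewrite big_nat_recl //= subSS subn0.
set A := fun v => iterU n N (fun s => G (v :: s) ^+ 2).
set B := fun v => iterU n N (fun s => G (v :: s)).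
have h1 : avg n (fun v => A v - B v ^+ 2) <=
   \sum_(0 <= i < N) avg n (fun v => iterU n i (fun s => iterU n (N - i.+1) (fun t =>
      avg n (fun u => (G (v :: s ++ u :: t) - G (v :: s ++ t)) ^+ 2)))).
  by rewrite -avg_sum; apply: ler_avg => v _; exact: IH.
have h2 := @avg_sqr_le n B (iterU n N G) n0.
have h3 : avg n (fun v => (B v - iterU n N G) ^+ 2) <=
    iterU n N (fun t => avg n (fun u => (G (u :: t) - G t) ^+ 2)).
  rewrite -avg_iterU; apply: ler_avg => v _; rewrite /B -iterUB; exact: iterU_jensen.
move: h1; rewrite avgB; set S := \sum_(_ <= _ < _) _ => h1.
by apply: (@le_trans _ _ (iterU n N (fun t => avg n (fun u => (G (u :: t) - G t) ^+ 2)) + S)) => //; lra.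
Qed.

Lemma efron_stein_sym n N G : (0 < n)%N ->
  (forall s u t, G (s ++ u :: t) = G (u :: s ++ t)) ->
  iterU n N (fun s => G s ^+ 2) - iterU n N G ^+ 2 <=
  N%:R * iterU n N.-1 (fun s => avg n (fun u => (G (u :: s) - G s) ^+ 2)).
Proof.
move=> n0 Gs; apply: (le_trans (efron_stein _ _ n0)).
rewrite -[N in N%:R]subn0 mulr_natl -sumr_const_nat.
apply: ler_sum_nat => j jN; rewrite le_eqVlt; apply/orP; left; apply/eqP.
have -> : N.-1 = (j + (N - j.+1))%N by lia.
rewrite iterE_cat; congr (iterE _ _ _); apply/funext => s.
congr (iterE _ _ _); apply/funext => t; congr (avg n _); apply/funext => u.
by rewrite Gs.
Qed.

Lemma iterU_sumS n N f : (0 < n)%N ->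
  iterU n N (fun s => \sum_(u <- s) f u) = N%:R * avg n f.
Proof.
move=> n0; elim: N => [|N IH] /=; first by rewrite big_nil mul0r.
under eq_fun => v do (under eq_fun => s do rewrite big_cons; rewrite iterUD iterU_cst // IH).
by rewrite avgD avg_cst // -natr1; ring.
Qed.

Lemma iterU_sum_sqr n N f : (0 < n)%N ->
  iterU n N (fun s => (\sum_(u <- s) f u) ^+ 2) =
  N%:R * avg n (fun u => f u ^+ 2) + N%:R * (N%:R - 1) * avg n f ^+ 2.
Proof.
move=> n0; elim: N => [|N IH] /=; first by rewrite big_nil !mul0r expr0n addr0.
have E v : iterU n N (fun s => (\sum_(u <- v :: s) f u) ^+ 2) =
   f v ^+ 2 + 2 * (N%:R * avg n f) * f v + iterU n N (fun s => (\sum_(u <- s) f u) ^+ 2).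
  rewrite -iterU_sumS // -{1}[f v ^+ 2](@iterU_cst n N) // mulrAC -iterUZ -!iterUD.
  by congr (iterE _ _ _); apply/funext => s; rewrite big_cons; ring.
under eq_fun => v do rewrite E.
by rewrite !avgD avgZ avg_cst // IH -natr1; ring.
Qed.

Lemma iterU_all n N (Q : pred nat) : (0 < n)%N ->
  iterU n N (fun s => (all Q s)%:R) = (avg n (fun u => (Q u)%:R)) ^+ N :> R.
Proof.
move=> n0; elim: N => [|N IH] //=; rewrite exprS -IH mulrC -avgZ.
congr (avg n _); apply/funext => v; rewrite mulrC -iterUZ.
by congr (iterE _ _ _); apply/funext => s; rewrite -mulnb natrM.
Qed.

Lemma sum_dvd_mul n d f : (0 < d)%N ->
  \sum_(1 <= u < n.+1) (d %| u)%:R * f u = \sum_(1 <= v < (n %/ d).+1) f (d * v)%N.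
Proof.
move=> d0; elim: n => [|n IH]; first by rewrite div0n !big_geq.
rewrite big_nat_recr //= IH divnS //; case: (boolP (d %| n.+1)%N) => dn; last first.
  by rewrite mul0r addr0 add0n.
rewrite mul1r add1n [in RHS]big_nat_recr //=; congr (_ + f _).
have /divnK := dn; rewrite divnS // dn add1n => <-; lia.
Qed.

Lemma avg_dvd n d : (0 < d)%N -> avg n (fun u => (d %| u)%:R) = (n %/ d)%:R / n%:R :> R.
Proof. by move=> d0; rewrite /avg divn_count_dvd -natr_sum. Qed.

Lemma avg_dvd_le_inv n d : (0 < n)%N -> (0 < d)%N -> (n %/ d)%:R / n%:R <= d%:R^-1 :> R.
Proof.
move=> n0 d0; rewrite ler_pdivrMr ?ltr0n // mulrC ler_pdivlMr ?ltr0n //.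
by rewrite -natrM ler_nat leq_trunc_div.
Qed.

Lemma avg_dvd_ge_inv n d : (0 < n)%N -> (0 < d)%N ->
  d%:R^-1 - n%:R^-1 <= (n %/ d)%:R / n%:R :> R.
Proof.
move=> n0 d0; rewrite lerBlDr -{2}[n%:R^-1]mul1r -mulrDl natr1 ler_pdivlMr ?ltr0n //.
by rewrite mulrC ler_pdivrMr ?ltr0n // -natrM ler_nat ltnW // ltn_ceil.
Qed.

(** On the multiples of [d] the quotient is uniform on [[n / d]]; hence the bound on [f] is asked
    for all ranges [n'] at once. *)
Lemma avg_dvd_mul_le n d f (K : R) : (0 < n)%N -> (0 < d)%N -> 0 <= K ->
  (forall n', (0 < n')%N -> avg n' (fun v => f (d * v)%N) <= K) ->
  avg n (fun u => (d %| u)%:R * f u) <= d%:R^-1 * K.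
Proof.
move=> n0 d0 K0 H; rewrite /avg sum_dvd_mul //.
have [nd0|nd0] := posnP (n %/ d); first by rewrite nd0 big_geq // mul0r mulr_ge0 ?invr_ge0.
have E : (n %/ d)%:R / n%:R * avg (n %/ d) (fun v => f (d * v)%N) =
    (\sum_(1 <= v < (n %/ d).+1) f (d * v)%N) / n%:R.
  have d1 : (n %/ d)%:R != 0 :> R by rewrite pnatr_eq0 -lt0n.
  by rewrite /avg; field; rewrite d1 pnatr_eq0 -lt0n n0.
rewrite -E; apply: (@le_trans _ _ ((n %/ d)%:R / n%:R * K)).
  by rewrite ler_wpM2l ?H // mulr_ge0 ?invr_ge0.
by rewrite ler_wpM2r // avg_dvd_le_inv.
Qed.

(** The strongly additive function with value [a p * log p] at the primes [p < b]. *)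
Definition padd (b : nat) (a : nat -> R) (u : nat) : R :=
  \sum_(0 <= p < b) lp p * a p * (p %| u)%:R.

Lemma padd_ge0 b (a : nat -> R) u : (forall p, 0 <= a p) -> 0 <= padd b a u.
Proof. by move=> a0; apply: sumr_ge0 => p _; rewrite !mulr_ge0 ?lp_ge0. Qed.

Lemma padd_mul_prime b (a : nat -> R) p v : (forall p, 0 <= a p) -> prime p -> (p < b)%N ->
  padd b a (p * v)%N <= lp p * a p + padd b a v.
Proof.
move=> a0 pp pb; rewrite /padd (bigD1_seq p) ?mem_iota ?subn0 ?iota_uniq //=.
rewrite [in leRHS](bigD1_seq p) ?mem_iota ?subn0 ?iota_uniq //=.
rewrite dvdn_mulr // mulr1 lerD2l -[leLHS]add0r lerD //.
  by rewrite !mulr_ge0 ?lp_ge0.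
apply: ler_sum => q qp; rewrite {1 2}/lp; case: ifP => [pq|]; last by rewrite !mul0r.
rewrite Euclid_dvdM // [X in (X || _)%:R](_ : _ = false) //.
by rewrite dvdn_prime2 // (negbTE qp).
Qed.

Lemma lp_case (p : nat) : (lp p = 0 :> R) \/ prime p.
Proof. by rewrite /lp; case: (boolP (prime p)); [right|left]. Qed.

(** * Moments of strongly additive functions *)

Section PrimeAdditive.
Context (b : nat) (a : nat -> R) (a0 : forall p, 0 <= a p).
Let A := \sum_(0 <= p < b) lp p * a p / p%:R.
Let B := \sum_(0 <= p < b) (lp p * a p) ^+ 2 / p%:R.

Let A0 : 0 <= A.
Proof. by apply: sumr_ge0 => p _; rewrite !mulr_ge0 ?invr_ge0 ?lp_ge0. Qed.

Let B0 : 0 <= B.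
Proof. by apply: sumr_ge0 => p _; rewrite mulr_ge0 ?invr_ge0 ?sqr_ge0. Qed.

(** Moment recursion: substituting [u = p * v] on the multiples of [p] reduces a moment of [padd] to
    the next lower one over a shorter range, where [padd (p * v) <= lp p * a p + padd v]. *)
Lemma avg_padd_mul n (f : nat -> R) (K : nat -> R) : (0 < n)%N ->
  (forall p, prime p -> (p < b)%N -> 0 <= K p) ->
  (forall p n', prime p -> (p < b)%N -> (0 < n')%N -> avg n' (fun v => f (p * v)%N) <= K p) ->
  avg n (fun u => padd b a u * f u) <= \sum_(0 <= p < b) lp p * a p / p%:R * K p.
Proof.
move=> n0 K0 H.
rewrite [leLHS](_ : _ = \sum_(0 <= p < b) lp p * a p * avg n (fun u => (p %| u)%:R * f u)).
  apply: ler_sum_nat => p /= pb; have [->|pp] := lp_case p; first by rewrite !mul0r.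
  rewrite -[leRHS]mulrA ler_wpM2l ?mulr_ge0 ?lp_ge0 //.
  by apply: avg_dvd_mul_le => [//|||n' n'0]; [exact: prime_gt0|exact: K0|exact: H].
under [in RHS]eq_bigr do rewrite -avgZ.
rewrite -avg_sum; congr (avg n _); apply/funext => u.
by rewrite /padd mulr_suml; apply: eq_bigr => p _; rewrite mulrA.
Qed.

Lemma avg_padd1 n : (0 < n)%N -> avg n (padd b a) <= A.
Proof.
move=> n0; have := @avg_padd_mul n (fun=> 1) (fun=> 1) n0 (fun _ _ _ => ler01).
rewrite (_ : (fun u => padd b a u * 1) = padd b a); last by apply/funext => u; rewrite mulr1.
rewrite -mulr_suml mulr1; apply => p n' _ _ n'0; by rewrite avg_cst.
Qed.

Lemma avg_padd2 n : (0 < n)%N -> avg n (fun u => padd b a u ^+ 2) <= B + A ^+ 2.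
Proof.
move=> n0; have := @avg_padd_mul n (padd b a) (fun p => lp p * a p + A) n0.
rewrite (_ : \sum_(0 <= p < b) _ = B + A ^+ 2); last first.
  rewrite expr2 {2}/A mulr_suml -big_split /=; apply: eq_bigr => p _; ring.
under eq_fun do rewrite -expr2.
apply => [p pp pb|p n' pp pb n'0]; first by rewrite addr_ge0 // mulr_ge0 ?lp_ge0.
apply: (@le_trans _ _ (avg n' (fun v => lp p * a p + padd b a v))).
  by apply: ler_avg => u _; exact: padd_mul_prime.
by rewrite avgD avg_cst // lerD2l avg_padd1.
Qed.

Lemma avg_padd3 n (L : R) : (0 < n)%N -> (forall p, (p < b)%N -> lp p * a p <= L) -> 0 <= L ->
  avg n (fun u => padd b a u ^+ 3) <= A * (L ^+ 2 + 2 * L * A + (L * A + A ^+ 2)).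
Proof.
move=> n0 HL L0; have := @avg_padd_mul n (fun u => padd b a u ^+ 2)
  (fun p => L ^+ 2 + 2 * L * A + (L * A + A ^+ 2)) n0.
rewrite -mulr_suml -/A; under eq_fun do rewrite -exprS.
have BL : B <= L * A.
  rewrite /A mulr_sumr; apply: ler_sum_nat => p /= pb.
  by rewrite expr2 -mulrA ler_wpM2r ?HL // !mulr_ge0 ?lp_ge0 ?invr_ge0.
apply => [p pp pb|p n' pp pb n'0]; first by rewrite !addr_ge0 ?mulr_ge0 ?sqr_ge0.
apply: (@le_trans _ _ (avg n' (fun v => L ^+ 2 + 2 * L * padd b a v + padd b a v ^+ 2))).
  apply: ler_avg => u _; have h := padd_mul_prime u a0 pp pb.
  have h0 := padd_ge0 b u a0.
  apply: (@le_trans _ _ ((L + padd b a u) ^+ 2)); last by rewrite sqrrD; lra.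
  rewrite lerXn2r ?nnegrE ?padd_ge0 ?addr_ge0 //; apply: (le_trans h).
  by rewrite lerD2r HL.
rewrite !avgD avg_cst // avgZ; have := avg_padd1 n'0; have := avg_padd2 n'0 => h2 h1.
have : 2 * L * avg n' (padd b a) <= 2 * L * A by rewrite ler_wpM2l ?mulr_ge0.
lra.
Qed.

End PrimeAdditive.
End Averages.

(** * The least common multiple and its prime parts *)

Section LcmVariance.
Context {R : realType}.
Implicit Types (n N m d p q u : nat) (s : seq nat).

Lemma eq_ler (x y : R) : x = y -> x <= y.
Proof. by move=> ->. Qed.

Definition lcms s : nat := \big[lcmn/1%N]_(u <- s) u.

(** For samples in [[n]], the logarithm of the radical of their lcm. *)
Definition ppart n s : R := \sum_(0 <= p < n.+1) lp p * (has (dvdn p) s)%:R.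

(** [c_n] is the exact mean of this part, not of [Y_n]; the higher prime powers keep their mean as
    an error term. *)
Lemma iterU_ppart n N : (0 < n)%N -> iterU n N (ppart n) = cn R n N.
Proof.
move=> n0; rewrite /ppart iterU_sum /cn -(big_mkord (fun p => prime p)
  (fun p => ln p%:R * (1 - (1 - (n %/ p)%:R / n%:R) ^+ N))) /=.
rewrite [RHS]big_mkcond; apply: eq_big_nat => p _.
rewrite iterUZ /lp; case: ifP => [pp|]; last by rewrite mul0r.
congr (_ * _); have p0 := prime_gt0 pp.
rewrite (_ : (fun s => (has (dvdn p) s)%:R) =
    (fun s => 1 - (all (fun u => ~~ (p %| u)%N) s)%:R)); last first.
  apply/funext => s; rewrite all_predC; case: (has _ s) => /=; lra.
rewrite iterUB iterU_cst // iterU_all //; congr (_ - _ ^+ _).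
rewrite -avg_dvd // -[X in X - _](@avg_cst _ n) // -avgB.
by congr (avg n _); apply/funext => u; case: (p %| u)%N => /=; lra.
Qed.

Lemma lcms_gt0 n s : all (fun u => 0 < u <= n)%N s -> (0 < lcms s)%N.
Proof.
elim: s => [_|u s IH]; first by rewrite /lcms big_nil.
by rewrite /lcms big_cons lcmn_gt0 => /= /andP[/andP[-> _] /IH].
Qed.

Lemma has_prime_power n s p k : prime p -> (0 < k)%N -> all (fun u => 0 < u <= n)%N s ->
  has (dvdn (p ^ k)) s = (k <= logn p (lcms s))%N.
Proof.
move=> pp k0; elim: s => [|u s IH].
  by rewrite /lcms big_nil logn1; case: k k0.
rewrite /lcms big_cons => /= /andP[/andP[u0 _] us]; rewrite IH //.
have s0 := lcms_gt0 us.
by rewrite logn_lcm // leq_max pfactor_dvdn.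
Qed.

Lemma lnn_lcms n s : all (fun u => 0 < u <= n)%N s -> ln ((lcms s)%:R : R) =
  \sum_(0 <= p < n.+1) lp p * (\sum_(1 <= k < n.+1) (has (dvdn (p ^ k)) s)%:R).
Proof.
move=> sn; have s0 := lcms_gt0 sn.
have big_no p k : prime p -> (0 < k)%N -> (n < p ^ k)%N -> has (dvdn (p ^ k)) s = false.
  move=> pp k0 npk; apply/hasPn => u /(allP sn) /andP[u0 un]; rewrite gtnNdvd //.
  exact: leq_ltn_trans un npk.
have pn p k : prime p -> (n < k)%N -> (n < p ^ k)%N.
  move=> pp nk; apply: (ltn_trans nk); exact: (ltn_expl _ (prime_gt1 pp)).
rewrite (lnn_logn s0 (leq_maxr n (lcms s))) (@big_cat_nat _ _ _ n.+1) ?ltnS ?leq_maxl //=.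
rewrite [X in _ + X]big1_seq ?addr0; last first.
  move=> p /andP[_]; rewrite mem_index_iota => /andP[np _].
  have [->|pp] := @lp_case R p; first by rewrite mul0r.
  have := @has_prime_power n s p 1 pp isT sn; rewrite big_no ?expn1 //.
  by case: (logn p _) => // _; rewrite mulr0.
apply: eq_big_nat => p _; have [->|pp] := @lp_case R p; first by rewrite !mul0r.
congr (_ * _).
have ln : (logn p (lcms s) <= n)%N.
  rewrite leqNgt; apply/negP => h; have := has_prime_power pp (ltn0Sn n) sn.
  by rewrite h big_no // pn.
rewrite (@big_cat_nat _ _ _ (logn p (lcms s)).+1) //=.
rewrite [X in _ + X]big1_seq ?addr0; last first.
  move=> k /andP[_]; rewrite mem_index_iota => /andP[np _].
  by rewrite (has_prime_power pp _ sn) ?(leq_ltn_trans _ np) // leqNgt np.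
rewrite (eq_big_nat _ _ (F2 := fun=> 1)); last first.
  by move=> k /andP[k0 kl]; rewrite (has_prime_power pp k0 sn) -ltnS kl.
by rewrite sumr_const_nat subn1.
Qed.

Lemma iterU_has_le n N d : (0 < n)%N -> (0 < d)%N ->
  iterU n N (fun s => (has (dvdn d) s)%:R) <= N%:R / d%:R :> R.
Proof.
move=> n0 d0; apply: (@le_trans _ _ (N%:R * avg n (fun u => (d %| u)%:R))).
  rewrite -iterU_sumS //; apply: ler_iterU => s _ _.
  rewrite -natr_sum ler_nat; elim: s => [|u s IH]; rewrite ?big_nil ?big_cons //=.
  by case: (d %| u)%N => //=; rewrite add1n ltnS; case: has.
by rewrite ler_wpM2l // avg_dvd // avg_dvd_le_inv.
Qed.

Lemma ppart_le_lnn_lcms n s : all (fun u => 0 < u <= n)%N s -> ppart n s <= ln ((lcms s)%:R).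
Proof.
move=> sn; rewrite (lnn_lcms sn); apply: ler_sum_nat => p /= pn.
rewrite ler_wpM2l ?lp_ge0 //; case: n pn sn => [|n] pn sn.
  rewrite big_geq //; case: p pn => //= _; case: s sn => //= u s /andP[/andP[u0 u1]].
  by case: u u0 u1.
rewrite big_ltn // expn1 lerDl; apply: sumr_ge0 => k _; exact: ler0n.
Qed.

Lemma iterU_lnn_lcms_sub n N : (0 < n)%N -> (0 < N)%N ->
  iterU n N (fun s => ln ((lcms s)%:R) - ppart n s) <= 80 * Num.sqrt (N%:R : R).
Proof.
move=> n0 N0; apply: (le_trans _ (@sum_lp_min_powers R N%:R n.+1 n.+1 _)); last by rewrite ler1n.
rewrite (@eq_iterU _ _ _ _ (fun s => \sum_(1 <= p < n.+1) lp p *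
   (\sum_(2 <= k < n.+1) (has (dvdn (p ^ k)) s)%:R))); last first.
  move=> s _ sn; rewrite (lnn_lcms sn) /ppart -sumrB big_ltn //.
  rewrite {1 2}/lp /= !mul0r subrr add0r; apply: eq_big_nat => p _.
  by rewrite -mulrBr [in LHS]big_ltn ?ltnS // expn1 addrC addKr.
rewrite iterU_sum; apply: ler_sum_nat => p /andP[p0 _].
rewrite iterUZ ler_wpM2l ?lp_ge0 // iterU_sum; apply: ler_sum => k _.
(* The trivial bound 1 serves small [p ^ k], the union bound over the samples serves the others. *)
rewrite le_min; apply/andP; split.
  rewrite -[leRHS](@iterU_cst R n N 1 n0); apply: ler_iterU => s _ _.
  by rewrite lern1 leq_b1.
by rewrite -natrX; apply: iterU_has_le => //; rewrite expn_gt0 p0.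
Qed.

Lemma expr_onem_bound (x : R) k : 0 <= x <= 1 -> (1 - x) ^+ k * (1 + k%:R * x) <= 1.
Proof.
move=> /andP[x0 x1]; elim: k => [|k IH]; first by rewrite expr0 !mul0r addr0 mulr1.
apply: le_trans IH; rewrite exprSr -mulrA ler_wpM2l ?exprn_ge0 ?subr_ge0 //.
rewrite -natr1 -subr_ge0.
have -> : 1 + k%:R * x - (1 - x) * (1 + (k%:R + 1) * x) = (k%:R + 1) * x ^+ 2 by ring.
by rewrite mulr_ge0 ?sqr_ge0 // addr_ge0.
Qed.

(** For [p <= n] a sample is divisible by [p] with probability [a >= 1 / (2 p)], and
    [(1 - a) ^ N <= 1 / (1 + N a)]. Division by [p] makes the bound independent of [p], so that its
    sum against [log p] costs only Chebyshev's bound. *)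
Lemma iterU_all_ndvd_le n N p : (0 < p <= n)%N ->
  iterU n N (fun s => (all (fun u => ~~ (p %| u)%N) s)%:R) / p%:R <= 2 / N.+1%:R :> R.
Proof.
move=> /andP[p0 pn]; have n0 : (0 < n)%N by exact: leq_trans pn.
rewrite iterU_all //.
rewrite (_ : avg n _ = 1 - (n %/ p)%:R / n%:R); last first.
  rewrite -avg_dvd // -[X in X - _](@avg_cst _ n) // -avgB.
  by congr (avg n _); apply/funext => u; case: (p %| u)%N => /=; lra.
set a : R := _ / n%:R.
have a1 : a <= 1 by rewrite ler_pdivrMr ?ltr0n // mul1r ler_nat leq_div.
have P0 : 0 < p%:R :> R by rewrite ltr0n.
have a2 : 1 <= 2 * (p%:R * a).
  rewrite /a !mulrA ler_pdivlMr ?ltr0n // mul1r -!natrM ler_nat.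
  have := divn_eq n p; have := ltn_pmod n p0; have : (0 < n %/ p)%N by rewrite divn_gt0.
  nia.
have a0 : 0 <= a by rewrite mulr_ge0 ?invr_ge0.
have := @expr_onem_bound a N; rewrite a0 a1 => /(_ isT) H.
rewrite ler_pdivrMr // mulrAC ler_pdivlMr ?ltr0n //.
set y := (1 - a) ^+ N in H *; have y0 : 0 <= y by rewrite exprn_ge0 // subr_ge0.
apply: (@le_trans _ _ (y * (2 * p%:R * (1 + N%:R * a)))); last first.
  have := ler_wpM2l (ltW P0) H; lra.
rewrite ler_wpM2l // -natr1.
have h1 : 1 <= p%:R :> R by rewrite ler1n.
have : N%:R * 1 <= N%:R * (2 * (p%:R * a)) by rewrite ler_wpM2l.
lra.
Qed.

Definition Wlcm m n s : R := \sum_(0 <= p < n.+1)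
  lp p * ((has (dvdn p) s)%:R - (m < p)%N%:R * (count (dvdn p) s)%:R).

(** The cost of one more sample: it matters only at primes [p <= m] not yet hit and at primes
    [p > m] already hit. *)
Lemma Wlcm_cons m n u s : Wlcm m n (u :: s) - Wlcm m n s =
  padd n.+1 (fun p => (p <= m)%N%:R * (all (fun v => ~~ (p %| v)%N) s)%:R) u
  - padd n.+1 (fun p => (m < p)%N%:R * (has (dvdn p) s)%:R) u.
Proof.
rewrite /Wlcm /padd -!sumrB; apply: eq_bigr => p _ /=.
rewrite all_predC natrD ltnNge; case: (p <= m)%N; case: (p %| u)%N; case: (has _ s) => /=; ring.
Qed.

Lemma Wlcm_sym m n s u t : Wlcm m n (s ++ u :: t) = Wlcm m n (u :: s ++ t).
Proof.
apply: eq_bigr => p _ /=; rewrite !has_cat !count_cat /=.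
by rewrite orbCA addnCA.
Qed.

Lemma iterU_padd_small m n N : (0 < m <= n)%N ->
  iterU n N (fun s => avg n (fun u =>
    padd n.+1 (fun p => (p <= m)%N%:R * (all (fun v => ~~ (p %| v)%N) s)%:R) u ^+ 2))
  <= 216 * m%:R * (1 + ln (m%:R : R)) / N.+1%:R.
Proof.
move=> /andP[m0 mn]; have n0 : (0 < n)%N by exact: leq_trans mn.
have l0 := @lnn_ge0 R m.
pose J p s : R := (all (fun v => ~~ (p %| v)%N) s)%:R.
have cut (F : nat -> R) : \sum_(0 <= p < n.+1) (p <= m)%N%:R * F p = \sum_(0 <= p < m.+1) F p.
  rewrite (@big_cat_nat _ _ _ m.+1) //= ?ltnS // [X in _ + X]big1_seq ?addr0; last first.
    by move=> p /andP[_]; rewrite mem_index_iota => /andP[mp _]; rewrite leqNgt mp mul0r.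
  by apply: eq_big_nat => p /=; rewrite ltnS => ->; rewrite mul1r.
apply: (@le_trans _ _ (iterU n N (fun s => \sum_(0 <= p < m.+1)
    (lp p * ln m%:R + lp p * (26 * (1 + ln m%:R))) * (J p s / p%:R)))).
  apply: ler_iterU => s _ _.
  apply: (le_trans (@avg_padd2 R _ _ _ n n0)) => [p|]; first by rewrite mulr_ge0.
  apply: (@le_trans _ _ (\sum_(0 <= p < m.+1) lp p ^+ 2 * (J p s / p%:R) +
      (\sum_(0 <= p < m.+1) lp p * (J p s / p%:R)) ^+ 2)).
    apply: eq_ler; congr (_ + _ ^+ 2); rewrite -cut; apply: eq_bigr => p _; rewrite -/(J p s).
      by rewrite /J; case: (p <= m)%N; case: (all _ s) => /=; ring.
    by ring.
  under [in leRHS]eq_bigr do rewrite mulrDl.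
  rewrite big_split /= lerD //.
    apply: ler_sum_nat => p /= pm; rewrite ler_wpM2r ?mulr_ge0 ?invr_ge0 //.
    rewrite expr2 ler_wpM2l ?lp_ge0 //; apply: (le_trans (lp_le_ln p)).
    by have [->|p0] := posnP p; [rewrite ln0|apply: ler_lnn].
  (* One factor of the square of the random sum [S] is bounded outright by Mertens, so that the
     expectation left is linear in the events [J p]. *)
  rewrite expr2; set S := \sum_(_ <= _ < _) _.
  have S0 : 0 <= S by apply: sumr_ge0 => p _; rewrite !mulr_ge0 ?lp_ge0 ?invr_ge0.
  have SA : S <= 26 * (1 + ln m%:R).
    apply: (@le_trans _ _ (\sum_(0 <= p < m.+1) lp p / p%:R)).
      apply: ler_sum => p _; rewrite ler_wpM2l ?lp_ge0 // ler_piMl ?invr_ge0 //.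
      by rewrite /J lern1 leq_b1.
    by have := @mertens R m m0 => /ler_normlP[]; lra.
  apply: (@le_trans _ _ (26 * (1 + ln m%:R) * S)); first by rewrite ler_wpM2r.
  rewrite /S mulr_sumr; apply: eq_ler.
  by apply: eq_bigr => p _; ring.
rewrite iterU_sum.
(* Here 27 is 1 from the diagonal part plus 26 from Mertens, and [216 = 27 * 2 * 4]. *)
apply: (@le_trans _ _ (\sum_(0 <= p < m.+1) lp p * (27 * (1 + ln m%:R) * (2 / N.+1%:R)))).
  apply: ler_sum_nat => p /= pm; have [->|pp] := @lp_case R p.
    by rewrite !mul0r addr0 iterUZ !mul0r.
  rewrite iterUZ -mulrDr -mulrA ler_wpM2l ?lp_ge0 //.
  have J2 : iterU n N (fun s => J p s / p%:R) <= 2 / N.+1%:R.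
    under eq_fun do rewrite mulrC.
    rewrite iterUZ mulrC; apply: iterU_all_ndvd_le; rewrite prime_gt0 //=.
    by apply: leq_trans mn; rewrite -ltnS.
  have J0 : 0 <= iterU n N (fun s => J p s / p%:R).
    by apply: iterU_ge0 => s _ _; rewrite mulr_ge0 ?invr_ge0.
  apply: ler_pM => //; lra.
rewrite -mulr_suml -/(theta m).
have : theta m <= 4 * m%:R :> R by exact: theta_le.
have : 0 <= 27 * (1 + ln m%:R) * (2 / N.+1%:R) :> R by rewrite !mulr_ge0 ?invr_ge0 //; lra.
set z := 27 * _ * _ => z0 th; apply: (le_trans (ler_wpM2r z0 th)).
by apply: eq_ler; rewrite /z; ring.
Qed.

Lemma sum_lp_large (F : nat -> R) m n : (forall p, 0 <= F p) ->
  \sum_(0 <= p < n) (m < p)%N%:R * F p <= \sum_(m <= p < n) F p.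
Proof.
move=> F0; have [mn|mn] := leqP n m.
  rewrite [in leRHS]big_geq // big_nat big1 // => p /andP[_ pn].
  by rewrite ltnNge (leq_trans (ltnW pn) mn) mul0r.
rewrite (@big_cat_nat _ _ _ m) ?(ltnW mn) //= big_nat big1 ?add0r; last first.
  by move=> p /andP[_ pm]; rewrite ltnNge (ltnW pm) mul0r.
by apply: ler_sum => p _; rewrite ler_piMl // lern1 leq_b1.
Qed.

(** Bounding [has] by the number of multiples of [p] in [s] turns the first moment in [u] into a sum
    over [s] of the additive function with weights [1 / p]. Its second moment under independent
    samples is explicit, and the tails beyond [m] of [lp p / p ^ 2] and [lp p ^ 2 / p ^ 2] supply
    the powers of [m]. *)
Lemma iterU_padd_large m n N : (0 < m <= n)%N ->
  iterU n N (fun s => avg n (fun u =>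
    padd n.+1 (fun p => (m < p)%N%:R * (has (dvdn p) s)%:R) u ^+ 2))
  <= 24 * N%:R * (1 + ln (m%:R : R)) / m%:R + 144 * N%:R * (1 + N%:R) / m%:R ^+ 2.
Proof.
move=> /andP[m0 mn]; have n0 : (0 < n)%N by exact: leq_trans mn.
have l0 := @lnn_ge0 R m.
have M0 : 0 < m%:R :> R by rewrite ltr0n.
pose H p s : R := (has (dvdn p) s)%:R.
pose a p : R := (m < p)%N%:R / p%:R.
have a0 p : 0 <= a p by rewrite mulr_ge0 ?invr_ge0.
apply: (@le_trans _ _ (iterU n N (fun s => \sum_(0 <= p < n.+1)
    (m < p)%N%:R * (lp p ^+ 2 / p%:R) * H p s + (\sum_(u <- s) padd n.+1 a u) ^+ 2))).
  apply: ler_iterU => s _ _.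
  apply: (le_trans (@avg_padd2 R _ _ _ n n0)) => [p|]; first by rewrite mulr_ge0.
  rewrite lerD //.
    apply: ler_sum => p _; rewrite -/(H p s) /H.
    by apply: eq_ler; case: (m < p)%N; case: (has _ s) => /=; ring.
  rewrite lerXn2r ?nnegrE //.
  - by apply: sumr_ge0 => p _; rewrite !mulr_ge0 ?lp_ge0 ?invr_ge0.
  - by apply: sumr_ge0 => u _; exact: padd_ge0.
  rewrite /padd exchange_big /=; apply: ler_sum => p _.
  rewrite -mulr_sumr /a mulrA [leLHS](_ : _ = lp p * ((m < p)%N%:R / p%:R) * (has (dvdn p) s)%:R); last by ring.
  rewrite ler_wpM2l ?mulr_ge0 ?lp_ge0 ?invr_ge0 // -natr_sum ler_nat.
  elim: s => [|u s IH]; rewrite ?big_nil ?big_cons //=.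
  by case: (p %| u)%N => //=; rewrite add1n ltnS; case: has.
rewrite iterUD iterU_sum.
have h1 : \sum_(0 <= p < n.+1) iterU n N (fun s => (m < p)%N%:R * (lp p ^+ 2 / p%:R) * H p s)
    <= N%:R * (12 * (1 + ln m%:R) / m%:R).
  apply: (@le_trans _ _ (\sum_(0 <= p < n.+1) (m < p)%N%:R * (N%:R * (lp p ^+ 2 / p%:R ^+ 2)))).
    apply: ler_sum => p _; rewrite iterUZ -mulrA ler_wpM2l //.
    have [->|pp] := @lp_case R p; first by rewrite expr0n !mul0r mulr0.
    have := @iterU_has_le n N p n0 (prime_gt0 pp); rewrite -/(H p) => h.
    rewrite [leRHS](_ : _ = lp p ^+ 2 / p%:R * (N%:R / p%:R)); last by rewrite -exprVn; ring.
    by rewrite ler_wpM2l // mulr_ge0 ?sqr_ge0 ?invr_ge0.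
  apply: (le_trans (sum_lp_large _ _ _)) => [p|].
    by apply: mulr_ge0 => //; rewrite mulr_ge0 ?invr_ge0 ?sqr_ge0.
  by rewrite -mulr_sumr ler_wpM2l // sum_lp2_inv_sqr.
have hA : \sum_(0 <= p < n.+1) lp p * a p / p%:R <= 12 / m%:R.
  apply: le_trans (sum_lp_inv_sqr n.+1 m0).
  apply: le_trans (sum_lp_large _ _ _); last by move=> p; rewrite !mulr_ge0 ?lp_ge0 ?invr_ge0 ?sqr_ge0.
  by apply: ler_sum => p _; apply: eq_ler; rewrite /a -exprVn; ring.
have hA0 : 0 <= \sum_(0 <= p < n.+1) lp p * a p / p%:R.
  by apply: sumr_ge0 => p _; rewrite !mulr_ge0 ?lp_ge0 ?invr_ge0.
have hB : \sum_(0 <= p < n.+1) (lp p * a p) ^+ 2 / p%:R <= 12 * (1 + ln m%:R) / m%:R.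
  apply: le_trans (sum_lp2_inv_sqr n.+1 m0).
  apply: le_trans (sum_lp_large _ _ _); last by move=> p; rewrite mulr_ge0 ?invr_ge0 ?sqr_ge0.
  apply: ler_sum => p _; rewrite /a; case: (ltnP m p) => mp /=; last by rewrite !(mul0r, mulr0, expr0n).
  rewrite mul1r exprMn mul1r exprVn -[leRHS]mulr1 ler_wpM2l ?mulr_ge0 ?lp_ge0 ?invr_ge0 ?sqr_ge0 //.
  by rewrite invf_le1 ?ler1n ?ltr0n; lia.
have h2 := iterU_sum_sqr N (padd n.+1 a) n0.
have hp1 := @avg_padd1 R n.+1 a a0 n n0; have hp2 := @avg_padd2 R n.+1 a a0 n n0.
have hp0 : 0 <= avg n (padd n.+1 a) by apply: avg_ge0 => u _; exact: padd_ge0.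
have e1 : N%:R * avg n (fun u => padd n.+1 a u ^+ 2) <=
   N%:R * (12 * (1 + ln m%:R) / m%:R + (12 / m%:R) ^+ 2).
  rewrite ler_wpM2l //; apply: (le_trans hp2); rewrite lerD // lerXn2r ?nnegrE // mulr_ge0 ?invr_ge0.
have e2 : N%:R * (N%:R - 1) * avg n (padd n.+1 a) ^+ 2 <= N%:R * N%:R * (12 / m%:R) ^+ 2.
  apply: (@le_trans _ _ (N%:R * N%:R * avg n (padd n.+1 a) ^+ 2)).
    by rewrite ler_wpM2r ?sqr_ge0 // ler_wpM2l // gerBl.
  rewrite ler_wpM2l ?mulr_ge0 // lerXn2r ?nnegrE // ?mulr_ge0 ?invr_ge0 //.
  exact: le_trans hp1 hA.
rewrite h2; apply: (le_trans (lerD h1 (lerD e1 e2))).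
have mr : m%:R != 0 :> R by rewrite gt_eqF.
by apply: eq_ler; field; rewrite mr.
Qed.

(** Efron-Stein multiplies by [N] the cost of adding a sample to [N - 1] others. For small primes
    that cost carries [1 / N], so [N] cancels and the bound survives for few samples, when many
    small primes are still unhit. The constants satisfy [432 + 48 + 288 <= 1200]. *)
Lemma Wlcm_variance m n N (t : R) : (0 < m <= n)%N -> (0 < N)%N -> 1 <= t ->
  N%:R <= t * m%:R ->
  iterU n N (fun s => Wlcm m n s ^+ 2) - iterU n N (Wlcm m n) ^+ 2 <=
  1200 * t ^+ 3 * (m%:R * (1 + ln m%:R)).
Proof.
move=> mn N0 t1 Nt; have /andP[m0 mn'] := mn.
have n0 : (0 < n)%N by exact: leq_trans mn'.
apply: (le_trans (efron_stein_sym N n0 (Wlcm_sym m n))).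
have := iterU_padd_large N.-1 mn; have := iterU_padd_small N.-1 mn.
set X := iterU _ _ _; set Y := iterU _ _ _; rewrite prednK // => hX hY.
set Z := iterU _ _ _; have ZXY : Z <= 2 * X + 2 * Y.
  rewrite /X /Y -!iterUZ -iterUD; apply: ler_iterU => s _ _.
  rewrite -!avgZ -avgD; apply: ler_avg => u _; rewrite Wlcm_cons.
  set x := padd _ _ _; set y := padd _ _ _.
  have := sqr_ge0 (x + y); rewrite sqrrD sqrrB; lra.
have l0 := @lnn_ge0 R m; set l := 1 + ln m%:R in hX hY *.
have M0 : 0 < m%:R :> R by rewrite ltr0n.
have N0' : 0 < N%:R :> R by rewrite ltr0n.
have Np : N.-1%:R <= N%:R :> R by rewrite ler_nat leq_pred.
have Np1 : 1 + N.-1%:R = N%:R :> R by rewrite -{2}(prednK N0) -natr1 addrC.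
have l1 : 1 <= l by rewrite /l; lra.
have {l0} l0 : 0 <= l by lra.
have t0 : 0 <= t by lra.
pose r : R := N%:R / m%:R; have Er : N%:R = r * m%:R by rewrite /r divfK // gt_eqF.
have r0 : 0 <= r by rewrite mulr_ge0 ?invr_ge0 // ltW.
have rt : r <= t by rewrite ler_pdivrMr.
have hY' : Y <= 24 * r * l + 144 * r ^+ 2.
  apply: (le_trans hY); rewrite Np1; apply: lerD.
    rewrite -mulrA mulrAC /r mulrA -mulrA [leRHS]mulrAC.
    rewrite [leLHS](_ : _ = 24 * l * (N.-1%:R / m%:R)); last by ring.
    rewrite [leRHS](_ : _ = 24 * l * (N%:R / m%:R)); last by ring.
    by rewrite ler_wpM2l ?mulr_ge0 ?ler_wpM2r ?invr_ge0.
  rewrite [leRHS](_ : _ = 144 * N%:R * N%:R / m%:R ^+ 2); last by rewrite /r exprMn -exprVn; ring.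
  rewrite ler_wpM2r ?invr_ge0 ?exprn_ge0 // -!mulrA ler_wpM2l // ler_wpM2r //.
apply: (@le_trans _ _ (N%:R * (2 * (216 * m%:R * l / N%:R) + 2 * (24 * r * l + 144 * r ^+ 2)))).
  rewrite ler_wpM2l //; lra.
rewrite [leLHS](_ : _ = m%:R * (432 * l + (48 * r ^+ 2 * l + 288 * r ^+ 3))); last first.
  have [mr nr] : m%:R != 0 :> R /\ r != 0 by rewrite !gt_eqF ?divr_gt0.
  by rewrite Er; field; rewrite mr nr.
rewrite [leRHS](_ : _ = m%:R * (1200 * t ^+ 3 * l)); last by ring.
rewrite ler_wpM2l //.
have t2 : r ^+ 2 <= t ^+ 2 by rewrite lerXn2r ?nnegrE //; lra.
have t3 : r ^+ 3 <= t ^+ 3 by rewrite lerXn2r ?nnegrE //; lra.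
have t4 : t ^+ 2 <= t ^+ 3 by rewrite ler_weXn2l.
have t5 : 1 <= t ^+ 3 by rewrite exprn_ege1.
have e1 : l <= t ^+ 3 * l := ler_peMl l0 t5.
have e2 : r ^+ 2 * l <= t ^+ 3 * l := ler_wpM2r l0 (le_trans t2 t4).
have e3 : r ^+ 3 * 1 <= t ^+ 3 * l := ler_pM (exprn_ge0 _ r0) ler01 t3 l1.
have e4 : 0 <= t ^+ 3 * l := mulr_ge0 (exprn_ge0 _ t0) l0.
clear -e1 e2 e3 e4; lra.
Qed.

End LcmVariance.

(** * Moments of sums over the prime divisors of a uniform integer *)

Section AdditiveMoments.
Context {R : realType}.
Implicit Types (n N m d p q u : nat) (s : seq nat).

Local Notation one := (fun _ : nat => 1 : R).

Lemma lp_le_lnn p m : (p <= m)%N -> lp p <= ln (m%:R : R).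
Proof.
move=> pm; apply: (le_trans (lp_le_ln p)).
by have [->|p0] := posnP p; [rewrite ln0 // lnn_ge0|apply: ler_lnn].
Qed.

(** Rounding [n / (p q)] costs [1 / n] per pair, in total [theta m ^ 2 / n <= 16], thanks to
    [m ^ 2 <= n]. Up to [O(1 + ln m)] the divisibility events thus behave as independent ones, with
    variance the sum of [lp p ^ 2 / p], which [mertens2] evaluates. *)
Lemma small_primes_variance m n : (0 < m)%N -> (m ^ 2 <= n)%N ->
  `|avg n (fun u => padd m.+1 one u ^+ 2) - avg n (padd m.+1 one) ^+ 2
     - ln (m%:R : R) ^+ 2 / 2| <= 300 * (1 + ln m%:R).
Proof.
move=> m0 mn2; have mn : (m <= n)%N by apply: leq_trans mn2; rewrite expnS leq_pmulr ?expn_gt0 ?m0.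
have n0 : (0 < n)%N by exact: leq_trans mn.
have N0 : 0 < n%:R :> R by rewrite ltr0n.
have l0 := @lnn_ge0 R m.
pose A : R := \sum_(0 <= p < m.+1) lp p / p%:R.
pose B : R := \sum_(0 <= p < m.+1) lp p ^+ 2 / p%:R.
pose C : R := \sum_(0 <= p < m.+1) lp p ^+ 2 / p%:R ^+ 2.
have A0 : 0 <= A by apply: sumr_ge0 => p _; rewrite mulr_ge0 ?lp_ge0 ?invr_ge0.
have hA : A <= ln m%:R + 26 by have /ler_normlP[] := @mertens R m m0; rewrite -/A; lra.
have hB := @mertens2 R m m0; rewrite -/B in hB.
have hC : C <= 12.
  rewrite /C big_ltn // {1}/lp /= expr0n mul0r add0r.
  have := @sum_lp2_inv_sqr R 1 m.+1 isT; rewrite ln1; lra.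
have th0 := @theta_ge0 R m.
have th : theta m / n%:R <= 4 :> R.
  rewrite ler_pdivrMr //; apply: (le_trans (theta_le m)).
  by rewrite ler_pM2l // ler_nat.
have th2 : theta m ^+ 2 / n%:R <= 16 :> R.
  rewrite ler_pdivrMr //; apply: (@le_trans _ _ ((4 * m%:R) ^+ 2)).
    by rewrite lerXn2r ?nnegrE ?mulr_ge0 // theta_le.
  rewrite exprMn -natrX; have : (m ^ 2)%:R <= n%:R :> R by rewrite ler_nat.
  lra.
have E1 : avg n (padd m.+1 one) = \sum_(0 <= p < m.+1) lp p * ((n %/ p)%:R / n%:R).
  rewrite /padd avg_sum; apply: eq_big_nat => p _.
  have [->|pp] := @lp_case R p; last by rewrite mulr1 avgZ avg_dvd // prime_gt0.
  by rewrite /avg big1 ?mul0r // => u _; rewrite !mul0r.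
have e1 : avg n (padd m.+1 one) <= A.
  rewrite E1; apply: ler_sum => p _; rewrite ler_wpM2l ?lp_ge0 //.
  by case: (posnP p) => [->|p0]; [rewrite divn0 mul0r invr0|apply: avg_dvd_le_inv].
have e2 : A - theta m / n%:R <= avg n (padd m.+1 one).
  rewrite E1 /A /theta mulr_suml -sumrB; apply: ler_sum => p _; rewrite -mulrBr.
  have [->|pp] := @lp_case R p; first by rewrite !mul0r.
  by rewrite ler_wpM2l ?lp_ge0 // avg_dvd_ge_inv // prime_gt0.
have e0 : 0 <= avg n (padd m.+1 one) by apply: avg_ge0 => u _; apply: padd_ge0.
have e3 : avg n (fun u => padd m.+1 one u ^+ 2) <= B + A ^+ 2.
  apply: (le_trans (@avg_padd2 R _ _ (fun=> ler01) n n0)); apply: eq_ler.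
  by congr (_ + _ ^+ 2); apply: eq_bigr => p _; rewrite mulr1.
have e4 : A ^+ 2 - theta m ^+ 2 / n%:R + (B - C) <= avg n (fun u => padd m.+1 one u ^+ 2).
  have -> : avg n (fun u => padd m.+1 one u ^+ 2) = \sum_(0 <= p < m.+1) \sum_(0 <= q < m.+1)
      lp p * lp q * avg n (fun u => (p %| u)%N%:R * (q %| u)%N%:R).
    rewrite (_ : (fun u => _) = (fun u => \sum_(0 <= p < m.+1) \sum_(0 <= q < m.+1)
       lp p * lp q * ((p %| u)%N%:R * (q %| u)%N%:R))); last first.
      apply/funext => u; rewrite expr2 /padd mulr_suml; apply: eq_bigr => p _.
      by rewrite mulr_sumr; apply: eq_bigr => q _; rewrite !mulr1; ring.
    rewrite avg_sum; apply: eq_bigr => p _; rewrite avg_sum; apply: eq_bigr => q _.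
    by rewrite avgZ.
  (* [A ^ 2] contributes [1 / p ^ 2] on the diagonal, as if [p = q] were independent events; the
     term with [p == q] restores [1 / p]. *)
  have -> : A ^+ 2 - theta m ^+ 2 / n%:R + (B - C) =
     \sum_(0 <= p < m.+1) \sum_(0 <= q < m.+1) (lp p * lp q * (p%:R^-1 * q%:R^-1 - n%:R^-1)
       + (p == q)%:R * (lp p ^+ 2 * (p%:R^-1 - p%:R^-1 ^+ 2))).
    under [RHS]eq_bigr => p _ do rewrite big_split /=.
    rewrite big_split /=; congr (_ + _).
      rewrite expr2 /A /theta expr2 !mulr_suml -sumrB; apply: eq_bigr => p _.
      by rewrite !mulr_sumr mulr_suml -sumrB; apply: eq_bigr => q _; ring.
    rewrite /B /C -sumrB; apply: eq_big_nat => p /= pm.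
    rewrite (bigD1_seq p) ?mem_iota ?subn0 ?iota_uniq //= eqxx mul1r big1 ?addr0.
      by rewrite -exprVn; ring.
    by move=> q; rewrite eq_sym => /negbTE ->; rewrite mul0r.
  apply: ler_sum => p _; apply: ler_sum => q _.
  have [->|pp] := @lp_case R p; first by rewrite expr0n !(mul0r, mulr0) addr0.
  have [E|pq] := @lp_case R q.
    have [pq|_] := eqVneq p q; last by rewrite E !(mul0r, mulr0) addr0.
    by rewrite pq E expr0n !(mul0r, mulr0) addr0.
  have p0 := prime_gt0 pp; have q0 := prime_gt0 pq.
  have [<-|npq] := eqVneq p q.
    rewrite mul1r -expr2 -mulrDr ler_wpM2l ?sqr_ge0 //.
    apply: (@le_trans _ _ (p%:R^-1 - n%:R^-1)); first by apply: eq_ler; ring.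
    apply: (le_trans (avg_dvd_ge_inv n0 p0)); rewrite -avg_dvd //; apply: ler_avg => u _.
    by case: (p %| u)%N; rewrite /= ?mul1r ?mul0r.
  rewrite mul0r addr0 ler_wpM2l ?mulr_ge0 ?lp_ge0 //.
  have pq0 : (0 < p * q)%N by rewrite muln_gt0 p0.
  rewrite -invfM -natrM; apply: (le_trans (avg_dvd_ge_inv n0 pq0)).
  rewrite -avg_dvd //; apply: ler_avg => u _; rewrite -natrM ler_nat mulnb.
  case: (boolP (p * q %| u)%N) => // pqu.
  by rewrite (dvdn_trans (dvdn_mulr q (dvdnn p)) pqu) (dvdn_trans (dvdn_mull p (dvdnn q)) pqu).
have f1 : avg n (padd m.+1 one) ^+ 2 <= A ^+ 2 by rewrite lerXn2r ?nnegrE.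
have f2 : A ^+ 2 - 2 * A * (theta m / n%:R) <= avg n (padd m.+1 one) ^+ 2.
  have [h|h] := lerP 0 (A - theta m / n%:R).
    apply: (@le_trans _ _ ((A - theta m / n%:R) ^+ 2)); last by rewrite lerXn2r ?nnegrE.
    rewrite -subr_ge0.
    have -> : (A - theta m / n%:R) ^+ 2 - (A ^+ 2 - 2 * A * (theta m / n%:R)) = (theta m / n%:R) ^+ 2 by ring.
    exact: sqr_ge0.
  apply: le_trans (sqr_ge0 _).
  have -> : A ^+ 2 - 2 * A * (theta m / n%:R) = A * (A - 2 * (theta m / n%:R)) by ring.
  by rewrite mulr_ge0_le0 //; have := divr_ge0 th0 (ltW N0); lra.
have f3 : A * (theta m / n%:R) <= (ln m%:R + 26) * 4.
  by apply: ler_pM => //; rewrite mulr_ge0 ?invr_ge0 // ltW.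
move/ler_normlP: hB => [hB1 hB2].
rewrite ler_norml; apply/andP; split.
  clear -e4 f1 hB1 hC th2 l0; lra.
clear -e3 f2 f3 hB2 l0; lra.
Qed.

Lemma small_primes_moment3 m n : (0 < m)%N -> (0 < n)%N ->
  avg n (fun u => padd m.+1 one u ^+ 3) <= 20000 * (1 + ln (m%:R : R)) ^+ 3.
Proof.
move=> m0 n0; have l0 := @lnn_ge0 R m.
apply: (le_trans (@avg_padd3 R _ _ (fun=> ler01) n (ln m%:R) n0 _ l0)).
  by move=> p pm; rewrite mulr1; exact: lp_le_lnn.
set A : R := \sum_(_ <= _ < _) _.
have A0 : 0 <= A by apply: sumr_ge0 => p _; rewrite !mulr_ge0 ?lp_ge0 ?invr_ge0.
have hA : A <= 26 * (1 + ln m%:R).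
  have /ler_normlP[_] := @mertens R m m0.
  rewrite (_ : \sum_(_ <= _ < _) _ = A); first lra.
  by apply: eq_bigr => p _; rewrite mulr1.
set l := 1 + ln m%:R in hA *; have l1 : ln m%:R <= l by rewrite /l; lra.
have l2 : 0 <= l by lra.
set k := ln m%:R in l0 l1 *.
apply: (@le_trans _ _ (26 * l * (l ^+ 2 + 2 * l * (26 * l) + (l * (26 * l) + (26 * l) ^+ 2)))).
  apply: ler_pM => //.
    by rewrite !addr_ge0 ?mulr_ge0 ?sqr_ge0.
  have h1 : k ^+ 2 <= l ^+ 2 by rewrite lerXn2r ?nnegrE.
  have h2 : k * A <= l * (26 * l) by apply: ler_pM.
  have h3 : A ^+ 2 <= (26 * l) ^+ 2 by rewrite lerXn2r ?nnegrE // mulr_ge0.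
  clear -h1 h2 h3; lra.
have : 0 <= l ^+ 3 by rewrite exprn_ge0.
lra.
Qed.

Lemma sum_mul_geometric2 (x : R) b : 0 <= x -> 2 * x <= 1 ->
  \sum_(2 <= k < b) k%:R * x ^+ k <= 6 * x ^+ 2.
Proof.
move=> x0 x1; have [b2|b2] := leqP b 2.
  by rewrite big_geq // mulr_ge0 // exprn_ge0.
suff : \sum_(2 <= k < b) k%:R * x ^+ k + (2 * b%:R + 2) * x ^+ b <= 6 * x ^+ 2.
  by apply: le_trans; rewrite lerDl mulr_ge0 ?exprn_ge0 // addr_ge0 // mulr_ge0.
rewrite -(subnK (ltnW b2)); elim: (b - 2)%N => [|j IH].
  by rewrite add0n big_geq // add0r ler_wpM2r ?exprn_ge0 //; lra.
rewrite addSn big_nat_recr /= ?leq_addl //; apply: le_trans IH.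
rewrite -addrA lerD2l exprS -(natr1 (j + 2)); have : 0 <= x ^+ (j + 2) by rewrite exprn_ge0.
have : 0 <= (j + 2)%:R :> R by [].
move: ((j + 2)%:R) (x ^+ (j + 2)) => c y c0 y0.
have : (2 * (c + 1) + 2) * (2 * x) * y <= (2 * (c + 1) + 2) * 1 * y.
  by rewrite ler_wpM2r // ler_wpM2l //; lra.
lra.
Qed.

(** When all primes of [u] lie below [b], this is [log (u / rad u)]. *)
Definition powerful b u : R := \sum_(0 <= p < b) lp p * ((logn p u).-1)%:R.

Lemma powerful_ge0 b u : 0 <= powerful b u.
Proof. by apply: sumr_ge0 => p _; rewrite mulr_ge0 ?lp_ge0. Qed.

Lemma powerful_mul b p k v : prime p -> (p < b)%N -> (0 < v)%N ->
  powerful b (p ^ k * v) <= k%:R * lp p + powerful b v.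
Proof.
move=> pp pb v0; have pk0 : (0 < p ^ k)%N by rewrite expn_gt0 prime_gt0.
rewrite /powerful (bigD1_seq p) ?mem_iota ?subn0 ?iota_uniq //=.
rewrite [in leRHS](bigD1_seq p) ?mem_iota ?subn0 ?iota_uniq //= addrA lerD //.
  rewrite [leRHS](_ : _ = lp p * (k + (logn p v).-1)%:R); last by rewrite natrD; ring.
  rewrite ler_wpM2l ?lp_ge0 // ler_nat.
  have -> : logn p (p ^ k * v) = (k + logn p v)%N by rewrite (lognM p pk0 v0) pfactorK.
  lia.
apply: ler_sum => q qp; have [->|pq] := @lp_case R q; first by rewrite !mul0r.
by rewrite (lognM q pk0 v0) lognX logn_prime // (negbTE qp) muln0.
Qed.

Lemma lognn_pred n p u : prime p -> (0 < u <= n)%N ->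
  ((logn p u).-1)%:R = \sum_(2 <= k < n.+1) (p ^ k %| u)%N%:R :> R.
Proof.
move=> pp /andP[u0 un].
have Ln : (logn p u < n.+1)%N.
  rewrite ltnS; apply: leq_trans un; rewrite ltnW //.
  by apply: (leq_trans (ltn_expl _ (prime_gt1 pp))); rewrite dvdn_leq // pfactor_dvdnn.
have [L1|L1] := leqP (logn p u) 1.
  rewrite big1_seq; first by case: (logn p u) L1 => [|[|]].
  move=> k /andP[_]; rewrite mem_index_iota pfactor_dvdn // => /andP[k2 _].
  by rewrite leqNgt (leq_trans _ k2).
have L2 : (2 <= (logn p u).+1)%N by rewrite ltnS ltnW.
rewrite (@big_cat_nat _ _ _ (logn p u).+1) //=.
rewrite [X in _ + X]big1_seq ?addr0; last first.
  by move=> k /andP[_]; rewrite mem_index_iota pfactor_dvdn // => /andP[kL _]; rewrite leqNgt kL.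
rewrite (eq_big_nat _ _ (F2 := fun=> 1)).
  by rewrite sumr_const_nat subSS subn1.
by move=> k /andP[_]; rewrite ltnS pfactor_dvdn // => ->.
Qed.

(** The recursion of [avg_padd_mul] over prime powers: [(logn p u).-1] counts the [k >= 2] with
    [p ^ k] dividing [u]. *)
Lemma avg_powerful_mul b n (f : nat -> R) (K : nat -> nat -> R) : (0 < n)%N ->
  (forall p k, prime p -> (p < b)%N -> 0 <= K p k) ->
  (forall p k n', prime p -> (p < b)%N -> (0 < n')%N ->
     avg n' (fun v => f (p ^ k * v)%N) <= K p k) ->
  avg n (fun u => powerful b u * f u) <=
  \sum_(0 <= p < b) lp p * \sum_(2 <= k < n.+1) p%:R^-1 ^+ k * K p k.
Proof.
move=> n0 K0 H.
rewrite (@eq_avg _ _ _ (fun u => \sum_(0 <= p < b) \sum_(2 <= k < n.+1)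
    lp p * ((p ^ k %| u)%N%:R * f u))); last first.
  move=> u un; rewrite /powerful mulr_suml; apply: eq_bigr => p _.
  have [->|pp] := @lp_case R p; first by rewrite !mul0r big1 // => k _; rewrite mul0r.
  rewrite (lognn_pred pp un) -mulr_sumr -mulrA mulr_suml; congr (_ * _).
rewrite avg_sum; apply: ler_sum_nat => p /= pb; rewrite avg_sum mulr_sumr.
apply: ler_sum => k _; rewrite avgZ; have [->|pp] := @lp_case R p; first by rewrite !mul0r.
rewrite ler_wpM2l ?lp_ge0 // exprVn -natrX.
apply: avg_dvd_mul_le => // [||n' n'0]; [by rewrite expn_gt0 prime_gt0|exact: K0|exact: H].
Qed.

Lemma sum_lp_inv_sqr0 b : \sum_(0 <= p < b) lp p * (p%:R^-1 ^+ 2) <= 12 :> R.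
Proof.
case: b => [|b]; first by rewrite big_geq.
rewrite big_ltn // {1}/lp /= mul0r add0r.
have := @sum_lp_inv_sqr R 1 b.+1 isT; rewrite divr1.
by rewrite (eq_bigr (fun p => lp p * p%:R^-1 ^+ 2)) // => p _; rewrite exprVn.
Qed.

Lemma prime_inv_half p : prime p -> 2 * (p%:R^-1 : R) <= 1.
Proof. by move=> pp; rewrite ler_pdivrMr ?ltr0n ?prime_gt0 // mul1r ler_nat prime_gt1. Qed.

Lemma avg_powerful b n : (0 < n)%N -> avg n (powerful b) <= 24.
Proof.
move=> n0; have := @avg_powerful_mul b n one (fun _ _ => 1) n0 (fun _ _ _ _ => ler01).
rewrite (_ : (fun u => powerful b u * 1) = powerful b); last by apply/funext => u; rewrite mulr1.
move=> H; apply: (le_trans (H _)) => [p k n' _ _ n'0|]; first by rewrite avg_cst.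
apply: (@le_trans _ _ (2 * \sum_(0 <= p < b) lp p * (p%:R^-1 ^+ 2))); last first.
  by have := sum_lp_inv_sqr0 b; lra.
rewrite mulr_sumr; apply: ler_sum => p _; have [->|pp] := @lp_case R p; first by rewrite !mul0r mulr0.
rewrite mulrCA ler_wpM2l ?lp_ge0 //.
under eq_bigr do rewrite mulr1.
by apply: sum_geometric2; rewrite ?invr_ge0 // prime_inv_half.
Qed.

Lemma avg_powerful_sqr b n : (0 < n)%N -> avg n (fun u => powerful b u ^+ 2) <= 648.
Proof.
move=> n0; under eq_fun do rewrite expr2.
apply: (le_trans (@avg_powerful_mul b n (powerful b) (fun p k => k%:R * lp p + 24) n0 _ _)).
- by move=> p k _ _; rewrite addr_ge0 // mulr_ge0 ?lp_ge0.
- move=> p k n' pp pb n'0.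
  apply: (@le_trans _ _ (avg n' (fun v => k%:R * lp p + powerful b v))).
    by apply: ler_avg => v /andP[v0 _]; apply: powerful_mul.
  by rewrite avgD avg_cst // lerD2l avg_powerful.
apply: (@le_trans _ _ (\sum_(0 <= p < b) (6 * (lp p ^+ 2 * p%:R^-1 ^+ 2) + 48 * (lp p * p%:R^-1 ^+ 2)))).
  apply: ler_sum => p _; have [->|pp] := @lp_case R p; first by rewrite expr0n !(mul0r, mulr0) addr0.
  under eq_bigr do rewrite mulrDr; rewrite big_split /= mulrDr lerD //.
    rewrite [leRHS](_ : _ = lp p * (lp p * (6 * p%:R^-1 ^+ 2))); last by ring.
    rewrite ler_wpM2l ?lp_ge0 //; under eq_bigr do rewrite mulrA mulrC (mulrC (_ ^+ _)).
    rewrite -mulr_sumr ler_wpM2l ?lp_ge0 //.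
    by apply: sum_mul_geometric2; rewrite ?invr_ge0 // prime_inv_half.
  rewrite mulrCA ler_wpM2l ?lp_ge0 // -mulr_suml.
  have := @sum_geometric2 R p%:R^-1 n.+1; rewrite invr_ge0 ler0n prime_inv_half // => /(_ isT isT).
  lra.
rewrite big_split /= -!mulr_sumr; have h := sum_lp_inv_sqr0 b.
have : \sum_(0 <= p < b) lp p ^+ 2 * p%:R^-1 ^+ 2 <= 12 :> R.
  case: b {h} => [|b]; first by rewrite big_geq.
  rewrite big_ltn // {1}/lp /= expr0n mul0r add0r.
  have := @sum_lp2_inv_sqr R 1 b.+1 isT; rewrite ln1 addr0 divr1 mulr1.
  by rewrite (eq_bigr (fun p => lp p ^+ 2 * p%:R^-1 ^+ 2)) // => p _; rewrite exprVn.
lra.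
Qed.

Lemma lnn_padd_powerful n u : (0 < u <= n)%N ->
  ln (u%:R : R) = padd n.+1 one u + powerful n.+1 u.
Proof.
move=> /andP[u0 un]; rewrite (lnn_logn u0 un) /padd /powerful -big_split /=.
apply: eq_bigr => p _; rewrite mulr1 -mulrDr; have [->|pp] := @lp_case R p; first by rewrite !mul0r.
congr (_ * _); rewrite -natrD; congr (_%:R).
by have := logn_gt0 p u; rewrite mem_primes pp u0 /= => <-; case: (logn p u).
Qed.

(** The sum of [log p] over all primes dividing [u] is [ln u] minus [powerful], and both
    [ln n - ln u] and [powerful] are bounded in [L^2]: [1300 = 2 * 2 + 2 * 648]. In the first regime
    this trades the primes above [m] for those up to [m]. *)
Lemma avg_padd_dev n : (0 < n)%N ->
  avg n (fun u => (padd n.+1 one u - ln (n%:R : R)) ^+ 2) <= 1300.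
Proof.
move=> n0; apply: (@le_trans _ _ (avg n (fun u => 2 * (ln n%:R - ln u%:R) ^+ 2
    + 2 * powerful n.+1 u ^+ 2))).
  apply: ler_avg => u un; rewrite (lnn_padd_powerful un).
  move: (padd _ _ _) (powerful _ _) (ln _) => x y z.
  have := sqr_ge0 (z - x - 2 * y).
  rewrite -subr_ge0 => h; rewrite -subr_ge0.
  rewrite [leRHS](_ : _ = (z - x - 2 * y - 0) ^+ 2); last by ring.
  by rewrite sqr_ge0.
rewrite avgD !avgZ; have := avg_powerful_sqr n.+1 n0.
have : avg n (fun u => (ln n%:R - ln u%:R) ^+ 2) <= 2 :> R.
  by rewrite /avg ler_pdivrMr ?ltr0n // sum_lnn_dev.
lra.
Qed.

(* As [m ^ 2 > n], at most one prime larger than [m] divides [u <= n]. *)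
Lemma large_primes_sqr m n u : (n < m ^ 2)%N -> (0 < u <= n)%N ->
  padd n.+1 (fun p => (m < p)%N%:R) u ^+ 2 =
  \sum_(0 <= p < n.+1) (m < p)%N%:R * lp p ^+ 2 * (p %| u)%N%:R :> R.
Proof.
move=> nm /andP[u0 un]; rewrite expr2 /padd mulr_suml; apply: eq_big_nat => p /= pn.
rewrite mulr_sumr (bigD1_seq p) ?mem_iota ?subn0 ?iota_uniq //= big1 ?addr0.
  by case: (m < p)%N; case: (p %| u)%N => /=; ring.
move=> q qp; have [->|pp] := @lp_case R p; first by rewrite !mul0r.
have [->|pq] := @lp_case R q; first by rewrite !(mul0r, mulr0).
have [mp|mp] := ltnP m p; last by rewrite !(mul0r, mulr0).
have [mq|mq] := ltnP m q; last by rewrite !(mul0r, mulr0).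
case: (boolP (p %| u)%N) => [pu|_]; last by rewrite !(mul0r, mulr0).
case: (boolP (q %| u)%N) => [qu|_]; last by rewrite !(mul0r, mulr0).
have : (p * q %| u)%N by rewrite Gauss_dvd ?pu // prime_coprime // dvdn_prime2 // eq_sym.
move/(dvdn_leq u0) => pqu; exfalso.
have : (m * m < p * q)%N by apply: ltn_mul.
by rewrite mulnn ltnNge (leq_trans pqu) // (leq_trans un) // ltnW.
Qed.

Lemma sum_lp_large_eq (F : nat -> R) m n : (m <= n)%N ->
  \sum_(0 <= p < n.+1) (m < p)%N%:R * F p =
  \sum_(0 <= p < n.+1) F p - \sum_(0 <= p < m.+1) F p.
Proof.
move=> mn; rewrite !(@big_cat_nat _ _ _ m.+1 0 n.+1) //= (addrC (\sum_(0 <= i < m.+1) F i)) addrK.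
rewrite big_nat big1 ?add0r; last by move=> p /andP[_]; rewrite ltnS leqNgt => /negbTE ->; rewrite mul0r.
by apply: eq_big_nat => p /andP[mp _]; rewrite mp mul1r.
Qed.

(** With [L = ln n] and [l = ln m], Mertens gives mean about [L - l] and, as [h ^ 2] has no cross
    terms, second moment about [(L ^ 2 - l ^ 2) / 2]; subtracting the squared mean leaves
    [(L - l) * (3 l - L) / 2]. *)
Lemma large_primes_variance m n : (0 < m <= n)%N -> (n < m ^ 2)%N ->
  `|avg n (fun u => padd n.+1 (fun p => (m < p)%N%:R) u ^+ 2)
     - avg n (padd n.+1 (fun p => (m < p)%N%:R)) ^+ 2
     - (ln (n%:R : R) - ln m%:R) * (3 * ln m%:R - ln n%:R) / 2|
  <= 10000 * (1 + ln n%:R).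
Proof.
move=> /andP[m0 mn] nm2; set h := padd _ _; have n0 : (0 < n)%N by exact: leq_trans mn.
have N0 : 0 < n%:R :> R by rewrite ltr0n.
have l0 := @lnn_ge0 R m; have lL := @ler_lnn R m n m0 mn.
(* The rounding error in the probability of [p | u]. Only single primes occur, never pairs, so its
   sum against [lp] is at most [theta n / n] even with [p] up to [n]. *)
pose e p : R := p%:R^-1 - (n %/ p)%:R / n%:R.
have he p : prime p -> 0 <= e p <= n%:R^-1.
  move=> /prime_gt0 p0; rewrite /e subr_ge0 avg_dvd_le_inv //=.
  by have := @avg_dvd_ge_inv R n p n0 p0; lra.
have th0 : theta n / n%:R <= 4 :> R by rewrite ler_pdivrMr // theta_le.
have E1 : avg n h = \sum_(0 <= p < n.+1) (m < p)%N%:R * (lp p / p%:R) -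
    \sum_(0 <= p < n.+1) (m < p)%N%:R * (lp p * e p).
  rewrite /h /padd avg_sum -sumrB; apply: eq_bigr => p _.
  have [->|pp] := @lp_case R p.
    by rewrite /avg big1 ?mul0r ?mulr0 ?subr0 // => u _; rewrite !mul0r.
  by rewrite avgZ avg_dvd ?prime_gt0 // /e; ring.
have E2 : avg n (fun u => h u ^+ 2) = \sum_(0 <= p < n.+1) (m < p)%N%:R * (lp p ^+ 2 / p%:R) -
    \sum_(0 <= p < n.+1) (m < p)%N%:R * (lp p ^+ 2 * e p).
  rewrite (eq_avg (fun u => @large_primes_sqr m n u nm2)) avg_sum -sumrB; apply: eq_bigr => p _.
  have [->|pp] := @lp_case R p.
    by rewrite expr0n /avg big1 ?mul0r ?mulr0 ?subr0 // => u _; rewrite !(mul0r, mulr0).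
  by rewrite avgZ avg_dvd ?prime_gt0 // /e; ring.
set e1 := \sum_(_ <= _ < _) _ * (lp _ * e _) in E1.
set e2 := \sum_(_ <= _ < _) _ * (lp _ ^+ 2 * e _) in E2.
have he1 : 0 <= e1 <= 4.
  apply/andP; split.
    apply: sumr_ge0 => p _; have [->|pp] := @lp_case R p; first by rewrite mul0r mulr0.
    by rewrite !mulr_ge0 ?lp_ge0 //; have /andP[] := he p pp.
  apply: le_trans th0; rewrite /theta mulr_suml; apply: ler_sum => p _.
  have [->|pp] := @lp_case R p; first by rewrite !mul0r mulr0.
  have /andP[h1 h2] := he p pp.
  apply: (@le_trans _ _ (lp p * e p)); last by rewrite ler_wpM2l ?lp_ge0.
  by rewrite ler_piMl ?mulr_ge0 ?lp_ge0 // lern1 leq_b1.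
have he2 : 0 <= e2 <= 4 * ln n%:R.
  apply/andP; split.
    apply: sumr_ge0 => p _; have [->|pp] := @lp_case R p; first by rewrite expr0n mul0r mulr0.
    by apply: mulr_ge0 => //; apply: mulr_ge0; [exact: sqr_ge0|have /andP[] := he p pp].
  apply: (@le_trans _ _ (theta n / n%:R * ln n%:R)); last by rewrite ler_wpM2r ?lnn_ge0.
  rewrite /theta !mulr_suml; apply: ler_sum_nat => p /= pn.
  have [->|pp] := @lp_case R p; first by rewrite expr0n !mul0r mulr0.
  have /andP[h1 h2] := he p pp.
  apply: (@le_trans _ _ (lp p ^+ 2 * e p)).
    by rewrite ler_piMl ?(mulr_ge0 (sqr_ge0 _) h1) // lern1 leq_b1.
  rewrite expr2 -!mulrA ler_wpM2l ?lp_ge0 // mulrC; apply: ler_pM; rewrite ?lp_ge0 //.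
  exact: lp_le_lnn.
pose A k : R := \sum_(0 <= p < k.+1) lp p / p%:R.
pose B k : R := \sum_(0 <= p < k.+1) lp p ^+ 2 / p%:R.
move: E1 E2; rewrite !sum_lp_large_eq // -/(A n) -/(A m) -/(B n) -/(B m) => E1 E2.
have /ler_normlP[a1 a2] := @mertens R n n0; have /ler_normlP[a3 a4] := @mertens R m m0.
have /ler_normlP[b1 b2] := @mertens2 R n n0; have /ler_normlP[b3 b4] := @mertens2 R m m0.
rewrite -/(A n) in a1 a2; rewrite -/(A m) in a3 a4.
rewrite -/(B n) in b1 b2; rewrite -/(B m) in b3 b4.
move/andP: he1 => [f1 f1']; move/andP: he2 => [f2 f2'].
set L := ln n%:R in lL f2' a1 a2 b1 b2 *; set l := ln m%:R in l0 lL a3 a4 b3 b4 *.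
set x := avg n h in E1 *.
have x1 : x - (L - l) <= 56 by rewrite E1; clear -f1 a1 a2 a3 a4; lra.
have x2 : - 56 <= x - (L - l) by rewrite E1; clear -f1' a1 a2 a3 a4; lra.
have D0 : 0 <= L - l by clear -lL; lra.
set D := L - l in x1 x2 D0 *.
have xD : 0 <= x by apply: avg_ge0 => u _; apply: padd_ge0.
have g1 : (x - D) * (x + D) <= 56 * (x + D) by rewrite ler_wpM2r // addr_ge0.
have g2 : -56 * (x + D) <= (x - D) * (x + D) by rewrite ler_wpM2r // addr_ge0.
have g3 : x + D <= 2 * L + 56 by rewrite /D; clear -x1 l0; rewrite /D in x1; lra.
have EV : avg n (fun u => h u ^+ 2) - x ^+ 2 - D * (3 * l - L) / 2 =
   (B n - L ^+ 2 / 2) - (B m - l ^+ 2 / 2) - e2 - (x - D) * (x + D).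
  by rewrite E2 /D; field.
rewrite EV ler_norml; apply/andP; split.
  clear -b1 b4 f2' g1 g3 l0 lL; lra.
clear -b2 b3 f2 g2 g3 l0 lL; lra.
Qed.

Lemma padd_le_lnn n (a : nat -> R) u : (forall p, 0 <= a p <= 1) -> (0 < u <= n)%N ->
  padd n.+1 a u <= ln n%:R.
Proof.
move=> a01 /andP[u0 un]; apply: (@le_trans _ _ (ln u%:R)); last exact: ler_lnn.
rewrite (@lnn_padd_powerful n) ?u0 // -[leLHS]addr0 lerD ?powerful_ge0 //.
apply: ler_sum => p _; have /andP[a0 a1] := a01 p.
by rewrite ler_wpM2r // ler_wpM2l ?lp_ge0.
Qed.

End AdditiveMoments.

(** * Smoothing of Lipschitz functions *)

Section Smoothing.
Context {R : realType}.
Implicit Types (f g df : R -> R) (x y h e : R).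

Lemma is_derive_continuous f df : (forall x, is_derive x 1 f (df x)) -> continuous f.
Proof.
move=> H x; apply: differentiable_continuous; apply/derivable1_diffP.
exact: ex_derive.
Qed.

Lemma mean_value_shift f df x h : (forall y, is_derive y 1 f (df y)) ->
  exists2 c, `|c| <= `|h| & f (x + h) - f x = df (x + c) * h.
Proof.
move=> H; have cf := is_derive_continuous H.
have [h0|h0|->] := ltgtP h 0; last first.
- by exists 0; rewrite ?normr0 // addr0 subrr mulr0.
- have xh : x < x + h by rewrite ltrDl.
  have [c] := MVT xh (fun y _ => H y) (continuous_subspaceT cf).
  rewrite in_itv /= => /andP[c1 c2] ->; exists (c - x).
    rewrite !ger0_norm; lra.
  have -> : x + (c - x) = c by ring.
  by congr (_ * _); ring.
- have xh : x + h < x by lra.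
  have [c] := MVT xh (fun y _ => H y) (continuous_subspaceT cf).
  rewrite in_itv /= => /andP[c1 c2] E; exists (c - x).
    rewrite !ltr0_norm; lra.
  have -> : x + (c - x) = c by ring.
  have -> : f (x + h) - f x = - (f x - f (x + h)) by ring.
  by rewrite E; ring.
Qed.

Lemma local_antiderivative f : continuous f -> exists G : R -> R -> R,
  (forall a b x, a <= b -> b <= x -> G a x = G a b + G b x) /\
  (forall a x, a < x -> is_derive x 1 (G a) (f x)).
Proof.
move=> cf; pose mu := @lebesgue_measure R.
have fi a b : mu.-integrable `[a, b] (EFin \o f).
  apply: continuous_compact_integrable; first exact: segment_compact.
  exact: continuous_subspaceT.
exists (fun a x : R => (\int[mu]_(t in `[a, x]) f t)%R); split.
  move=> a b x ab bx.
  have := @Rintegral_itvB R f (BLeft a) (BRight x) b (fi a x).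
  rewrite !bnd_simp => /(_ ab bx) => H.
  rewrite [X in _ = _ + X](_ : _ = \int[mu]_(t in `]b, x]) f t)%R; first by rewrite -H; ring.
  rewrite [RHS](Rintegral_itv_obnd_cbnd (r := b)) //.
  by apply: integrableS (fi b x) => //; apply: subset_itvr; rewrite bnd_simp.
move=> a x ax; have xu : x < x + 1 by lra.
have [d1 d2] := continuous_FTC1_closed xu (fi a (x + 1)) ax (cf x).
apply: DeriveDef; first exact: d1.
by rewrite -derive1E; exact: d2.
Qed.

Lemma antiderivative f : continuous f -> exists F : R -> R, forall x, is_derive x 1 F (f x).
Proof.
move=> cf; have [G [GD Gd]] := local_antiderivative cf.
(* [G a x - G a 0] does not depend on [a] below [x] and 0. Letting the base point follow [x] gives
   one function on the whole line, equal near each point to one with a fixed base point. *)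
exists (fun x => G (- `|x| - 1) x - G (- `|x| - 1) 0) => x.
pose a : R := - `|x| - 2.
have Fa y : `|y - x| < 1 -> G (- `|y| - 1) y - G (- `|y| - 1) 0 = G a y - G a 0.
  move=> yx; have h1 : a <= - `|y| - 1.
    have := ler_normB y x; have := ler_normD (y - x) x; rewrite subrK /a; lra.
  have h2 := ler_norm (- y); rewrite normrN in h2; have h3 := normr_ge0 y.
  have e1 : - `|y| - 1 <= y by clear -h2; lra.
  have e2 : - `|y| - 1 <= 0 by clear -h3; lra.
  by rewrite (GD a _ y h1 e1) (GD a _ 0 h1 e2); ring.
have ax : a < x by have := ler_norm (- x); rewrite normrN /a; lra.
have D := Gd a x ax.
have D' : is_derive x 1 (fun y : R => G a y - G a 0) (f x).
  by apply: is_derive_eq; rewrite subr0.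
apply: near_eq_is_derive D'.
by exists 1 => //= y; rewrite /ball_ /= distrC => /Fa ->.
Qed.

Lemma taylor2 f f1 f2 (K : R) :
  (forall x, is_derive x 1 f (f1 x)) -> (forall x, is_derive x 1 f1 (f2 x)) ->
  (forall x y, `|f2 x - f2 y| <= K * `|x - y|) ->
  forall x h, `|f (x + h) - f x - f1 x * h - f2 x * (h ^+ 2 / 2)| <= K * `|h| ^+ 3.
Proof.
move=> D1 D2 L x h.
have K0 : 0 <= K by have := L 1 0; rewrite subr0 normr1 mulr1; apply: le_trans.
pose g (t : R) := f (t + x) - f x - f1 x * t - f2 x * (t ^+ 2 / 2).
have Dx (k k1 : R -> R) : (forall x, is_derive x 1 k (k1 x)) ->
    forall t : R, is_derive t 1 (fun t : R => k (t + x)) (k1 (t + x)).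
  move=> Dk t; have Dt : is_derive t 1 (fun t : R => t + x) 1 by apply: is_derive_eq; rewrite addr0.
  have := @is_derive1_comp R k (fun t => t + x) t _ _ (Dk (t + x)) Dt.
  by rewrite mulr1.
have Dg (t : R) : is_derive t 1 g (f1 (t + x) - f1 x - f2 x * t).
  have D := Dx f f1 D1 t.
  have Dq : is_derive t 1 (fun t : R => t ^+ 2 / 2) t.
    by apply: is_derive_eq; rewrite /GRing.scale /=; field.
  by apply: is_derive_eq; rewrite /GRing.scale /=; ring.
have [c ch E] := mean_value_shift 0 h Dg.
move: E; rewrite !add0r; have -> : g 0 = 0 by rewrite /g add0r expr0n /=; ring.
rewrite subr0 /g (addrC h) => ->; rewrite normrM (addrC c).
have [c' cc' E'] := mean_value_shift x c D2.
rewrite E' -mulrBl normrM.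
have h1 : `|f2 (x + c') - f2 x| <= K * `|h|.
  apply: (le_trans (L _ _)); rewrite ler_wpM2l // addrAC subrr add0r.
  exact: le_trans ch.
rewrite [leRHS](_ : _ = K * `|h| * `|h| * `|h|); last by ring.
by rewrite ler_wpM2r // ler_pM.
Qed.

Definition lipschitz_by (L : R) f := forall x y, `|f x - f y| <= L * `|x - y|.

(** Stated through the expansion and not through derivatives, so that it passes to averages of
    translates, with the same constants, by averaging [f1] and [f2]. *)
Definition taylor_class (b K : R) f := exists f1 f2 : R -> R,
  (forall x, `|f2 x| <= b) /\
  forall x h, `|f (x + h) - f x - f1 x * h - f2 x * (h ^+ 2 / 2)| <= K * `|h| ^+ 3.

Lemma lipschitz_continuous L f : lipschitz_by L f -> continuous f.
Proof.
move=> Lf x; apply/cvgrPdist_lt => e e0; near=> y.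
apply: (le_lt_trans (Lf _ _)); apply: (@le_lt_trans _ _ ((`|L| + 1) * `|x - y|)).
  by rewrite ler_wpM2r // (le_trans (ler_norm _)) // lerDl.
rewrite mulrC -ltr_pdivlMr ?ltr_wpDl //.
near: y; apply: cvgr_dist_lt => //; rewrite divr_gt0 // ltr_wpDl //.
Unshelve. all: by end_near. Qed.

Lemma lipschitz_by_ge0 L f : lipschitz_by L f -> 0 <= L.
Proof. by move=> /(_ 1 0); rewrite subr0 normr1 mulr1; apply: le_trans. Qed.

(* Averaging [f] twice over windows of length [e] gives a second difference of
   a second antiderivative of [f]. *)
Lemma smoothing f (L M e : R) : 0 < e -> lipschitz_by L f -> (forall x, `|f x| <= M) ->
  exists psi, [/\ lipschitz_by L psi, (forall x, `|psi x| <= M),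
    (forall x, `|psi x - f x| <= 2 * L * e) & taylor_class (2 * L / e) (4 * L / e ^+ 2) psi].
Proof.
move=> e0 Lf Mf; have L0 := lipschitz_by_ge0 Lf.
have [F1 D1] := antiderivative (lipschitz_continuous Lf).
have [F2 D2] := antiderivative (is_derive_continuous D1).
have Dx (k k1 : R -> R) (a : R) : (forall x, is_derive x 1 k (k1 x)) ->
    forall t : R, is_derive t 1 (fun t : R => k (t + a)) (k1 (t + a)).
  move=> Dk t; have Dt : is_derive t 1 (fun t : R => t + a) 1 by apply: is_derive_eq; rewrite addr0.
  have := @is_derive1_comp R k (fun t => t + a) t _ _ (Dk (t + a)) Dt.
  by rewrite mulr1.
(* The second difference over [e ^ 2] commutes with differentiation, so [D F2], [D F1] and [D f] are
   the smoothed function and its first two derivatives; by the mean value theorem [D F2 x] is a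
   value of [f] within [2 e] of [x]. *)
pose D (k : R -> R) x := e ^- 2 * (k (x + (e + e)) - 2 * k (x + e) + k x).
have DD (k k1 : R -> R) : (forall x, is_derive x 1 k (k1 x)) ->
    forall x, is_derive x 1 (D k) (D k1 x).
  move=> Dk x; have H1 := Dx k k1 (e + e) Dk x; have H2 := Dx k k1 e Dk x; have H3 := Dk x.
  by rewrite /D; apply: is_derive_eq; rewrite /GRing.scale /=; ring.
have ne0 : e != 0 by rewrite gt_eqF.
have diff (k k1 : R -> R) : (forall x, is_derive x 1 k (k1 x)) -> forall x,
    exists2 c, `|c| <= e & D k x = e ^-1 * (k1 (x + c + e) - k1 (x + c)).
  move=> Dk x; have H (t : R) : is_derive t 1 (fun t : R => k (t + e) - k t) (k1 (t + e) - k1 t).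
    by have H2 := Dx k k1 e Dk t; have H3 := Dk t; apply: is_derive_eq.
  have [c ce] := mean_value_shift x e H.
  rewrite (gtr0_norm e0) in ce; move=> E; exists c => //.
  rewrite /D; have -> : k (x + (e + e)) - 2 * k (x + e) + k x = (k1 (x + c + e) - k1 (x + c)) * e.
    by rewrite -E addrA; ring.
  by rewrite -exprVn expr2 -mulrA [_^-1 * (_ * e)]mulrCA mulVf // mulr1.
have psiE x : exists2 c, `|c| <= 2 * e & D F2 x = f (x + c).
  have [c ce ->] := diff F2 F1 D2 x.
  have [c' ce' ->] := mean_value_shift (x + c) e D1.
  rewrite (gtr0_norm e0) in ce'; exists (c + c').
    by apply: (le_trans (ler_normD _ _)); lra.
  by rewrite addrA mulrCA mulVf // mulr1.
exists (D F2); split.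
- move=> x y; have [c _] := mean_value_shift y (x - y) (DD F2 F1 D2).
  rewrite (_ : y + (x - y) = x); last by ring.
  move=> ->; rewrite normrM ler_wpM2r //.
  have [c' _ ->] := diff F1 f D1 (y + c).
  rewrite normrM gtr0_norm ?invr_gt0 // mulrC ler_pdivrMr //.
  apply: (le_trans (Lf _ _)); rewrite [X in L * `|X|](_ : _ = e); last by ring.
  by rewrite (gtr0_norm e0).
- by move=> x; have [c _ ->] := psiE x.
- move=> x; have [c ce ->] := psiE x; apply: (le_trans (Lf _ _)).
  by rewrite addrAC subrr add0r -mulrA mulrCA mulrA [leRHS]mulrC mulrA; rewrite [leRHS](_ : _ = L * (2 * e)) ?ler_wpM2l //; ring.
- have e20 : 0 <= e ^- 2 by rewrite invr_ge0 sqr_ge0.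
  exists (D F1), (D f); split.
    move=> x; rewrite /D normrM (ger0_norm e20) mulrC ler_pdivrMr ?exprn_gt0 //.
    have -> : 2 * L / e * e ^+ 2 = L * e + L * e by field.
    have -> : f (x + (e + e)) - 2 * f (x + e) + f x = (f (x + (e + e)) - f (x + e)) - (f (x + e) - f x) by ring.
    apply: (le_trans (ler_normB _ _)); apply: lerD; apply: (le_trans (Lf _ _)).
      by rewrite [X in `|X|](_ : _ = e) ?(gtr0_norm e0) //; ring.
    by rewrite [X in `|X|](_ : _ = e) ?(gtr0_norm e0) //; ring.
  apply: (taylor2 (DD F2 F1 D2) (DD F1 f D1)) => x y.
  rewrite /D -mulrBr normrM (ger0_norm e20) [4 * L / _]mulrC -mulrA ler_wpM2l //.
  rewrite [X in `|X|](_ : _ = (f (x + (e + e)) - f (y + (e + e))) - 2 * (f (x + e) - f (y + e)) + (f x - f y)); last by ring.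
  apply: (le_trans (ler_normD _ _)); apply: (le_trans (lerD (ler_normB _ _) (lexx _))).
  rewrite normrM ger0_norm //.
  have a1 := Lf (x + (e + e)) (y + (e + e)); have a2 := Lf (x + e) (y + e); have a3 := Lf x y.
  have b1 a : x + a - (y + a) = x - y by ring.
  rewrite !b1 in a1 a2; clear -a1 a2 a3; lra.
Qed.

End Smoothing.

(** * The Lindeberg exchange for one-step operators *)

Section Lindeberg.
Context {R : realType}.
Implicit Types (f g : R -> R) (x y h e : R) (A T Q : (R -> R) -> R).

Definition bounded_by (M : R) f := forall x, `|f x| <= M.

Definition nice f := (exists L, lipschitz_by L f) /\ (exists M, bounded_by M f).

Definition conv A f x : R := A (fun y => f (x + y)).

(** What the exchange uses of an expectation: normalization and contraction in the sup norm, on a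
    class of functions integrable for every probability. *)
Definition markov A := (forall c : R, A (fun=> c) = c) /\
  forall f g e, nice f -> nice g -> (forall x, `|f x - g x| <= e) -> `|A f - A g| <= e.

(* [A] acts like the expectation over a step of mean [0], variance [v] and absolute
   third moment at most [k]. *)
Definition taylor_op A (v k : R) := forall f x (a b K : R), nice f ->
  (forall h, `|f (x + h) - f x - a * h - b * (h ^+ 2 / 2)| <= K * `|h| ^+ 3) ->
  `|conv A f x - f x - b * (v / 2)| <= K * k.

Lemma nice_cst (c : R) : nice (fun=> c).
Proof.
split; first by exists 0 => x y; rewrite subrr normr0 mul0r.
by exists `|c| => x.
Qed.

Lemma nice_shift f x : nice f -> nice (fun y => f (x + y)).
Proof.
move=> [[L fL] [M fM]]; split; last by exists M => y.
exists L => y z; apply: (le_trans (fL _ _)).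
by rewrite [X in L * `|X|](_ : _ = y - z) //; ring.
Qed.

Lemma lipschitz_conv A L f : markov A -> nice f -> lipschitz_by L f -> lipschitz_by L (conv A f).
Proof.
move=> [_ Am] nf fL x y; apply: Am; try exact: nice_shift.
move=> z; apply: (le_trans (fL _ _)).
by rewrite [X in L * `|X|](_ : _ = x - y) //; ring.
Qed.

Lemma bounded_conv A M f : markov A -> nice f -> bounded_by M f -> bounded_by M (conv A f).
Proof.
move=> [Ac Am] nf fM x; rewrite -[conv A f x]subr0 -(Ac 0).
apply: Am; [exact: nice_shift|exact: nice_cst|by move=> z; rewrite subr0].
Qed.

Lemma nice_conv A f : markov A -> nice f -> nice (conv A f).
Proof.
move=> mA nf; have [[L fL] [M fM]] := nf; split.
  by exists L; apply: lipschitz_conv.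
by exists M; apply: bounded_conv.
Qed.

Lemma nice_iter_conv A r f : markov A -> nice f -> nice (iter r (conv A) f).
Proof. by move=> mA nf; elim: r => //= r; apply: nice_conv. Qed.

Lemma iter_conv_close A r f g (d e : R) : markov A -> nice f -> nice g ->
  (forall x y, `|x - y| <= d -> `|f x - g y| <= e) ->
  forall x y, `|x - y| <= d -> `|iter r (conv A) f x - iter r (conv A) g y| <= e.
Proof.
move=> mA nf ng fg; elim: r => //= r IH x y xy; apply: mA.2.
- exact/nice_shift/nice_iter_conv.
- exact/nice_shift/nice_iter_conv.
- by move=> z; apply: IH; rewrite [X in `|X|](_ : _ = x - y) //; ring.
Qed.

(** Telescoping: [T^(r+1) f - Q^(r+1) f] is [(T - Q) T^r f] plus the difference of [Q] applied to
    [T^r f] and to [Q^r f]. Only [T^r f] is expanded, so regularity has to be preserved by [T]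
    alone; the contraction of [Q] carries the previous error, and first-order terms disappear
    because both steps are centred. *)
Lemma iter_conv_lindeberg T Q (v v' k k' b K : R) f : markov T -> markov Q ->
  (forall b K g, taylor_class b K g -> taylor_class b K (conv T g)) ->
  taylor_op T v k -> taylor_op Q v' k' -> nice f -> taylor_class b K f ->
  forall r x, `|iter r (conv T) f x - iter r (conv Q) f x| <=
    r%:R * (b * (`|v - v'| / 2) + K * (k + k')).
Proof.
move=> mT mQ sT tT tQ nf cf; elim=> [|r IH] x; first by rewrite /= subrr normr0 mul0r.
have nT := nice_iter_conv r mT nf; have nQ := nice_iter_conv r mQ nf.
have [f1 [f2 [fb fK]]] : taylor_class b K (iter r (conv T) f).
  by elim: (r) => //= r' /sT.
rewrite !iterS; set g := iter r (conv T) f in fK nT IH *; set g' := iter r (conv Q) f in nQ IH *.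
have h1 := tT g x _ _ K nT (fK x); have h2 := tQ g x _ _ K nT (fK x).
have h3 : `|conv Q g x - conv Q g' x| <= r%:R * (b * (`|v - v'| / 2) + K * (k + k')).
  by apply: mQ.2; [exact: nice_shift|exact: nice_shift|move=> y; apply: IH].
have h4 : `|f2 x * (v / 2) - f2 x * (v' / 2)| <= b * (`|v - v'| / 2).
  rewrite -mulrBr -mulrBl !normrM normfV (ger0_norm (x := 2)) //.
  by rewrite ler_wpM2r // divr_ge0.
have -> : conv T g x - conv Q g' x = (conv T g x - g x - f2 x * (v / 2))
   - (conv Q g x - g x - f2 x * (v' / 2)) + (f2 x * (v / 2) - f2 x * (v' / 2))
   + (conv Q g x - conv Q g' x) by ring.
apply: (le_trans (ler_normD _ _)); apply: (le_trans (lerD (ler_normD _ _) (lexx _))).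
apply: (le_trans (lerD (lerD (ler_normB _ _) (lexx _)) (lexx _))).
rewrite -(natr1 r); clear -h1 h2 h3 h4; lra.
Qed.

(** Smoothing at scale [e] costs [2 L e] for each operator. The scale stays free: it is fixed while
    [n] grows and only then chosen small. *)
Lemma lipschitz_lindeberg T Q (v v' k k' L M : R) f : markov T -> markov Q ->
  (forall b K g, taylor_class b K g -> taylor_class b K (conv T g)) ->
  taylor_op T v k -> taylor_op Q v' k' -> lipschitz_by L f -> bounded_by M f ->
  forall e r x, 0 < e -> `|iter r (conv T) f x - iter r (conv Q) f x| <=
    4 * L * e + r%:R * (L / e * `|v - v'| + 4 * L / e ^+ 2 * (k + k')).
Proof.
move=> mT mQ sT tT tQ fL fM e r x e0.
have [psi [pL pM pf pt]] := smoothing e0 fL fM.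
have np : nice psi by split; [exists L|exists M].
have nf : nice f by split; [exists L|exists M].
have h1 := iter_conv_lindeberg mT mQ sT tT tQ np pt r x.
have close A : markov A -> `|iter r (conv A) psi x - iter r (conv A) f x| <= 2 * L * e.
  move=> mA; apply: (@iter_conv_close A r psi f 0) => //; last by rewrite subrr normr0.
  by move=> y z; rewrite normr_le0 subr_eq0 => /eqP ->.
have h2 := close T mT; have h3 := close Q mQ.
have E : 2 * L / e * (`|v - v'| / 2) = L / e * `|v - v'| by field; rewrite gt_eqF.
rewrite E in h1.
set a := iter r (conv T) f x in h2 *; set b := iter r (conv Q) f x in h3 *.
set a' := iter r (conv T) psi x in h1 h2; set b' := iter r (conv Q) psi x in h1 h3.
have -> : a - b = (a' - b') - (a' - a) + (b' - b) by ring.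
apply: (le_trans (ler_normD _ _)); apply: (le_trans (lerD (ler_normB _ _) (lexx _))).
clear -h1 h2 h3; lra.
Qed.

Definition avgop (n : nat) (xi : nat -> R) : (R -> R) -> R :=
  fun f => avg n (fun u => f (xi u)).

Lemma avg_norm n (f : nat -> R) : `|avg n f| <= avg n (fun u => `|f u|).
Proof.
apply/ler_normlP; split; last by apply: ler_avg => u _; exact: ler_norm.
by rewrite -mulN1r -avgZ; apply: ler_avg => u _; rewrite mulN1r -normrN ler_norm.
Qed.

Lemma markov_avgop n xi : (0 < n)%N -> markov (avgop n xi).
Proof.
move=> n0; split=> [c|f g e _ _ fg]; first exact: avg_cst.
rewrite /avgop -avgB; apply: (le_trans (avg_norm _ _)).
by rewrite -[leRHS](@avg_cst R n) //; apply: ler_avg.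
Qed.

Lemma taylor_class_avgop n xi b K g : (0 < n)%N -> taylor_class b K g ->
  taylor_class b K (conv (avgop n xi) g).
Proof.
move=> n0 [g1 [g2 [gb gK]]].
exists (fun x => avg n (fun u => g1 (x + xi u))), (fun x => avg n (fun u => g2 (x + xi u))).
split=> [x|x h].
  apply: (le_trans (avg_norm _ _)); rewrite -[leRHS](@avg_cst R n) //; exact: ler_avg.
have -> : conv (avgop n xi) g (x + h) - conv (avgop n xi) g x
     - avg n (fun u => g1 (x + xi u)) * h - avg n (fun u => g2 (x + xi u)) * (h ^+ 2 / 2) =
   avg n (fun u => g (x + xi u + h) - g (x + xi u) - h * g1 (x + xi u) - h ^+ 2 / 2 * g2 (x + xi u)).
  rewrite !avgB !avgZ /conv /avgop; congr (_ - _ - _ - _); rewrite 1?mulrC //.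
  by congr (avg n _); apply/funext => u; congr g; ring.
apply: (le_trans (avg_norm _ _)); rewrite -[leRHS](@avg_cst R n) //; apply: ler_avg => u _.
by rewrite (mulrC h) (mulrC (h ^+ 2 / 2)).
Qed.

Lemma taylor_op_avgop n (xi : nat -> R) : (0 < n)%N -> avg n xi = 0 ->
  taylor_op (avgop n xi) (avg n (fun u => xi u ^+ 2)) (avg n (fun u => `|xi u| ^+ 3)).
Proof.
move=> n0 xi0 f x a b K nf H.
have -> : conv (avgop n xi) f x - f x - b * (avg n (fun u => xi u ^+ 2) / 2) =
  avg n (fun u => f (x + xi u) - f x - a * xi u - b / 2 * xi u ^+ 2).
  rewrite !avgB !avgZ xi0 (@avg_cst R n) // /conv /avgop; ring.
apply: (le_trans (avg_norm _ _)); rewrite -avgZ; apply: ler_avg => u _.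
by rewrite [b / 2 * _](_ : _ = b * (xi u ^+ 2 / 2)) ?H //; ring.
Qed.

Fixpoint psums (bs : seq nat) (s : seq R) x : seq R :=
  if bs is r :: bs' then
    let y := x + \sum_(z <- take r s) z in y :: psums bs' (drop r s) y
  else [::].

(* The expectation of [F] at the positions, after [r1], [r1 + r2], ... steps for
   [bs = [:: r1; r2; ...]], of the random walk started at [x] with step operator [A]. *)
Fixpoint pathE A (bs : seq nat) (F : seq R -> R) x : R :=
  if bs is r :: bs' then iter r (conv A) (fun y => pathE A bs' (fun l => F (y :: l)) y) x
  else F [::].

Lemma eq_iterE_size (V : Type) (A : (V -> R) -> R) N (F G : seq V -> R) :
  (forall s, size s = N -> F s = G s) -> iterE A N F = iterE A N G.
Proof.
elim: N F G => [|N IH] F G FG /=; first exact: FG.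
by congr (A _); apply/funext => v; apply: IH => s sN; apply: FG; rewrite /= sN.
Qed.

Lemma iterE_conv A r f x :
  iterE A r (fun s => f (x + \sum_(z <- s) z)) = iter r (conv A) f x.
Proof.
elim: r x => [|r IH] x /=; first by rewrite big_nil addr0.
rewrite /conv; congr (A _); apply/funext => y; rewrite -IH.
by congr (iterE _ _ _); apply/funext => s; rewrite big_cons addrA.
Qed.

Lemma iterE_psums A bs (F : seq R -> R) x :
  iterE A (sumn bs) (fun s => F (psums bs s x)) = pathE A bs F x.
Proof.
elim: bs F x => [|r bs IH] F x //=.
rewrite iterE_cat -iterE_conv; apply: eq_iterE_size => s sr.
rewrite -IH; apply: eq_iterE_size => t _.
by rewrite take_size_cat // drop_size_cat.
Qed.

Lemma iterE_map (V : Type) (A : (V -> R) -> R) (g : V -> R) N (F : seq R -> R) :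
  iterE (fun f => A (f \o g)) N F = iterE A N (fun s => F (map g s)).
Proof. by elim: N F => //= N IH F; congr (A _); apply/funext => v /=; rewrite IH. Qed.

Lemma nth_psums bs s x i : (i < size bs)%N ->
  (psums bs s x)`_i = x + \sum_(z <- take (sumn (take i.+1 bs)) s) z.
Proof.
elim: bs s x i => [|r bs IH] s x [|i] //= ib; first by rewrite take0 addn0.
rewrite IH // takeD big_cat addrA //=.
Qed.

(** The index runs over all naturals: past the common size both entries are the default 0, so
    nothing is asked there. *)
Definition lip_seq (L : R) (F : seq R -> R) := forall (l l' : seq R) (e : R), 0 <= e ->
  size l = size l' -> (forall i, `|l`_i - l'`_i| <= e) -> `|F l - F l'| <= L * e.

Lemma lip_seq_cons L F y : lip_seq L F -> lip_seq L (fun l => F (y :: l)).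
Proof.
move=> FL l l' e e0 ll' H; apply: FL => //=; first by rewrite ll'.
by case=> [|i] //=; rewrite subrr normr0.
Qed.

(** Two functionals and two starting points vary together because each block records its endpoint:
    shifted starts leave different functionals [F (y :: _)] and [G (z :: _)] for the remaining
    blocks. *)
Lemma pathE_close A bs (F G : seq R -> R) (L M d e x y : R) : markov A -> 0 <= L ->
  lip_seq L F -> lip_seq L G -> (forall l, `|F l| <= M) -> (forall l, `|G l| <= M) ->
  (forall l l', size l = size l' -> (forall i, `|l`_i - l'`_i| <= d) -> `|F l - G l'| <= e) ->
  0 <= d -> `|x - y| <= d -> `|pathE A bs F x - pathE A bs G y| <= e.
Proof.
move=> mA L0; elim: bs F G d e x y => [|r bs IH] F G d e x y FL GL FM GM FG d0 xy /=.
  by apply: FG => // i; rewrite subrr normr0.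
have nice_inner H : lip_seq L H -> (forall l, `|H l| <= M) ->
    nice (fun y => pathE A bs (fun l => H (y :: l)) y).
  move=> HL HM; split.
    exists L => z z'; apply: (IH _ _ `|z - z'|) => //; try exact: lip_seq_cons.
    move=> l l' ll' H'; apply: HL => //=; first by rewrite ll'.
    by case=> [|i] //=.
  exists M => z.
  (* Boundedness follows from the induction hypothesis as well, by comparison with the zero
     functional. *)
  have c0 : pathE A bs (fun=> 0) z = 0.
    elim: (bs) z => //= r' bs' IH' z; elim: r' z => [|r' IHr] z /=; first exact: IH'.
    by rewrite /conv -[RHS]mA.1; congr (A _); apply/funext => w; apply: IHr.
  rewrite -[X in `|X|]subr0 -c0.
  apply: (IH _ _ 0) => //; first exact: lip_seq_cons.
  - by move=> l l' e' e'0 _ _; rewrite subrr normr0 mulr_ge0.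
  - by move=> l; rewrite normr0; apply: le_trans (HM [::]).
  - by move=> l l' _ _; rewrite subr0.
  - by rewrite subrr normr0.
apply: (@iter_conv_close A r _ _ d) => //; try exact: nice_inner.
move=> z w zw; apply: (IH _ _ d) => //; try exact: lip_seq_cons.
by move=> l l' ll' H; apply: FG => /=; [rewrite ll'|case].
Qed.

Lemma lipschitz_pathE A bs (F : seq R -> R) (L M : R) : markov A -> 0 <= L ->
  lip_seq L F -> (forall l, `|F l| <= M) ->
  lipschitz_by L (fun y => pathE A bs (fun l => F (y :: l)) y).
Proof.
move=> mA L0 FL FM z z'; apply: (@pathE_close A bs _ _ L M `|z - z'|) => //.
- exact: lip_seq_cons.
- exact: lip_seq_cons.
- move=> l l' ll' H; apply: FL => //=; first by rewrite ll'.
  by case=> [|i] /=.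
Qed.

Lemma bounded_pathE A bs (F : seq R -> R) (L M x : R) : markov A -> 0 <= L ->
  lip_seq L F -> (forall l, `|F l| <= M) -> `|pathE A bs F x| <= M.
Proof.
move=> mA L0 FL FM.
have c0 : pathE A bs (fun=> 0) x = 0.
  elim: (bs) x => //= r' bs' IH' z; elim: r' z => [|r' IHr] z /=; first exact: IH'.
  by rewrite /conv -[RHS]mA.1; congr (A _); apply/funext => w; apply: IHr.
rewrite -[X in `|X|]subr0 -c0; apply: (@pathE_close A bs _ _ L M 0) => //.
- by move=> l l' e' e'0 _ _; rewrite subrr normr0 mulr_ge0.
- by move=> l; rewrite normr0; apply: le_trans (FM [::]).
- by move=> l l' _ _; rewrite subr0.
- by rewrite subrr normr0.
Qed.

(** Blocks are exchanged one at a time. The continuation after a block is again [L]-Lipschitz and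
    bounded by [M], so one [eta] serves all blocks. *)
Lemma pathE_lindeberg T Q bs (F : seq R -> R) (L M eta : R) : markov T -> markov Q -> 0 <= L ->
  (forall f r x, lipschitz_by L f -> bounded_by M f -> r \in bs ->
     `|iter r (conv T) f x - iter r (conv Q) f x| <= eta) ->
  lip_seq L F -> (forall l, `|F l| <= M) ->
  forall x, `|pathE T bs F x - pathE Q bs F x| <= (size bs)%:R * eta.
Proof.
move=> mT mQ L0; elim: bs F => [|r bs IH] F H FL FM x /=; first by rewrite subrr normr0 mul0r.
pose fA A y := pathE A bs (fun l => F (y :: l)) y.
have fL A : markov A -> lipschitz_by L (fA A) by move=> mA; apply: (lipschitz_pathE _ mA L0 FL FM).
have fM A : markov A -> bounded_by M (fA A).
  by move=> mA y; apply: (@bounded_pathE A bs _ L M y mA L0 (lip_seq_cons y FL)).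
have fn A : markov A -> nice (fA A).
  by move=> mA; split; [exists L; exact: fL|exists M; exact: fM].
have h1 := H _ r x (fL T mT) (fM T mT) (mem_head _ _).
have h2 : `|iter r (conv Q) (fA T) x - iter r (conv Q) (fA Q) x| <= (size bs)%:R * eta.
  apply: (@iter_conv_close Q r _ _ 0) => //; try exact: fn; last by rewrite subrr normr0.
  move=> y z; rewrite normr_le0 subr_eq0 => /eqP ->; apply: IH => //; last exact: lip_seq_cons.
  by move=> f r' x' f1 f2 r'b; apply: H => //; rewrite inE r'b orbT.
rewrite -/(fA T) -/(fA Q) -(natr1 (size bs)).
have := ler_distD (iter r (conv Q) (fA T) x) (iter r (conv T) (fA T) x) (iter r (conv Q) (fA Q) x).
clear -h1 h2; lra.
Qed.

End Lindeberg.

(** * Independent variables as iterated integrals *)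

Definition intop {R : realType} {d} {V : measurableType d} (mu : probability V R) :
  (V -> R) -> R := fun f => (\int[mu]_x f x)%R.

Section ProductLaw.
Context {R : realType} {d : measure_display} {V : measurableType d} (mu : probability V R).

Definition tuple_box N (A : 'I_N -> set V) : set (N.-tuple V) :=
  \bigcap_(i in [set: 'I_N]) ((fun t : N.-tuple V => tnth t i) @^-1` A i).

Lemma measurable_tuple_box N (A : 'I_N -> set V) :
  (forall i, measurable (A i)) -> measurable (tuple_box A).
Proof.
move=> mA; rewrite /tuple_box; apply: fin_bigcap_measurable; first exact: finite_finset.
move=> i _; rewrite -[X in measurable X]setTI; exact: measurable_tnth.
Qed.

Definition boxes N : set (set (N.-tuple V)) :=
  [set B | exists2 A : 'I_N -> set V, (forall i, measurable (A i)) & B = tuple_box A].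

Lemma measurable_boxes N (B : set (N.-tuple V)) : measurable B -> <<s @boxes N >> B.
Proof.
apply: smallest_sub; first exact: smallest_sigma_algebra.
move=> C; rewrite -bigcup_seq => -[i _ [A mA <-]].
apply: sub_sigma_algebra; exists (fun j => if j == i then A else setT).
  by move=> j; case: ifP.
apply/seteqP; split => t /=.
  by move=> [_ ti] j _ /=; case: eqP => // ->.
by move=> /(_ i I) /=; rewrite eqxx.
Qed.

Lemma eq_measure_boxes N (m1 m2 : probability (N.-tuple V) R) :
  (forall A : 'I_N -> set V, (forall i, measurable (A i)) -> m1 (tuple_box A) = m2 (tuple_box A)) ->
  forall B, measurable B -> m1 B = m2 B.
Proof.
move=> H B mB; apply: (g_sigma_algebra_measure_unique (@boxes N) _ (fun=> setT)).
- by move=> C [A mA ->]; exact: measurable_tuple_box.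
- by move=> _; exists (fun=> setT) => //; apply/seteqP; split.
- by rewrite bigcup_const //; exists 0%N.
- move=> C D [A mA ->] [A' mA' ->]; exists (fun i => A i `&` A' i).
    by move=> i; exact: measurableI.
  by rewrite /tuple_box -bigcapI.
- by move=> C [A mA ->]; exact: H.
- by move=> k; apply: (le_lt_trans (probability_le1 m1 (@measurableT _ _))); rewrite ltry.
- exact: measurable_boxes.
Qed.

(** The product law is built by prepending a coordinate, so that Tonelli yields the iterated
    integral in the same induction. *)
Lemma iid_tuple_measure N : exists nu : probability (N.-tuple V) R,
  (forall A : 'I_N -> set V, (forall i, measurable (A i)) ->
     nu (tuple_box A) = (\prod_i mu (A i))%E) /\
  (forall (F : seq V -> R) (M : R), measurable_fun setT (fun t : N.-tuple V => F t) ->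
     (forall s, 0 <= F s <= M) ->
     (\int[nu]_t (F t)%:E)%E = (iterE (intop mu) N F)%:E).
Proof.
elim: N => [|N [nu [nubox nuint]]].
  exists (\d_ [tuple] : probability _ R); split.
    move=> A mA; rewrite big_ord0 /= diracE (_ : _ \in _) //.
    by rewrite inE => -[].
  move=> F M mF F0; rewrite integral_dirac ?diracT ?mul1e //=.
  exact/measurable_EFinP.
pose c (x : V * N.-tuple V) : N.+1.-tuple V := [tuple of x.1 :: x.2].
have mc : measurable_fun setT c by apply: measurable_cons.
pose cX : {mfun (V * N.-tuple V)%type >-> N.+1.-tuple V} := HB.pack c (isMeasurableFun.Build _ _ _ _ c mc).
pose pr : probability _ R := [the probability _ R of (mu \x nu)%E].
exists [the probability _ R of distribution pr cX]; split.
  move=> A mA.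
  transitivity (pr (A ord0 `*` tuple_box (fun i => A (lift ord0 i)))).
    rewrite /= /distribution /pushforward; congr (pr _); apply/seteqP; split => -[v t] /=.
      move=> H; split; first by have := H ord0 I.
      by move=> i _ /=; have := H (lift ord0 i) I; rewrite /= tnthS.
    move=> [h1 h2] i _ /=; case: (unliftP ord0 i) => [j ->|->] //.
    by rewrite tnthS; exact: h2.
  rewrite /pr /= product_measure1E //; last exact: measurable_tuple_box.
  by rewrite big_ord_recl; congr (_ * _)%E; exact: nubox.
move=> F M mF F0.
have mFc : measurable_fun setT (fun x : V * N.-tuple V => F (c x)).
  exact: (measurableT_comp mF mc).
transitivity (\int[pr]_x (F (c x))%:E)%E.
  apply: (@ge0_integral_distribution _ _ _ _ _ pr cX (fun t => (F t)%:E)).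
    exact/measurable_EFinP.
  by move=> y; rewrite lee_fin; have /andP[] := F0 y.
rewrite /pr /= fubini_tonelli1; last 2 first.
- exact/measurable_EFinP.
- by move=> x /=; rewrite lee_fin; have /andP[] := F0 (c x).
have inner v : fubini_F nu (EFin \o (fun x : V * N.-tuple V => F (c x))) v =
    (iterE (intop mu) N (fun s => F (v :: s)))%:E.
  rewrite /fubini_F /=; apply: nuint => [|s]; last exact: F0.
  exact: (measurableT_comp mFc (measurable_pair1 v)).
(* The bound [M] keeps the integrals finite, so that the real-valued [intop] agrees with the
   extended integral. *)
have Fub v : 0 <= iterE (intop mu) N (fun s => F (v :: s)) <= M.
  rewrite -!lee_fin -inner /fubini_F; apply/andP; split.
    by apply: integral_ge0 => t _ /=; rewrite lee_fin; have /andP[] := F0 (v :: t).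
  rewrite -[leRHS](_ : \int[nu]_t (M%:E) = _)%E; last first.
    by rewrite integral_cst //= probability_setT mule1.
  apply: ge0_le_integral => //.
  - by move=> t _ /=; rewrite lee_fin; have /andP[] := F0 (v :: t).
  - by apply/measurable_EFinP; exact: (measurableT_comp mFc (measurable_pair1 v)).
  - by move=> t _ /=; rewrite lee_fin; have /andP[] := F0 (v :: t).
have mi : measurable_fun setT (fun v => (iterE (intop mu) N (fun s => F (v :: s)))%:E).
  suff : measurable_fun setT (fubini_F nu (EFin \o (fun x : V * N.-tuple V => F (c x)))).
    by congr measurable_fun; apply/funext => v; exact: inner.
  apply: measurable_fun_fubini_tonelli_F; first exact/measurable_EFinP.
  by move=> x /=; rewrite lee_fin; have /andP[] := F0 (c x).
rewrite (eq_integral (fun v => (iterE (intop mu) N (fun s => F (v :: s)))%:E)); last first.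
  by move=> v _; exact: inner.
rewrite /= /intop /Rintegral fineK // ge0_fin_numE; last first.
  by apply: integral_ge0 => v _; rewrite lee_fin; have /andP[] := Fub v.
apply: (@le_lt_trans _ _ (\int[mu]_v (M%:E))%E); last first.
  by rewrite integral_cst //= probability_setT mule1 ltry.
apply: ge0_le_integral => //.
- by move=> v _; rewrite lee_fin; have /andP[] := Fub v.
- by move=> v _; rewrite lee_fin; have /andP[] := Fub v.
Qed.

(** The law of the vector of the [X i] and the product law agree on boxes, a generating family
    stable under intersection. *)
Lemma iid_integral {d'} {W : measurableType d'} (P : probability W R) N
    (X : 'I_N -> W -> V) (F : seq V -> R) (M : R) :
  (forall i, measurable_fun setT (X i)) -> mutually_independent P X ->
  (forall i A, measurable A -> P (X i @^-1` A) = mu A) ->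
  measurable_fun setT (fun t : N.-tuple V => F t) -> (forall s, 0 <= F s <= M) ->
  (\int[P]_x (F [seq X i x | i <- enum 'I_N])%:E)%E = (iterE (intop mu) N F)%:E.
Proof.
move=> mX indX lawX mF F0; have [nu [nubox nuint]] := iid_tuple_measure N.
rewrite -(nuint F M) //.
pose Z x : N.-tuple V := [tuple X i x | i < N].
have mZ : measurable_fun setT Z.
  apply/measurable_fun_tnthP => i; rewrite (_ : _ \o Z = X i) //.
  by apply/funext => x; rewrite /= /Z tnth_mktuple.
pose ZX : {mfun W >-> N.-tuple V} := HB.pack Z (isMeasurableFun.Build _ _ _ _ Z mZ).
transitivity (\int[distribution P ZX]_t (F t)%:E)%E.
  rewrite ge0_integral_distribution //; first exact/measurable_EFinP.
  by move=> y; rewrite lee_fin; have /andP[] := F0 y.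
apply: eq_measure_integral => B mB _.
apply: eq_measure_boxes => // A mA; rewrite nubox //.
rewrite /distribution /pushforward.
have := indX (index_enum _) A (index_enum_uniq _) (fun i _ => mA i).
rewrite (eq_bigr (fun i => mu (A i))); last by move=> i _; rewrite lawX.
move=> <-; congr (P _); apply/seteqP; split => x /= H i.
  by move=> _ /=; have := H i I; rewrite /= /Z tnth_mktuple.
by move=> _ /=; rewrite /Z tnth_mktuple; apply: H; rewrite /= mem_index_enum.
Qed.

End ProductLaw.

(** * Gaussian moments *)

Section Integrability.
Context {R : realType} {d : measure_display} {V : measurableType d} (mu : probability V R).
Implicit Types f g : V -> R.

Lemma bounded_integrable f M :
  measurable_fun setT f -> (forall x, `|f x| <= M) -> mu.-integrable setT (EFin \o f).
Proof.
move=> mf fM.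
apply: (@le_integrable _ _ _ mu setT measurableT _ (cst M%:E)).
- exact/measurable_EFinP.
- by move=> x _ /=; rewrite lee_fin (le_trans (fM x)) // ler_norm.
- exact: finite_measure_integrable_cst.
Qed.

Lemma integrableB_EFin f g : mu.-integrable setT (EFin \o f) -> mu.-integrable setT (EFin \o g) ->
  mu.-integrable setT (EFin \o (fun x => f x - g x)).
Proof. by move=> iF iG; have := integrableB measurableT iF iG; exact: eq_integrable. Qed.

Lemma integrableZl_EFin f (a : R) : mu.-integrable setT (EFin \o f) ->
  mu.-integrable setT (EFin \o (fun x => a * f x)).
Proof. by move=> iF; have := integrableZl measurableT a iF; exact: eq_integrable. Qed.

Lemma Rintegral_cst1 (c : R) : \int[mu]_x c = c.
Proof. by rewrite Rintegral_cst // [X in fine X]probability_setT mulr1. Qed.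

End Integrability.

Lemma norm_expn_continuous (R : realType) n : continuous (fun x : R => `|x| ^+ n).
Proof.
move=> x; apply: (@continuous_comp R R R (fun x : R => `|x|) (fun x : R => x ^+ n)).
  exact: norm_continuous.
exact: exprn_continuous.
Qed.

Section GaussianMoments.
Context {R : realType} (s : R) (s0 : 0 < s).
Implicit Types (x y : R) (f F : R -> R).
Notation leb := (@lebesgue_measure R).

Let gs y : R := expR (- (y ^+ 2) / (s ^+ 2 *+ 2)).

Lemma ge0_integral_normal_prob (f : R -> \bar R) :
  measurable_fun setT f -> (forall x, 0 <= f x)%E ->
  (\int[normal_prob 0 s]_x f x = \int[leb]_x (f x * (normal_pdf 0 s x)%:E))%E.
Proof.
move=> mf f0.
have dom : normal_prob (0 : R) s `<< leb by exact: normal_prob_dominates.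
rewrite -(Radon_Nikodym_SigmaFinite.change_of_variables dom f0 measurableT mf).
have fi := Radon_Nikodym_SigmaFinite.f_integrable dom.
apply: ae_eq_integral => //.
- by apply: emeasurable_funM => //; exact: (measurable_int leb).
- by apply: emeasurable_funM => //; apply/measurable_EFinP; exact: measurable_normal_pdf.
- apply: ae_eqe_mul2l; apply: integral_ae_eq => //.
    by apply/measurable_EFinP; exact: measurable_normal_pdf.
  by move=> E _ mE; rewrite -Radon_Nikodym_SigmaFinite.f_integral.
Qed.

Lemma cvg_pinfty0 f (C : R) : (forall y, 1 <= y -> `|f y| <= C / y) -> f y @[y --> +oo] --> (0 : R).
Proof.
move=> H; apply/cvgrPdist_lt => e e0; near=> y.
have y1 : 1 <= y by near: y; apply: nbhs_pinfty_ge; rewrite num_real.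
have y0 : 0 < y by lra.
rewrite sub0r normrN; apply: (le_lt_trans (H y y1)).
rewrite ltr_pdivrMr // mulrC -ltr_pdivrMr //.
by near: y; apply: nbhs_pinfty_gt; rewrite num_real.
Unshelve. all: by end_near. Qed.

Lemma improper_integral f F : (forall y, is_derive y 1 F (f y)) -> continuous f ->
  (forall y, 0 <= y -> 0 <= f y) -> F y @[y --> +oo] --> (0 : R) ->
  (\int[leb]_(x in `[0%R, +oo[) (f x)%:E = (- F 0)%:E)%E.
Proof.
move=> DF cf f0 F0; rewrite (@ge0_continuous_FTC2y R f F 0 0) //.
- by rewrite sub0e.
- exact: continuous_subspaceT.
- by apply: cvg_at_right_filter; exact: (is_derive_continuous DF).
- by move=> x _; rewrite derive1E; apply: derive_val.
Qed.

Lemma normal_pdf_gs x : normal_pdf 0 s x = normal_peak s * gs x.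
Proof. by rewrite normal_pdfE ?gt_eqF // /normal_fun subr0. Qed.

Lemma gs_ge0 y : 0 <= gs y.
Proof. exact: expR_ge0. Qed.

Lemma gs_derive y : is_derive y 1 gs (- (y / s ^+ 2) * gs y).
Proof.
have D : is_derive y 1 (fun y : R => - (y ^+ 2) / (s ^+ 2 *+ 2)) (- (y / s ^+ 2)).
  by apply: is_derive_eq; rewrite /GRing.scale /=; field; rewrite gt_eqF.
have := @is_derive1_comp R expR _ y _ _ (is_derive_expR _) D.
by rewrite mulrC.
Qed.

Lemma gs_continuous : continuous gs.
Proof. exact: is_derive_continuous gs_derive. Qed.

Lemma gs_bound y : 1 <= y -> y ^+ 2 * gs y <= 8 * s ^+ 4 / y.
Proof.
move=> y1; have y0 : 0 < y by lra.
pose z := y ^+ 2 / (s ^+ 2 *+ 2).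
have z0 : 0 < z by rewrite divr_gt0 ?exprn_gt0 // pmulrn_lgt0 // exprn_gt0.
have h := @expR_ge1Dxn R z 1 (ltW z0).
have h2 : z ^+ 2 / 2 <= expR z by apply: le_trans h; rewrite lerDr.
rewrite /gs mulNr -/z expRN.
have Z : 0 < z ^+ 2 / 2 by rewrite divr_gt0 // exprn_gt0.
apply: (@le_trans _ _ (y ^+ 2 * (z ^+ 2 / 2)^-1)).
  by rewrite ler_wpM2l ?sqr_ge0 // lef_pV2 ?posrE ?expR_gt0.
have -> : y ^+ 2 * (z ^+ 2 / 2)^-1 = 8 * s ^+ 4 / y * y^-1.
  rewrite /z -mulr_natr; field; rewrite !gt_eqF //=.
rewrite ler_piMr ?invf_le1 // divr_ge0 ?(ltW y0) // mulr_ge0 ?exprn_ge0 // ltW //.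
Qed.

Lemma gs_poly_cvg (a b c : R) : (a + b * y + c * y ^+ 2) * gs y @[y --> +oo] --> (0 : R).
Proof.
apply: (@cvg_pinfty0 _ ((`|a| + `|b| + `|c|) * (8 * s ^+ 4))) => y y1.
rewrite normrM (ger0_norm (gs_ge0 y)) -[leRHS]mulrA.
apply: (@le_trans _ _ ((`|a| + `|b| + `|c|) * (y ^+ 2 * gs y))); last first.
  by rewrite ler_wpM2l ?addr_ge0 // gs_bound.
rewrite [leRHS]mulrA ler_wpM2r ?gs_ge0 // !mulrDl.
have y0 : 0 <= y by lra.
have y2 : 1 <= y ^+ 2 by rewrite exprn_ege1.
have yy : y <= y ^+ 2 by rewrite expr2 ler_peMl.
apply: (le_trans (ler_normD _ _)); apply: lerD; last by rewrite normrM (ger0_norm (sqr_ge0 y)).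
apply: (le_trans (ler_normD _ _)); apply: lerD; first by rewrite ler_peMr.
by rewrite normrM (ger0_norm y0) ler_wpM2l.
Qed.

Lemma integral0y_gs3 : (\int[leb]_(x in `[0%R, +oo[) (x ^+ 3 * gs x)%:E = (2 * s ^+ 4)%:E)%E.
Proof.
have DF y : is_derive y 1 (fun y : R => (- (2 * s ^+ 4) - s ^+ 2 * y ^+ 2) * gs y) (y ^+ 3 * gs y).
  have D := gs_derive y; apply: is_derive_eq; rewrite /GRing.scale /=.
  by field; rewrite gt_eqF.
apply: etrans (improper_integral DF _ _ _) _.
- by move=> x; apply: cvgM; [exact: exprn_continuous|exact: gs_continuous].
- by move=> y y0; rewrite mulr_ge0 ?gs_ge0 ?exprn_ge0.
- have := gs_poly_cvg (- (2 * s ^+ 4)) 0 (- s ^+ 2).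
  by under eq_fun do rewrite mul0r addr0 mulNr.
- by rewrite /gs expr0n /= oppr0 mul0r expR0; congr (_%:E); ring.
Qed.

Let ex y : R := expR (- (y / s)).

Lemma ex_derive y : is_derive y 1 ex (- s^-1 * ex y).
Proof.
have D : is_derive y 1 (fun y : R => - (y / s)) (- s^-1).
  by apply: is_derive_eq; rewrite /GRing.scale /=; ring.
have := @is_derive1_comp R expR _ y _ _ (is_derive_expR _) D.
by rewrite mulrC.
Qed.

Lemma ex_bound y : 1 <= y -> `|ex y| <= s / y.
Proof.
move=> y1; have y0 : 0 < y by lra.
rewrite ger0_norm ?expR_ge0 // /ex expRN -[leRHS]invrK invf_div.
rewrite lef_pV2 ?posrE ?expR_gt0 ?divr_gt0 //; apply: le_trans (expR_ge1Dx _).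
by rewrite lerDr.
Qed.

Lemma integral0y_ex (K : R) : 0 <= K ->
  (\int[leb]_(x in `[0%R, +oo[) (K * ex x)%:E = (K * s)%:E)%E.
Proof.
move=> K0.
have DF y : is_derive y 1 (fun y : R => - (K * s) * ex y) (K * ex y).
  have D := ex_derive y; apply: is_derive_eq; rewrite /GRing.scale /=.
  by field; rewrite gt_eqF.
apply: etrans (improper_integral DF _ _ _) _.
- by move=> x; apply: cvgM; [exact: cvg_cst|exact: (is_derive_continuous ex_derive)].
- by move=> y y0; rewrite mulr_ge0 ?expR_ge0.
- apply: (@cvg_pinfty0 _ (K * s * s)) => y y1.
  rewrite mulNr normrN normrM ger0_norm ?mulr_ge0 ?(ltW s0) // -[leRHS]mulrA.
  by rewrite ler_wpM2l ?ex_bound // mulr_ge0 // ltW.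
- by rewrite /ex mul0r oppr0 expR0 mulr1 opprK.
Qed.

(* [(x ^+ 2 - s ^+ 2) * gs x] changes sign; adding the multiple [expR 1 * s ^+ 2] of
   [expR (- (x / s))] makes it nonnegative, so that the fundamental theorem applies. *)
Lemma integral0y_gs2 : (\int[leb]_(x in `[0%R, +oo[) (x ^+ 2 * gs x)%:E =
  (s ^+ 2)%:E * \int[leb]_(x in `[0%R, +oo[) (gs x)%:E)%E.
Proof.
pose K := expR 1 * s ^+ 2; have K0 : 0 <= K by rewrite mulr_ge0 ?expR_ge0 ?sqr_ge0.
have cex := is_derive_continuous ex_derive.
have cgs := gs_continuous.
have cKex : continuous (fun x : R => K * ex x).
  by move=> x; apply: cvgM; [exact: cvg_cst|exact: cex].
have cx2 : continuous (fun x : R => x ^+ 2 * gs x).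
  by move=> x; apply: cvgM; [exact: exprn_continuous|exact: cgs].
pose f x := (x ^+ 2 - s ^+ 2) * gs x + K * ex x.
have cf : continuous f.
  move=> x; apply: cvgD; last exact: cKex.
  apply: cvgM; last exact: cgs.
  by apply: cvgB; [exact: exprn_continuous|exact: cvg_cst].
have mc (g : R -> R) : continuous g -> measurable_fun (`[0, +oo[ : set R) (fun x => (g x)%:E).
  by move=> cg; apply/measurable_EFinP/measurable_funTS; exact: continuous_measurable_fun.
have f0 y : 0 <= y -> 0 <= f y.
  move=> y0; rewrite /f; have [ys|ys] := leP y s; last first.
    apply: addr_ge0; last by apply: mulr_ge0 => //; exact: expR_ge0.
    apply: mulr_ge0; last exact: gs_ge0.
    by rewrite subr_ge0 lerXn2r // ?nnegrE ltW.
  rewrite mulrBl addrAC -addrA addr_ge0 ?mulr_ge0 ?sqr_ge0 ?gs_ge0 //.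
  rewrite subr_ge0; apply: (@le_trans _ _ (s ^+ 2)).
    rewrite ler_piMr ?sqr_ge0 // -expR0 ler_expR mulNr oppr_le0.
    by rewrite divr_ge0 ?sqr_ge0 // mulrn_wge0 // sqr_ge0.
  rewrite /K /ex mulrAC -expRD ler_peMl ?sqr_ge0 // -expR0 ler_expR.
  by rewrite expR0 subr_ge0 ler_pdivrMr // mul1r.
pose F y := (0 + - s ^+ 2 * y + 0 * y ^+ 2) * gs y - K * s * ex y.
have DF y : is_derive y 1 F (f y).
  have D := gs_derive y; have D' := ex_derive y.
  by rewrite /F; apply: is_derive_eq; rewrite /f /GRing.scale /=; field; rewrite gt_eqF.
have cF : F y @[y --> +oo] --> (0 : R).
  rewrite -(subr0 0); apply: cvgB; first exact: gs_poly_cvg.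
  apply: (@cvg_pinfty0 _ (K * s * s)) => y y1.
  rewrite normrM ger0_norm ?mulr_ge0 ?(ltW s0) // -[leRHS]mulrA.
  by rewrite ler_wpM2l ?ex_bound // mulr_ge0 // ltW.
have E := improper_integral DF cf f0 cF.
have E2 := integral0y_ex K0.
have G0 x : (0 <= (gs x)%:E)%E by rewrite lee_fin gs_ge0.
rewrite -ge0_integralZl //; [|exact: mc|by rewrite lee_fin sqr_ge0].
have EE : (\int[leb]_(x in `[0%R, +oo[) (f x)%:E + \int[leb]_(x in `[0%R, +oo[) ((s ^+ 2)%:E * (gs x)%:E)
   = \int[leb]_(x in `[0%R, +oo[) (x ^+ 2 * gs x)%:E + \int[leb]_(x in `[0%R, +oo[) (K * ex x)%:E)%E.
  rewrite -!ge0_integralD //.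
  - by apply: eq_integral => x _; rewrite -!EFinD /f; congr (_%:E); ring.
  - by move=> x _; rewrite lee_fin mulr_ge0 ?sqr_ge0 ?gs_ge0.
  - exact: mc.
  - by move=> x _; rewrite lee_fin mulr_ge0 // expR_ge0.
  - exact: mc.
  - by move=> x; rewrite /= in_itv /= andbT => x0; rewrite lee_fin f0.
  - exact: mc.
  - by move=> x _; rewrite lee_fin mulr_ge0 ?sqr_ge0 ?gs_ge0.
  - by apply: (mc (fun x => s ^+ 2 * gs x)) => x; apply: cvgM; [exact: cvg_cst|exact: cgs].
move: EE; rewrite E E2 [X in _ = X]addeC.
have -> : - F 0 = K * s.
  have e0 : ex 0 = 1 by rewrite /ex mul0r oppr0 expR0.
  by rewrite /F e0; ring.
have addI (c : R) (a b : \bar R) : (c%:E + a = c%:E + b -> a = b)%E.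
  by case: a b => [a| |] [b| |] //= -[] /addrI ->.
by move/addI => <-.
Qed.

Lemma normal_peak_le : normal_peak s <= s^-1.
Proof.
rewrite /normal_peak lef_pV2 ?posrE //; last first.
  by rewrite sqrtr_gt0 pmulrn_lgt0 // mulr_gt0 ?exprn_gt0 // pi_gt0.
rewrite -[leLHS]gtr0_norm // -sqrtr_sqr ler_wsqrtr // -mulrnAr ler_peMr ?sqr_ge0 //.
by have := @pi_ge2 R; lra.
Qed.

(** Improper integrals are evaluated by antiderivatives on the half-line, so the Gaussian integral
    is folded at 0. *)
Lemma integral_normal_fold (g : R -> R) : continuous g -> (forall x, 0 <= g x) ->
  (\int[normal_prob 0 s]_x (g x)%:E =
   (normal_peak s)%:E * (\int[leb]_(x in `[0%R, +oo[) (g x * gs x)%:E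
                         + \int[leb]_(x in `[0%R, +oo[) (g (- x) * gs x)%:E))%E.
Proof.
move=> cg g0.
have cgg : continuous (fun x : R => g x * gs x).
  by move=> x; apply: cvgM; [exact: cg|exact: gs_continuous].
have gg0 x : 0 <= g x * gs x by apply: mulr_ge0 => //; exact: gs_ge0.
have mgg : measurable_fun setT (fun x : R => (g x * gs x)%:E).
  by apply/measurable_EFinP; exact: continuous_measurable_fun.
rewrite ge0_integral_normal_prob; last 2 first.
- by apply/measurable_EFinP; exact: continuous_measurable_fun.
- by move=> x; rewrite lee_fin.
transitivity (\int[leb]_x ((normal_peak s)%:E * (g x * gs x)%:E))%E.
  by apply: eq_integral => x _; rewrite -!EFinM normal_pdf_gs; congr (_%:E); ring.
rewrite ge0_integralZl //; last 2 first.
- by move=> x _; rewrite lee_fin; exact: gg0.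
- by rewrite lee_fin normal_peak_ge0.
congr (_ * _)%E.
rewrite -(setUv [set x : R | 0 <= x]%R) -set_itvcy ge0_integral_setU //=; last 4 first.
- exact: measurableC.
- by rewrite setUv.
- by move=> x _; rewrite lee_fin; exact: gg0.
- exact/disj_setPCl.
congr (_ + _)%E.
rewrite setCitvr integral_itv_bndo_bndc; last exact: measurable_funTS.
rewrite -{1}oppr0 ge0_integration_by_substitutionNy //.
- by apply: eq_integral => /= x _; rewrite /gs sqrrN.
- exact: continuous_subspaceT.
Qed.

Lemma integral_normal_even (g : R -> R) : continuous g -> (forall x, 0 <= g x) ->
  (forall x, g (- x) = g x) ->
  (\int[normal_prob 0 s]_x (g x)%:E =
   (2 * normal_peak s)%:E * \int[leb]_(x in `[0%R, +oo[) (g x * gs x)%:E)%E.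
Proof.
move=> cg g0 gN; rewrite integral_normal_fold //.
under [X in (_ + X)%E]eq_integral do rewrite gN.
by rewrite -mule2n -(mule_natl _ 2) muleA -EFinM mulrC.
Qed.

Lemma integral_normal_sqr : (\int[normal_prob 0 s]_x (x ^+ 2)%:E = (s ^+ 2)%:E)%E.
Proof.
have c1 : continuous (fun _ : R => 1 : R) by move=> x; exact: cvg_cst.
(* The case [g = 1] reads the normalization off the total mass 1, so the integral of [gs] itself is
   never computed. *)
have := integral_normal_even c1 (fun _ => ler01) (fun _ => erefl).
rewrite integral_cst // [X in (_ * X)%E]probability_setT mule1.
have -> : (\int[leb]_(x in `[0%R, +oo[) (1 * gs x)%:E = \int[leb]_(x in `[0%R, +oo[) (gs x)%:E)%E.
  by apply: eq_integral => x _; rewrite mul1r.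
move=> G; rewrite integral_normal_even //; last 3 first.
- exact: exprn_continuous.
- by move=> x; exact: sqr_ge0.
- by move=> x; rewrite sqrrN.
by rewrite integral0y_gs2 muleCA -G mule1.
Qed.

Lemma integral_normal_cube : (\int[normal_prob 0 s]_x (`|x| ^+ 3)%:E <= (4 * s ^+ 3)%:E)%E.
Proof.
rewrite integral_normal_even; first last.
- by move=> x; rewrite normrN.
- by move=> x; rewrite exprn_ge0.
- exact: norm_expn_continuous.
have -> : (\int[leb]_(x in `[0%R, +oo[) (`|x| ^+ 3 * gs x)%:E = (2 * s ^+ 4)%:E)%E.
  rewrite -integral0y_gs3; apply: eq_integral => x; rewrite inE /= in_itv /= andbT => x0.
  by rewrite ger0_norm.
rewrite -EFinM lee_fin; apply: (@le_trans _ _ (2 * s^-1 * (2 * s ^+ 4))).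
  by rewrite ler_wpM2r ?mulr_ge0 ?exprn_ge0 ?(ltW s0) // ler_wpM2l // normal_peak_le.
by rewrite (_ : 2 / s * (2 * s ^+ 4) = 4 * s ^+ 3) //; field; rewrite gt_eqF.
Qed.

Lemma normal_integrable_sqr : (normal_prob 0 s).-integrable setT (fun x => (x ^+ 2)%:E).
Proof.
apply/integrableP; split.
  by apply/measurable_EFinP; apply: continuous_measurable_fun; exact: exprn_continuous.
under eq_integral do rewrite gee0_abs ?lee_fin ?sqr_ge0 //.
by rewrite integral_normal_sqr ltry.
Qed.

Lemma normal_integrable_id : (normal_prob 0 s).-integrable setT (fun x => x%:E).
Proof.
apply: (@le_integrable _ _ _ (normal_prob 0 s) setT measurableT _ (fun x => (1 + x ^+ 2)%:E)).
- by apply/measurable_EFinP.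
- move=> /= x _; rewrite lee_fin (ger0_norm (_ : 0 <= 1 + x ^+ 2)) ?addr_ge0 ?sqr_ge0 //.
  by rewrite -real_normK ?num_real //; have := sqr_ge0 (`|x| - 1); have := normr_ge0 x; nra.
- under eq_fun do rewrite EFinD; apply: integrableD => //.
    by apply: finite_measure_integrable_cst.
  exact: normal_integrable_sqr.
Qed.

Lemma Rintegral_normal_id : \int[normal_prob 0 s]_x x = 0.
Proof.
have ix := normal_integrable_id; have iax := integrable_norm ix.
(* Reflection exchanges these two nonnegative functions; equality of their integrals makes the mean
   its own opposite. *)
have H : \int[normal_prob 0 s]_x (`|x| + x) = \int[normal_prob 0 s]_x (`|x| - x).
  have cN : continuous (fun x : R => `|x|) by exact: norm_continuous.
  rewrite /Rintegral !integral_normal_fold; first last.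
  - by move=> x; rewrite -[X in _ + X]opprK subr_ge0 -normrN ler_norm.
  - by move=> x; apply: cvgD; [exact: cN|exact: cvg_id].
  - by move=> x; rewrite subr_ge0 ler_norm.
  - by move=> x; apply: cvgB; [exact: cN|exact: cvg_id].
  rewrite addeC; congr (fine (_ * (_ + _)))%E; apply: eq_integral => x _;
    by rewrite normrN ?opprK.
have /= iax' : (normal_prob 0 s).-integrable setT (EFin \o (fun x => `|x|)) by [].
have E1 := RintegralD measurableT iax' ix.
have E2 := RintegralB measurableT iax' ix.
move: H; rewrite E1 E2 => /addrI/eqP.
by rewrite -addr_eq0 -mulr2n mulrn_eq0 => /eqP.
Qed.

End GaussianMoments.

(** * Gaussian integration as a one-step operator *)

Section IntegralOperators.
Context {R : realType}.
Implicit Types (mu : probability (measurableTypeR R) R) (f : R -> R).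

Lemma nice_measurable f : nice f -> measurable_fun setT f.
Proof.
move=> [[L fL] _].
by apply: continuous_measurable_fun; exact: lipschitz_continuous fL.
Qed.

Lemma nice_integrable mu f : nice f -> mu.-integrable setT (EFin \o f).
Proof.
by move=> nf; have [_ [M fM]] := nf; exact: (@bounded_integrable _ _ _ mu f M (nice_measurable nf) fM).
Qed.

Lemma markov_intop mu : markov (intop mu).
Proof.
split=> [c|f g e nf ng H]; first exact: Rintegral_cst1.
have iF := nice_integrable mu nf; have iG := nice_integrable mu ng.
rewrite /intop -RintegralB //.
have iFG : mu.-integrable setT (EFin \o (fun x => f x - g x)) by exact: integrableB_EFin.
apply: le_trans (le_normr_Rintegral _ iFG) _ => //.
rewrite -[leRHS](Rintegral_cst1 mu e); apply: le_Rintegral => //.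
- exact: integrable_norm iFG.
- exact: finite_measure_integrable_cst.
Qed.

Lemma shift_nice f x : nice f -> nice (fun y => f (x + y)).
Proof.
move=> [[L fL] [M fM]]; split; last by exists M => y; exact: fM.
by exists L => y z; apply: le_trans (fL _ _) _; rewrite opprD addrACA subrr add0r.
Qed.

Lemma taylor_op_intop_normal (s : R) : 0 < s ->
  taylor_op (intop (normal_prob 0 s)) (s ^+ 2) (4 * s ^+ 3).
Proof.
move=> s0 f x a b K nf H.
have K0 : 0 <= K.
  by apply: le_trans (normr_ge0 _) (le_trans (H 1) _); rewrite normr1 expr1n mulr1.
pose mu : probability (measurableTypeR R) R := normal_prob 0 s.
have i1 := nice_integrable mu (shift_nice x nf).
have ic (c : R) : mu.-integrable setT (EFin \o (fun=> c)) by exact: finite_measure_integrable_cst.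
have ia : mu.-integrable setT (EFin \o (fun h => a * h)).
  apply: integrableZl_EFin; exact: normal_integrable_id.
have ib : mu.-integrable setT (EFin \o (fun h => b / 2 * h ^+ 2)).
  apply: integrableZl_EFin; exact: normal_integrable_sqr.
have i2 : mu.-integrable setT (EFin \o (fun h => f (x + h) - f x)) by exact: integrableB_EFin.
have i3 : mu.-integrable setT (EFin \o (fun h => f (x + h) - f x - a * h)) by exact: integrableB_EFin.
have i4 : mu.-integrable setT (EFin \o (fun h => f (x + h) - f x - a * h - b / 2 * h ^+ 2)).
  exact: integrableB_EFin.
have -> : conv (intop (normal_prob 0 s)) f x - f x - b * (s ^+ 2 / 2) =
    \int[mu]_h (f (x + h) - f x - a * h - b / 2 * h ^+ 2).
  rewrite /conv /intop RintegralB // RintegralB // RintegralB // Rintegral_cst1.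
  rewrite RintegralZl //; last exact: normal_integrable_id.
  rewrite RintegralZl //; last exact: normal_integrable_sqr.
  rewrite Rintegral_normal_id // [X in _ = _ - _ * X]/Rintegral integral_normal_sqr //=.
  by rewrite mulr0 subr0; congr (_ - _); field.
have i5 := integrable_norm i4.
apply: le_trans (le_normr_Rintegral _ i4) _ => //.
rewrite -lee_fin /Rintegral fineK; last exact: integrable_fin_num.
apply: (@le_trans _ _ (\int[mu]_h (K%:E * (`|h| ^+ 3)%:E)))%E.
  apply: ge0_le_integral => //.
  - exact: (measurable_int mu).
  - apply: emeasurable_funM => //; apply/measurable_EFinP.
    exact: continuous_measurable_fun (@norm_expn_continuous R 3).
  - by move=> h _; rewrite -EFinM lee_fin (le_trans _ (H h)) // mulrA mulrAC.
rewrite ge0_integralZl //; last first.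
  by apply/measurable_EFinP; exact: continuous_measurable_fun (@norm_expn_continuous R 3).
by rewrite EFinM lee_wpmul2l ?lee_fin // integral_normal_cube.
Qed.

End IntegralOperators.

(** * Measurability of continuous functions of measurable coordinates *)

Section ContinuousOfMeasurable.
Context {R : realType} {d : measure_display} {V : measurableType d}.

Lemma rV_norm_le k (v : 'rV[R]_k) (e : R) : 0 <= e ->
  (forall i, `|v ord0 i| <= e) -> `|v| <= e.
Proof.
move=> e0 H; rewrite /Num.norm /= mx_normrE; apply/bigmax_leP; split => // -[i j] _ /=.
by rewrite ord1.
Qed.

(* The composition is a limit of the countably valued functions obtained by rounding the
   coordinates [g i x] down to multiples of [1 / (n + 1)]. *)
Lemma continuous_row_measurable k (f : 'rV[R]_k -> R) (g : 'I_k -> V -> R) :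
  continuous f -> (forall i, measurable_fun setT (g i)) ->
  measurable_fun setT (fun x => f (\row_i g i x)).
Proof.
move=> cf mg.
pose fl n (y : R) : R := (Num.floor (y * n.+1%:R))%:~R / n.+1%:R.
have fln n y : `|fl n y - y| <= n.+1%:R^-1.
  have /andP[h1 h2] := floor_itv (y * n.+1%:R); rewrite intrD1 in h2.
  have n0 : 0 < n.+1%:R :> R by [].
  have -> : fl n y - y = ((Num.floor (y * n.+1%:R))%:~R - y * n.+1%:R) / n.+1%:R.
    by rewrite /fl mulrBl mulfK // gt_eqF.
  rewrite normrM [X in _ * X]gtr0_norm ?invr_gt0 // ler_piMl ?invr_ge0 //.
  by rewrite ler_norml; apply/andP; split; lra.
apply: (@measurable_fun_cvg _ _ R setT (fun n x => f (\row_i fl n (g i x)))).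
  move=> n.
  pose code (z : {ffun 'I_k -> int}) := f (\row_i ((z i)%:~R / n.+1%:R)).
  pose z x : {ffun 'I_k -> int} := [ffun i => Num.floor (g i x * n.+1%:R)].
  have mz w : measurable (z @^-1` [set w]).
    have -> : z @^-1` [set w] =
        \bigcap_(i in [set: 'I_k]) (g i @^-1` `[((w i)%:~R / n.+1%:R : R), ((w i + 1)%:~R / n.+1%:R : R)[).
      have E i x : (Num.floor (g i x * n.+1%:R) == w i) =
          (g i x \in `[((w i)%:~R / n.+1%:R : R), ((w i + 1)%:~R / n.+1%:R : R)[).
        by rewrite floor_eq in_itv /= ler_pdivrMr // ltr_pdivlMr.
      apply/seteqP; split => x /=; first by move=> h i _; have := E i x; rewrite -{1}h ffunE eqxx => /esym.
      by move=> H; apply/ffunP => i; rewrite ffunE; apply/eqP; rewrite E; exact: H.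
    apply: fin_bigcap_measurable; first exact: finite_finset.
    by move=> i _; rewrite -[X in measurable X]setTI; apply: mg.
  have fE x : f (\row_i fl n (g i x)) = code (z x).
    by congr f; apply/rowP => i; rewrite !mxE ffunE.
  move=> _ /= A mA; rewrite setTI.
  have -> : (fun x => f (\row_i fl n (g i x))) @^-1` A =
      \bigcup_j [set x | A (code (z x)) /\ pickle (z x) = j].
    by apply/seteqP; split => x /=; rewrite fE; [move=> Ax; exists (pickle (z x))|case=> j _ []].
  apply: bigcupT_measurable => j.
  case E : (unpickle j : option {ffun 'I_k -> int}) => [w|]; last first.
    rewrite [X in measurable X](_ : _ = set0) //; apply/seteqP; split => // x /= [_ h].
    by move: E; rewrite -h pickleK.
  have [Aw|nAw] := pselect (A (code w)); last first.
    rewrite [X in measurable X](_ : _ = set0) //; apply/seteqP; split => // x /= [Ax h].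
    by move: E; rewrite -h pickleK => -[zw]; rewrite zw in Ax.
  have [wj|nwj] := eqVneq (pickle w) j.
    rewrite [X in measurable X](_ : _ = z @^-1` [set w]) //; apply/seteqP; split => x /=.
      by move=> [_ h]; move: E; rewrite -h pickleK => -[].
    by move=> ->.
  rewrite [X in measurable X](_ : _ = set0) //; apply/seteqP; split => // x /= [_ h].
  by move: E nwj; rewrite -h pickleK => -[->]; rewrite eqxx.
move=> x _; apply: continuous_cvg; first exact: cf.
apply/cvgrPdist_le => e e0; near=> n.
apply: rV_norm_le => [|i]; first exact: ltW.
rewrite !mxE distrC; apply: le_trans (fln _ _) _.
by apply: ltW; near: n; exact: (near_infty_natSinv_lt (PosNum e0)).
Unshelve. all: by end_near. Qed.

End ContinuousOfMeasurable.

(** * Uniform samples and Brownian increments on a mesh *)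

Section UniformLaw.
Context {R : realType}.

Lemma nat_tuple_measurable N (F : N.-tuple nat -> R) : measurable_fun setT F.
Proof.
move=> _ A mA; rewrite setTI; apply: countable_measurable; last exact: countableP.
move=> t; rewrite (_ : [set t] = tuple_box (fun i => [set tnth t i])).
  exact: measurable_tuple_box.
apply/seteqP; split => [s -> //|s H]; apply: eq_from_tnth => i; exact: H.
Qed.

Lemma eq_measure_nat (m1 m2 : {measure set nat -> \bar R}) :
  (forall k : nat, m1 [set k] = m2 [set k]) -> forall A, m1 A = m2 A.
Proof.
move=> H A.
have AE : A = \bigcup_k (A `&` [set k]).
  by apply/seteqP; split => [k Ak|k [_ _ []] //]; exists k.
have tA : trivIset setT (fun k => A `&` [set k]).
  by move=> i j _ _ [k [[_ ->] [_ ->]]].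
have E (m : {measure set nat -> \bar R}) : m A = (\sum_(0 <= k <oo) m (A `&` [set k]))%E.
  by rewrite {1}AE measure_bigcup //; apply: eq_eseriesl => k; rewrite in_setT.
rewrite !E; apply: eq_eseriesr => k _.
have [Ak|nAk] := pselect (A k).
  by rewrite (_ : A `&` [set k] = [set k]) ?H //; apply/seteqP; split => [j []|j ->].
by rewrite (_ : A `&` [set k] = set0) ?measure0 //; apply/seteqP; split => [j [Aj jk]|//];
  rewrite jk in Aj.
Qed.

Lemma intop_uniform (mu : probability nat R) n : (0 < n)%N ->
  (forall k : nat, mu [set k] = (if (1 <= k <= n)%N then n%:R^-1 else 0)%:E) ->
  intop mu = avg n.
Proof.
move=> n0 H.
have ni0 : (0 : R) <= n%:R^-1 by rewrite invr_ge0.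
(* A law on the naturals is determined by its point masses; this one is the average of [n] Dirac
   masses. *)
pose nu : {measure set nat -> \bar R} :=
  mscale (NngNum ni0) (msum (fun k => (\d_(k.+1) : {measure set nat -> \bar R})) n).
have nuE k : mu [set k] = nu [set k].
  rewrite H.
  transitivity ((n%:R^-1)%:E * \sum_(i < n) \d_(i.+1) [set k] : \bar R)%E; last by [].
  rewrite (eq_bigr (fun i : 'I_n => ((i.+1 == k)%:R : R)%:E)); last first.
    move=> i _; rewrite diracE; congr ((nat_of_bool _)%:R%:E); apply/idP/eqP.
      by rewrite inE.
    by move=> ->; rewrite inE.
  rewrite sumEFin -EFinM; congr (_%:E).
  case: k => [|k]; first by rewrite /= big1 ?mulr0.
  case: ifP => [/andP[_ kn]|/negbT]; last first.
    rewrite /= -leqNgt => nk; rewrite big1 ?mulr0 // => i _.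
    by case: eqP => // -[ik]; move: (ltn_ord i); rewrite ik ltnNge nk.
  rewrite (bigD1 (Ordinal kn)) //= eqxx big1 ?addr0 ?mulr1 // => i.
  by rewrite -val_eqE /= eqSS => /negbTE ->.
have g0 (f : nat -> R) : (forall k, 0 <= f k) -> (\int[mu]_x (f x)%:E = (avg n f)%:E)%E.
  move=> f0; rewrite (eq_measure_integral nu); last by move=> A _ _; exact: (@eq_measure_nat mu nu).
  rewrite /nu ge0_integral_mscale //; last by move=> x _; rewrite lee_fin.
  rewrite ge0_integral_measure_sum //; last by move=> x _; rewrite lee_fin.
  rewrite (eq_bigr (fun i : 'I_n => (f i.+1)%:E)); last first.
    by move=> i _; rewrite integral_dirac // diracT mul1e.
  by rewrite sumEFin -EFinM /avg big_add1 /= big_mkord mulrC.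
apply/funext => f; rewrite /intop /Rintegral integralE.
rewrite (eq_integral (fun x => (Num.max (f x) 0)%:E)); last first.
  by move=> x _; rewrite funeposE -EFin_max.
rewrite [X in (_ - X)%E](eq_integral (fun x => (Num.max (- f x) 0)%:E)); last first.
  by move=> x _; rewrite funenegE -EFin_max.
rewrite !g0 => [|k|k]; [|by rewrite le_max lexx orbT..].
rewrite -EFinB /= -avgB; congr (avg n _); apply/funext => u.
by rewrite /Num.max; case: ifP; case: ifP; lra.
Qed.

Lemma integral_iid_uniform d (T : measurableType d) (P : probability T R) n
    (U : nat -> T -> nat) N (F : seq nat -> R) (M : R) :
  (0 < n)%N -> iid_uniform P n U -> (forall s, `|F s| <= M) ->
  (\int[P]_x (F [seq U i.+1 x | i <- iota 0 N])%:E)%E = (iterU n N F)%:E.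
Proof.
move=> n0 [mU [indU lawU]] FM.
pose U1 : {mfun T >-> nat} := HB.pack (U 1%N) (isMeasurableFun.Build _ _ _ _ (U 1%N) (mU 1%N)).
pose mu : probability nat R := [the probability nat R of distribution P U1].
have muE : intop mu = avg n by apply: intop_uniform => // k; exact: lawU.
have E x : [seq U i.+1 x | i <- iota 0 N] = [seq (fun (i : 'I_N) x => U i.+1 x) i x | i <- enum 'I_N].
  by rewrite -val_enum_ord -map_comp.
have mF (G : seq nat -> R) : measurable_fun setT (fun x => G [seq U i.+1 x | i <- iota 0 N]).
  pose Z x : N.-tuple nat := [tuple U (val i).+1 x | i < N].
  have mZ : measurable_fun setT Z.
    apply/measurable_fun_tnthP => i; rewrite (_ : _ \o Z = U i.+1) //.
    by apply/funext => x; rewrite /= /Z tnth_mktuple.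
  rewrite (_ : (fun x => _) = (fun t : N.-tuple nat => G t) \o Z).
    by apply: measurableT_comp mZ; exact: nat_tuple_measurable.
  by apply/funext => x; rewrite E.
(* The shift by [M] makes the integrand nonnegative, as the product formula requires; it is
   cancelled at the end. *)
have I1 : (\int[P]_x (F [seq U i.+1 x | i <- iota 0 N] + M)%:E)%E = (iterU n N (fun s => F s + M))%:E.
  rewrite -muE -(@iid_integral _ _ _ mu _ _ P N (fun i x => U (val i).+1 x) _ (M + M)).
  - by apply: eq_integral => x _; rewrite E.
  - by move=> i; exact: mU.
  - move=> J A uJ mA; have inj : injective (fun i : 'I_N => i.+1) by move=> i j [] /val_inj.
    (* Samples are numbered from 1 and ['I_N] from 0; [A'] transports the sets along
       [i -> i + 1]. *)
    pose A' k : set nat := if insub k.-1 is Some i then A i else setT.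
    have A'E (i : 'I_N) : A' i.+1 = A i.
      by rewrite /A' /=; case: insubP => [j _ /val_inj -> //|]; rewrite ltn_ord.
    have := indU [seq (val i).+1 | i <- J] A' _ (fun _ _ => _).
    rewrite map_inj_uniq // => /(_ uJ).
    move=> /(_ _)/wrap[].
      by [].
    rewrite big_map => h; rewrite (eq_bigr (fun i : 'I_N => P (U i.+1 @^-1` A' i.+1))).
      rewrite -h; congr (P _); apply/seteqP; split => x H.
        by move=> _ /mapP[i iJ ->]; rewrite /= A'E; exact: H.
      by move=> i iJ; have := H i.+1; rewrite /= A'E; apply; apply/mapP; exists i.
    by move=> i _; rewrite A'E.
  - move=> i A _; rewrite /mu /= /distribution /pushforward.
    pose Ui : {mfun T >-> nat} :=
      HB.pack (U i.+1) (isMeasurableFun.Build _ _ _ _ (U i.+1) (mU i.+1)).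
    apply: (@eq_measure_nat (distribution P Ui) (distribution P U1)) => k.
    by rewrite /= /distribution /pushforward; rewrite [LHS]lawU [RHS]lawU.
  - exact: nat_tuple_measurable.
  - by move=> s; have := FM s; rewrite ler_norml => /andP[]; lra.
have iF := @bounded_integrable _ _ _ P _ M (mF F) (fun x => FM _).
have : (\int[P]_x (F [seq U i.+1 x | i <- iota 0 N] + M)%:E =
    \int[P]_x (F [seq U i.+1 x | i <- iota 0 N])%:E + M%:E)%E.
  under eq_integral do rewrite EFinD.
  rewrite integralD //; last exact: finite_measure_integrable_cst.
  by rewrite integral_cst // [X in (_ * X)%E]probability_setT mule1.
rewrite I1 iterUD iterU_cst // EFinD => h; apply/esym.
have /fineK <- := integrable_fin_num measurableT iF.
move: h; have /fineK <- := integrable_fin_num measurableT iF.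
by rewrite -!EFinD => -[] /addIr ->.
Qed.

End UniformLaw.

(** * Brownian motion on the mesh of step [1 / m] *)

Section BrownianMesh.
Context {R : realType} {dB : measure_display} {TB : measurableType dB} (PB : probability TB R).
Context (B : R -> TB -> R) (HB : standard_BM PB B).

(** Mesh increments are independent centred normals of variance [1 / m], one for each sample. [B 0]
    is subtracted because it vanishes only almost everywhere. *)
Lemma integral_BM_mesh (m : nat) bs (f : 'rV[R]_(size bs) -> R) (M : R) : (0 < m)%N ->
  continuous f -> (forall v, 0 <= f v <= M) ->
  (\int[PB]_x (f (\row_i (B ((sumn (take i.+1 bs))%:R / m%:R) x - B 0 x)))%:E)%E =
  (pathE (intop (normal_prob 0 (Num.sqrt m%:R^-1))) bs (fun l => f (\row_i l`_i)) 0)%:E.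
Proof.
move=> m0 cf f0; have [mB [_ [_ [indB lawB]]]] := HB.
have m0' : 0 < m%:R :> R by rewrite ltr0n.
set N := sumn bs.
pose t (i : 'I_N.+1) : R := i%:R / m%:R.
pose X (i : 'I_N) x := B (t (lift ord0 i)) x - B (t (widen_ord (leqnSn N) i)) x.
have t0 i : 0 <= t i by rewrite divr_ge0.
have mX i : measurable_fun setT (X i) by apply: measurable_funB; exact: mB.
have indX : mutually_independent PB X.
  apply: (indB N t) => //.
  by move=> i j ij; rewrite /t ltr_pM2r ?invr_gt0 // ltr_nat.
have lawX i A : measurable A -> PB (X i @^-1` A) = normal_prob 0 (Num.sqrt m%:R^-1) A.
  move=> mA; have tt : t (lift ord0 i) - t (widen_ord (leqnSn N) i) = m%:R^-1.
    by rewrite /t /= /bump /= add1n -mulrBl -natrB // subSnn mul1r.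
  rewrite -tt; apply: lawB => //.
  by rewrite -subr_gt0 tt invr_gt0.
rewrite -iterE_psums.
rewrite -(@iid_integral _ _ _ (normal_prob 0 (Num.sqrt m%:R^-1)) _ _ PB N X _ M) //.
- apply: eq_integral => x _; congr (f _)%:E; apply/rowP => i; rewrite !mxE.
  rewrite nth_psums // add0r.
  set G := fun j : nat => B (j%:R / m%:R) x.
  have -> : [seq X j x | j <- enum 'I_N] = [seq G j.+1 - G j | j <- iota 0 N].
    by rewrite -val_enum_ord -map_comp; apply: eq_map => j.
  have rN : (sumn (take i.+1 bs) <= N)%N.
    by rewrite /N -[X in (_ <= sumn X)%N](cat_take_drop i.+1 bs) sumn_cat leq_addr.
  rewrite -map_take take_iota (minn_idPl rN) big_map.
  rewrite -[X in iota 0 X]subn0 -/(index_iota 0 _) telescope_sumr //.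
  by rewrite /G mul0r.
- pose g (i : 'I_(size bs)) (s : N.-tuple R) := (psums bs s 0)`_i.
  apply: (@continuous_row_measurable _ _ _ _ f g cf) => i.
  have rN : (sumn (take i.+1 bs) <= N)%N.
    by rewrite /N -[X in (_ <= sumn X)%N](cat_take_drop i.+1 bs) sumn_cat leq_addr.
  rewrite (_ : g i = fun s => \sum_(j < N) (j < sumn (take i.+1 bs))%N%:R * tnth s j).
    apply: measurable_sum => j; apply: measurable_funM => //; exact: measurable_tnth.
  apply/funext => s; rewrite /g nth_psums // add0r.
  rewrite -{1}[val s]map_tnth_enum.
  set r := sumn _ in rN *.
  rewrite (_ : map _ _ = [seq nth 0 s j | j <- iota 0 N]); last first.
    by rewrite -val_enum_ord -map_comp; apply: eq_map => j; rewrite (tnth_nth 0).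
  rewrite -map_take take_iota (minn_idPl rN) big_map.
  rewrite -[X in iota 0 X]subn0 -/(index_iota 0 _) big_mkord (big_ord_widen N _ rN) big_mkcond.
  by apply: eq_bigr => j _; rewrite (tnth_nth 0); case: ifP; rewrite ?mul1r ?mul0r.
Qed.

Lemma BM_increment_le (s t : R) : 0 <= s -> s <= t ->
  (\int[PB]_x (`|B t x - B s x|)%:E <= (Num.sqrt (t - s))%:E)%E.
Proof.
move=> s0 st; have [mB [_ [_ [_ lawB]]]] := HB.
have [->|] := eqVneq s t.
  rewrite subrr sqrtr0; under eq_integral do rewrite subrr normr0.
  by rewrite integral0.
move=> nst; have {nst st} : s < t by rewrite lt_neqAle nst.
move=> st.
pose Z x := B t x - B s x.
have mZ : measurable_fun setT Z by apply: measurable_funB; apply: mB => //; lra.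
have mZ' : measurable_fun setT (Z : TB -> measurableTypeR R) := mZ.
pose ZX : {mfun TB >-> measurableTypeR R} := HB.pack Z (isMeasurableFun.Build _ _ TB (measurableTypeR R) Z mZ').
set sg := Num.sqrt (t - s).
have sg0 : 0 < sg by rewrite sqrtr_gt0 subr_gt0.
have cN : continuous (fun y : R => `|y|) by exact: norm_continuous.
rewrite (_ : \int[PB]_x _ = \int[distribution PB ZX]_y (`|y|)%:E)%E; last first.
  rewrite ge0_integral_distribution //.
  by apply/measurable_EFinP; exact: continuous_measurable_fun.
rewrite (eq_measure_integral (normal_prob 0 sg)); last first.
  by move=> A mA _; exact: lawB.
(* The inequality of means [|y| <= sg / 2 + y ^ 2 / (2 sg)] reduces the first absolute moment to the
   second moment. *)
apply: (@le_trans _ _ (\int[normal_prob 0 sg]_y (sg / 2 + (2 * sg)^-1 * y ^+ 2)%:E))%E.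
  apply: ge0_le_integral => //.
  - by apply/measurable_EFinP; exact: continuous_measurable_fun.
  - apply/measurable_EFinP; apply: continuous_measurable_fun => y; apply: cvgD; first exact: cvg_cst.
    by apply: cvgM; [exact: cvg_cst|exact: exprn_continuous].
  - move=> y _; rewrite lee_fin -[X in _ * X ^+ 2]/y.
    rewrite -(@real_normK _ y) ?num_real // -subr_ge0.
    have -> : sg / 2 + (2 * sg)^-1 * `|y| ^+ 2 - `|y| = (2 * sg)^-1 * (`|y| - sg) ^+ 2.
      by field; rewrite gt_eqF.
    by rewrite mulr_ge0 ?sqr_ge0 // invr_ge0 mulr_ge0 // ltW.
under eq_integral do rewrite EFinD.
rewrite integralD //; last 2 first.
- exact: finite_measure_integrable_cst.
- by apply: integrableZl_EFin; exact: normal_integrable_sqr.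
rewrite integral_cst // [X in (_ * X)%E]probability_setT mule1.
under [X in (_ + X)%E]eq_integral do rewrite EFinM.
rewrite ge0_integralZl //; last 3 first.
- by apply/measurable_EFinP; apply: continuous_measurable_fun; exact: exprn_continuous.
- by move=> y _; rewrite lee_fin sqr_ge0.
- by rewrite lee_fin invr_ge0 mulr_ge0 // ltW.
rewrite integral_normal_sqr // -EFinM -EFinD lee_fin.
by rewrite (_ : _ + _ = sg) //; field; rewrite gt_eqF.
Qed.

End BrownianMesh.

(** * Convergence of finite-dimensional distributions from one-step estimates *)

Section Blocks.
Context (Ns : nat -> nat).

Definition blocks k : seq nat := [seq (Ns i - (if i is j.+1 then Ns j else 0))%N | i <- iota 0 k].

Lemma size_blocks k : size (blocks k) = k.
Proof. by rewrite size_map size_iota. Qed.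

Lemma sumn_take_blocks k i : (forall j, Ns j <= Ns j.+1)%N -> (i < k)%N ->
  sumn (take i.+1 (blocks k)) = Ns i.
Proof.
move=> Nm; elim: i => [|i IH] ik.
  by case: k ik => // k _; rewrite /blocks /= take0 /= subn0 addn0.
rewrite (take_nth 0%N) ?size_blocks // sumn_rcons IH ?(ltnW ik) //.
by rewrite (nth_map 0%N) ?size_iota // nth_iota // add0n /= subnKC.
Qed.

Lemma le_sumn_blocks k i : (forall j, Ns j <= Ns j.+1)%N -> (i < k)%N -> (Ns i <= sumn (blocks k))%N.
Proof.
move=> Nm ik; rewrite -(sumn_take_blocks Nm ik).
by rewrite -[X in (_ <= sumn X)%N](cat_take_drop i.+1) sumn_cat leq_addr.
Qed.

Lemma sumn_blocks_le k a : (forall j, Ns j <= Ns j.+1)%N -> (forall j, j < k -> Ns j <= a)%N ->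
  (sumn (blocks k) <= a)%N.
Proof.
case: k => [//|k] Nm Na.
by rewrite -(take_size (blocks k.+1)) size_blocks sumn_take_blocks // Na.
Qed.

End Blocks.

(** * Exchange of the sampled walk for the Gaussian walk *)

Section FiniteComparison.
Context {R : realType}.

Lemma iterU_take n N r (g : seq nat -> R) : (0 < n)%N -> (r <= N)%N ->
  iterU n N (fun s => g (take r s)) = iterU n r g.
Proof.
move=> n0 rN; rewrite -[X in iterE _ X](subnKC rN) iterE_cat; apply: eq_iterE_size => s sr.
rewrite (_ : (fun t => _) = fun=> g s) ?iterU_cst //; apply/funext => t.
by rewrite -sr take_size_cat.
Qed.

Definition lipschitz_row k (L : R) (f : 'rV[R]_k -> R) := forall v w, `|f v - f w| <= L * `|v - w|.

Lemma lipschitz_row_continuous k L (f : 'rV[R]_k -> R) : lipschitz_row L f -> continuous f.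
Proof.
move=> fL v; apply/(@cvgrPdist_lt R R _ (nbhs v) (nbhs_filter v)) => e e0.
have L0 : 0 < `|L| + 1 by have := normr_ge0 L; lra.
near=> w; apply: le_lt_trans (fL _ _) _.
apply: (@le_lt_trans _ _ ((`|L| + 1) * `|v - w|)).
  by rewrite ler_wpM2r // (le_trans (ler_norm L)) // lerDl.
rewrite mulrC -ltr_pdivlMr //.
by near: w; have := nbhsx_ballx v _ (divr_gt0 e0 L0); rewrite -ball_normE.
Unshelve. all: by end_near. Qed.

Lemma lip_seq_row k L (f : 'rV[R]_k -> R) : 0 <= L -> lipschitz_row L f ->
  lip_seq L (fun l => f (\row_i l`_i)).
Proof.
move=> L0 fL l l' e e0 ll' H; apply: le_trans (fL _ _) _.
by rewrite ler_wpM2l //; apply: rV_norm_le => // i; rewrite !mxE.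
Qed.

Lemma lipschitz_row_sum k L (f : 'rV[R]_k -> R) (a b : 'I_k -> R) : 0 <= L -> lipschitz_row L f ->
  `|f (\row_i a i) - f (\row_i b i)| <= L * \sum_i `|a i - b i|.
Proof.
move=> L0 fL; apply: le_trans (fL _ _) _; rewrite ler_wpM2l //; apply: rV_norm_le.
  by apply: sumr_ge0 => i _.
move=> i; rewrite !mxE (bigD1 i) //= lerDl; exact: sumr_ge0.
Qed.

Definition scaled_lcm (a : R) (n : nat) (s : seq nat) : R := (ln (lcms s)%:R - cn R n (size s)) / a.

Lemma iterU_lipschitz n N k L (f : 'rV[R]_k -> R) (Ns : 'I_k -> nat) (G H : seq nat -> R) :
  (0 < n)%N -> 0 <= L -> lipschitz_row L f -> (forall i, Ns i <= N)%N ->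
  `|iterU n N (fun s => f (\row_i G (take (Ns i) s))) -
    iterU n N (fun s => f (\row_i H (take (Ns i) s)))| <=
  L * \sum_i iterU n (Ns i) (fun s => `|G s - H s|).
Proof.
move=> n0 L0 fL NN; rewrite -iterUB; apply: le_trans (iterU_norm _ _ _) _.
rewrite (eq_bigr (fun i => iterU n N (fun s => `|G (take (Ns i) s) - H (take (Ns i) s)|))); last first.
  by move=> i _; rewrite -(@iterU_take n N (Ns i) (fun s => `|G s - H s|)).
rewrite -iterU_sum -iterUZ; apply: ler_iterU => s _ _.
exact: lipschitz_row_sum.
Qed.

Lemma iterU_pathE_normal n m bs k L M (f : 'rV[R]_k -> R) (xi : nat -> R) (e : R) :
  (0 < n)%N -> (0 < m)%N -> size bs = k -> 0 <= L -> lipschitz_row L f ->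
  (forall v, 0 <= f v <= M) -> avg n xi = 0 -> 0 < e ->
  `|iterU n (sumn bs) (fun s => f (\row_i \sum_(u <- take (sumn (take i.+1 bs)) s) xi u)) -
    pathE (intop (normal_prob 0 (Num.sqrt m%:R^-1))) bs (fun l => f (\row_i l`_i)) 0| <=
  k%:R * (4 * L * e + (sumn bs)%:R * (L / e * `|avg n (fun u => xi u ^+ 2) - m%:R^-1| +
     4 * L / e ^+ 2 * (avg n (fun u => `|xi u| ^+ 3) + 4 * Num.sqrt m%:R^-1 ^+ 3))).
Proof.
move=> n0 m0 bk L0 fL fM xi0 e0; have m0' : 0 < m%:R :> R by rewrite ltr0n.
set sg := Num.sqrt m%:R^-1; have sg0 : 0 < sg by rewrite sqrtr_gt0 invr_gt0.
have sg2 : sg ^+ 2 = m%:R^-1 by rewrite sqr_sqrtr // invr_ge0 ltW.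
set F := fun l : seq R => f (\row_i l`_i).
have -> : iterU n (sumn bs) (fun s => f (\row_i \sum_(u <- take (sumn (take i.+1 bs)) s) xi u)) =
    pathE (avgop n xi) bs F 0.
  rewrite -iterE_psums /avgop iterE_map; congr (iterE _ _ _); apply/funext => s.
  congr f; apply/rowP => i; rewrite !mxE nth_psums ?bk // add0r -map_take big_map.
  by [].
rewrite -bk; apply: (@pathE_lindeberg R _ _ _ _ L M) => //.
- exact: markov_avgop.
- exact: markov_intop.
- move=> g r x gL gM rbs.
  have rle : (r <= sumn bs)%N.
    by rewrite sumnE (big_rem r) //= leq_addr.
  apply: le_trans (@lipschitz_lindeberg R _ _ _ _ _ _ L M g _ _ _ (taylor_op_avgop n0 xi0)
    (taylor_op_intop_normal sg0) gL gM e r x e0) _.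
  + exact: markov_avgop.
  + exact: markov_intop.
  + by move=> b K h; exact: taylor_class_avgop.
  rewrite sg2 lerD2l ler_wpM2r ?ler_nat //; apply: addr_ge0; apply: mulr_ge0 => //.
  + by rewrite divr_ge0 // ltW.
  + by rewrite divr_ge0 ?mulr_ge0 ?exprn_ge0 // ltW.
  + apply: addr_ge0; last by rewrite mulr_ge0 ?exprn_ge0 // ltW.
    by apply: avg_ge0 => u; rewrite exprn_ge0.
- exact: lip_seq_row.
- by move=> l; have /andP[h1 h2] := fM (\row_i l`_i); rewrite ger0_norm.
Qed.

End FiniteComparison.

(** * Brownian motion at given times and at nearby mesh points *)

Section BrownianComparison.
Context {R : realType} {dB : measure_display} {TB : measurableType dB} (PB : probability TB R).
Context (B : R -> TB -> R) (HB : standard_BM PB B).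

Lemma BM_row_integrable k (f : 'rV[R]_k -> R) M (t : 'I_k -> R) : continuous f ->
  (forall v, `|f v| <= M) -> (forall i, 0 <= t i) ->
  PB.-integrable setT (EFin \o (fun x => f (\row_i B (t i) x))).
Proof.
move=> cf fM t0; have [mB _] := HB.
apply: (@bounded_integrable _ _ _ PB _ M) => // x.
by apply: continuous_row_measurable => // i; exact: mB.
Qed.

Lemma integral_BM_shift k L M (f : 'rV[R]_k -> R) (s t : 'I_k -> R) : 0 <= L -> lipschitz_row L f ->
  (forall v, `|f v| <= M) -> (forall i, 0 <= s i <= t i) ->
  `|\int[PB]_x f (\row_i (B (s i) x - B 0 x)) - \int[PB]_x f (\row_i B (t i) x)| <=
   L * \sum_i Num.sqrt (t i - s i).
Proof.
move=> L0 fL fM st; have [mB [B0 _]] := HB.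
have cf := lipschitz_row_continuous fL.
have mBs i : measurable_fun setT (B (s i)) by apply: mB; have /andP[] := st i.
have mBt i : measurable_fun setT (B (t i)).
  by apply: mB; have /andP[h1 h2] := st i; exact: le_trans h2.
have mB0 : measurable_fun setT (B 0) by exact: mB.
have mf1 : measurable_fun setT (fun x => f (\row_i (B (s i) x - B 0 x))).
  by apply: continuous_row_measurable => // i; exact: measurable_funB.
have mf2 : measurable_fun setT (fun x => f (\row_i B (t i) x)).
  by apply: continuous_row_measurable => // i; exact: measurable_funB.
have i1 := bounded_integrable PB mf1 (fun x => fM _).
have i2 := bounded_integrable PB mf2 (fun x => fM _).
have i3 := integrableB_EFin i1 i2.
rewrite -RintegralB //; apply: le_trans (le_normr_Rintegral _ i3) _ => //.
rewrite -lee_fin /Rintegral fineK; last exact: integrable_fin_num (integrable_norm i3).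
have mabs i : measurable_fun setT (fun x => `|B (t i) x - B (s i) x|).
  by apply: measurableT_comp => //; exact: measurable_funB.
apply: (@le_trans _ _ (\int[PB]_x (L%:E * \sum_i (`|B (t i) x - B (s i) x|)%:E)))%E.
  apply: ae_ge0_le_integral => //.
  - by apply/measurable_EFinP; apply: measurableT_comp => //; exact: measurable_funB.
  - by move=> x _; rewrite sumEFin -EFinM lee_fin mulr_ge0 // sumr_ge0.
  - apply: emeasurable_funM => //; apply: emeasurable_sum => i.
    by apply/measurable_EFinP; exact: mabs.
  - apply: filterS B0 => x Bx _; rewrite sumEFin -EFinM lee_fin Bx.
    apply: le_trans (lipschitz_row_sum _ _ L0 fL) _; rewrite ler_wpM2l //.
    by apply: ler_sum => i _; rewrite subr0 distrC.
rewrite ge0_integralZl //; last 2 first.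
- by apply: emeasurable_sum => i; apply/measurable_EFinP; exact: mabs.
- by move=> x _; apply: sume_ge0 => i _; rewrite lee_fin.
rewrite EFinM lee_wpmul2l ?lee_fin // ge0_integral_sum //; last first.
  by move=> i; apply/measurable_EFinP; exact: mabs.
rewrite -sumEFin; apply: lee_sum => i _.
by apply: (BM_increment_le HB); have /andP[] := st i.
Qed.

Lemma Rintegral_BM_blocks k m bs (Ns : nat -> nat) (f : 'rV[R]_k -> R) M : (0 < m)%N ->
  size bs = k -> (forall i : 'I_k, sumn (take i.+1 bs) = Ns i) ->
  continuous f -> (forall v, 0 <= f v <= M) ->
  \int[PB]_x f (\row_i (B ((Ns i)%:R / m%:R) x - B 0 x)) =
  pathE (intop (normal_prob 0 (Num.sqrt m%:R^-1))) bs (fun l => f (\row_i l`_i)) 0.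
Proof.
move=> m0 bk NE cf fM; move: Ns f NE cf fM; rewrite -bk => Ns f NE cf fM.
rewrite /Rintegral -[RHS]/(fine (_%:E)) -(integral_BM_mesh HB m0 cf fM).
congr fine; apply: eq_integral => x _; congr (f _)%:E; apply/rowP => i.
by rewrite !mxE NE.
Qed.

End BrownianComparison.

Lemma iid_scaled_lcm {R : realType} d (T : measurableType d) (P : probability T R) n m
    (U : nat -> T -> nat) k (t : 'I_k -> R) (a M : R) (f : 'rV[R]_k -> R) N :
  (0 < n)%N -> iid_uniform P n U -> (forall v, `|f v| <= M) ->
  (forall i, Num.truncn (m%:R * t i) <= N)%N ->
  (\int[P]_x (f (\row_i lcm_process U n m a (t i) x))%:E)%E =
  (iterU n N (fun s => f (\row_i scaled_lcm a n (take (Num.truncn (m%:R * t i)) s))))%:E.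
Proof.
move=> n0 HU fM NN; rewrite -(integral_iid_uniform N n0 HU (fun s => fM _)).
apply: eq_integral => x _; congr (f _)%:E; apply/rowP => i; rewrite !mxE.
rewrite /lcm_process /scaled_lcm /Ylcm.
rewrite -map_take take_iota (minn_idPl (NN i)) size_map size_iota.
congr ((ln _%:R - _) / _); rewrite /lcms big_map.
by rewrite -[X in iota 0 X]subn0 -/(index_iota 0 _) big_mkord.
Qed.

(** * Lipschitz approximation from below *)

Section InfConvolution.
Context {R : realType} {k : nat} (g : 'rV[R]_k -> R) (M : R).
Context (gM : forall v, 0 <= g v <= M).

(** The Pasch-Hausdorff envelope: for [l >= 0], the largest [l]-Lipschitz function below [g]. *)
Definition inf_conv (l : R) (v : 'rV[R]_k) : R := inf [set g w + l * `|v - w| | w in setT].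

Lemma inf_conv_lb l v w : 0 <= l -> inf_conv l v <= g w + l * `|v - w|.
Proof.
move=> l0; apply: ge_inf; last by exists w.
exists 0 => _ [u _ <-]; have /andP[h _] := gM u; by rewrite addr_ge0 ?mulr_ge0.
Qed.

Lemma le_inf_conv l v c : (forall w, c <= g w + l * `|v - w|) -> c <= inf_conv l v.
Proof.
move=> H; apply: lb_le_inf; first by exists (g v + l * `|v - v|); exists v.
by move=> _ [w _ <-].
Qed.

Lemma inf_conv_le l v : 0 <= l -> inf_conv l v <= g v.
Proof.
by move=> l0; have := inf_conv_lb v v l0; rewrite subrr normr0 mulr0 addr0.
Qed.

Lemma inf_conv_bounded l v : 0 <= l -> 0 <= inf_conv l v <= M.
Proof.
move=> l0; apply/andP; split.
  apply: le_inf_conv => w; have /andP[h _] := gM w; by rewrite addr_ge0 ?mulr_ge0.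
by apply: le_trans (inf_conv_le v l0) _; have /andP[] := gM v.
Qed.

Lemma inf_conv_lipschitz l : 0 <= l -> lipschitz_row l (inf_conv l).
Proof.
move=> l0.
have H v w : inf_conv l v - l * `|v - w| <= inf_conv l w.
  apply: le_inf_conv => u; rewrite lerBlDr; apply: le_trans (inf_conv_lb v u l0) _.
  rewrite -addrA lerD2l -mulrDr ler_wpM2l // [leRHS]addrC.
  have -> : v - u = (v - w) + (w - u) by rewrite addrA subrK.
  exact: ler_normD.
move=> v w; rewrite ler_norml lerBlDr -lerBlDl H andbT lerNl opprB lerBlDr -lerBlDl.
by rewrite distrC H.
Qed.

Lemma inf_conv_cvg v : {for v, continuous g} -> inf_conv j%:R v @[j --> \oo] --> g v.
Proof.
move=> cg; apply/cvgrPdist_le => e e0.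
have [d /= d0 Hd] : exists2 d : R, 0 < d & forall w, `|v - w| < d -> g v - e <= g w.
  have /(@cvgrPdist_le R R _ (nbhs v) (nbhs_filter v)) /(_ e e0) := cg.
  rewrite -nbhs_ballE => -[d /= d0 Hd]; exists d => // w vw.
  have := Hd w; rewrite -ball_normE /= => /(_ vw).
  by rewrite ler_distlC => /andP[].
have M0 : 0 <= M by have /andP[h1 h2] := gM v; exact: le_trans h2.
near=> j.
(* Once [j * d >= M], the penalty alone is at least [g v] at distance [d] or more; continuity
   handles the closer points. *)
have jM : M / d <= j%:R by near: j; exact: nbhs_infty_ger.
rewrite ger0_norm ?subr_ge0 ?inf_conv_le // lerBlDl -lerBlDr.
apply: le_inf_conv => w; have /andP[gw _] := gM w.
have [vw|vw] := ltP `|v - w| d.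
  by apply: le_trans (Hd w vw) _; rewrite lerDl mulr_ge0.
apply: (@le_trans _ _ M); first by have /andP[_ h] := gM v; lra.
apply: (@le_trans _ _ (j%:R * `|v - w|)); last by rewrite lerDr.
by apply: (@le_trans _ _ (j%:R * d)); [rewrite -ler_pdivrMr|rewrite ler_wpM2l].
Unshelve. all: by end_near. Qed.

End InfConvolution.

(** * Finite-dimensional convergence under one-step hypotheses *)

Section FddConvergence.
Context {R : realType}.
Context (d : nat -> measure_display) (T : forall n, measurableType (d n)).
Context (P : forall n, probability (T n) R) (U : forall n, nat -> T n -> nat).
Context (HU : forall n : nat, (0 < n)%N -> iid_uniform (P n) n (@U n)).
Context (dB : measure_display) (TB : measurableType dB) (PB : probability TB R).
Context (B : R -> TB -> R) (HB : standard_BM PB B).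
Context (m : nat -> nat) (m_pos : forall n, (0 < m n)%N).
Context (a : nat -> R) (xi : nat -> nat -> R).

Let v n : R := avg n (fun u => xi n u ^+ 2).
Let w n : R := avg n (fun u => `|xi n u| ^+ 3).
Let q n : R := Num.sqrt (m n)%:R^-1.
Let D n (t : R) : R := iterU n (Num.truncn ((m n)%:R * t))
  (fun s => `|scaled_lcm (a n) n s - \sum_(u <- s) xi n u|).

(** Three comparisons: the process with the walk of steps [xi] (cost [D]), this walk with the
    Gaussian walk (exchange at scale [e]), and Brownian motion at mesh points with its values at the
    times [t i] (cost [q] each). The summands are grouped so that all but the first will vanish for
    fixed [e]. *)
Lemma fdd_lipschitz_bound n k (t : 'I_k -> R) (L M e TT : R) (f : 'rV[R]_k -> R) :
  (0 < n)%N -> avg n (xi n) = 0 -> 0 <= L -> lipschitz_row L f -> (forall z, 0 <= f z <= M) ->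
  (forall i, 0 <= t i <= TT) -> (forall i j : 'I_k, (i < j)%N -> t i < t j) -> 0 < e -> 0 <= TT ->
  `|\int[P n]_x f (\row_i lcm_process (@U n) n (m n) (a n) (t i) x) -
    \int[PB]_x f (\row_i B (t i) x)| <=
  k%:R * (4 * L * e) +
  (L * (\sum_i D n (t i)) + k%:R * (TT * (L / e * `|(m n)%:R * v n - 1|
       + 4 * L / e ^+ 2 * ((m n)%:R * w n + 4 * q n))) + L * (k%:R * q n)).
Proof.
move=> n0 xi0 L0 fL fM tT tm e0 TT0.
have fM' z : `|f z| <= M by have /andP[h1 h2] := fM z; rewrite ger0_norm.
have m0 : 0 < (m n)%:R :> R by rewrite ltr0n.
have cf := lipschitz_row_continuous fL.
(* The value [TT] past the last index makes [tt], hence [Ns], monotone on all naturals, as the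
   lemmas on [blocks] ask. *)
pose tt j := if insub j is Some i then t i else TT.
have ttE (i : 'I_k) : tt i = t i.
  by rewrite /tt; case: insubP => [j _ /val_inj -> //|]; rewrite ltn_ord.
have ttT j : tt j <= TT by rewrite /tt; case: insub => // i; have /andP[] := tT i.
have ttm j : tt j <= tt j.+1.
  have [jk|kj] := ltnP j.+1 k.
    by rewrite -[j.+1]/(val (Ordinal jk)) -[j in tt j]/(val (Ordinal (ltnW jk))) !ttE ltW // tm.
  by rewrite {2}/tt insubN ?ttT // -leqNgt.
pose Ns j := Num.truncn ((m n)%:R * tt j).
have Nm j : (Ns j <= Ns j.+1)%N by apply: le_truncn; exact: (ler_wpM2l (ltW m0) (ttm j)).
have NE (i : 'I_k) : Ns i = Num.truncn ((m n)%:R * t i) by rewrite /Ns ttE.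
pose bs := blocks Ns k; have bk : size bs = k by exact: size_blocks.
have NT : (sumn bs)%:R <= (m n)%:R * TT.
  apply: (@le_trans _ _ (Num.truncn ((m n)%:R * TT))%:R).
    by rewrite ler_nat; apply: sumn_blocks_le => // j _; apply: le_truncn; exact: (ler_wpM2l (ltW m0) (ttT j)).
  by rewrite truncn_le // mulr_ge0 // ltW.
have takeE (i : 'I_k) : sumn (take i.+1 bs) = Ns i by exact: sumn_take_blocks.
have E1 : \int[P n]_x f (\row_i lcm_process (@U n) n (m n) (a n) (t i) x) =
    iterU n (sumn bs) (fun s => f (\row_i scaled_lcm (a n) n (take (Ns i) s))).
  rewrite /Rintegral (@iid_scaled_lcm R _ _ (P n) n (m n) (@U n) k t (a n) M f (sumn bs)) ?fineK //.
  - congr (iterE _ _ _); apply/funext => s; congr f; apply/rowP => i; by rewrite !mxE NE.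
  - exact: HU.
  - by move=> i; rewrite -NE; exact: le_sumn_blocks.
have E2 := @iterU_lipschitz R n (sumn bs) k L f Ns (scaled_lcm (a n) n)
  (fun s => \sum_(u <- s) xi n u) n0 L0 fL (fun i => le_sumn_blocks Nm (ltn_ord i)).
have E3 := iterU_pathE_normal n0 (m_pos n) bk L0 fL fM xi0 e0.
have E4 : \int[PB]_x f (\row_i (B ((Ns i)%:R / (m n)%:R) x - B 0 x)) =
    pathE (intop (normal_prob 0 (q n))) bs (fun l => f (\row_i l`_i)) 0.
  exact: (Rintegral_BM_blocks HB (m_pos n) bk takeE cf fM).
have E5 : `|\int[PB]_x f (\row_i (B ((Ns i)%:R / (m n)%:R) x - B 0 x)) -
    \int[PB]_x f (\row_i B (t i) x)| <= L * (k%:R * q n).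
  have tN (i : 'I_k) : (Ns i)%:R <= (m n)%:R * t i < (Ns i)%:R + 1.
    rewrite NE natr1; apply: truncn_itv.
    by rewrite mulr_ge0 ?(ltW m0) //; have /andP[] := tT i.
  apply: le_trans (@integral_BM_shift R _ _ PB B HB k L M f _ t L0 fL fM' _) _.
    move=> i; have /andP[h _] := tN i.
    by rewrite divr_ge0 //= ler_pdivrMr // mulrC.
  rewrite ler_wpM2l //.
  have -> : k%:R * q n = \sum_(i < k) q n by rewrite sumr_const card_ord mulr_natl.
  apply: ler_sum => i _.
  rewrite ler_wsqrtr // lerBlDr -[X in X + _]mul1r -mulrDl ler_pdivlMr // mulrC addrC.
  by have /andP[_ /ltW] := tN i.
have E6 : (sumn bs)%:R * (L / e * `|v n - (m n)%:R^-1| + 4 * L / e ^+ 2 * (w n + 4 * q n ^+ 3)) <=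
   TT * (L / e * `|(m n)%:R * v n - 1| + 4 * L / e ^+ 2 * ((m n)%:R * w n + 4 * q n)).
  have -> : `|(m n)%:R * v n - 1| = (m n)%:R * `|v n - (m n)%:R^-1|.
    by rewrite -[X in X * `|_|](gtr0_norm m0) -normrM mulrBr mulfV // gt_eqF.
  have q3 : q n = (m n)%:R * q n ^+ 3.
    by rewrite exprS sqr_sqrtr ?invr_ge0 ?(ltW m0) // mulrCA mulfV ?mulr1 // gt_eqF.
  apply: (@le_trans _ _ (((m n)%:R * TT) * (L / e * `|v n - (m n)%:R^-1| +
      4 * L / e ^+ 2 * (w n + 4 * q n ^+ 3)))); last by apply/eq_ler; rewrite [in RHS]q3; ring.
  rewrite ler_wpM2r //; apply: addr_ge0; apply: mulr_ge0 => //.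
  - by rewrite divr_ge0 // ltW.
  - by rewrite divr_ge0 ?mulr_ge0 ?exprn_ge0 // ltW.
  - apply: addr_ge0; last by rewrite mulr_ge0 ?exprn_ge0 ?sqrtr_ge0.
    by apply: avg_ge0 => u; rewrite exprn_ge0.
have E3' : `|iterU n (sumn bs) (fun s => f (\row_i \sum_(u <- take (Ns i) s) xi n u)) -
    \int[PB]_x f (\row_i (B ((Ns i)%:R / (m n)%:R) x - B 0 x))| <=
  k%:R * (4 * L * e + TT * (L / e * `|(m n)%:R * v n - 1| + 4 * L / e ^+ 2 * ((m n)%:R * w n + 4 * q n))).
  rewrite E4; apply: le_trans (le_trans _ E3) _; last first.
    by rewrite ler_wpM2l // lerD2l; exact: E6.
  apply/eq_ler; congr (`|_ - _|); congr (iterE _ _ _); apply/funext => s; congr f; apply/rowP => i.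
  by rewrite !mxE takeE.
have E2' : `|iterU n (sumn bs) (fun s => f (\row_i scaled_lcm (a n) n (take (Ns i) s))) -
    iterU n (sumn bs) (fun s => f (\row_i \sum_(u <- take (Ns i) s) xi n u))| <= L * \sum_i D n (t i).
  apply: le_trans E2 _; rewrite ler_wpM2l //; apply: ler_sum => i _.
  by rewrite /D -NE.
rewrite E1.
set X1 := iterU _ _ _ in E2' *; set X2 := iterU _ _ _ in E2' E3'; set X3 := Rintegral _ _ _ in E3' E5.
set X4 := Rintegral _ _ _ in E5 *.
rewrite -(subrKA X2) -(subrKA X3 (X2)).
move: E2' E3' E5; clear => E2 E3 E5.
apply: le_trans (ler_normD _ _) _.
apply: le_trans (lerD E2 (ler_normD _ _)) _.
apply: le_trans (lerD (lexx _) (lerD E3 E5)) _.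
by apply/eq_ler; ring.
Qed.

Context (m_oo : ((m n)%:R : R) @[n --> \oo] --> +oo).
Context (xi0 : forall n, (0 < n)%N -> avg n (xi n) = 0).
Context (xi2 : (m n)%:R * v n @[n --> \oo] --> (1 : R)).
Context (xi3 : (m n)%:R * w n @[n --> \oo] --> (0 : R)).
Context (xiD : forall t, 0 <= t -> D n t @[n --> \oo] --> (0 : R)).

Lemma cvg_inv_sqrt : q n @[n --> \oo] --> (0 : R).
Proof.
rewrite -[X in _ --> X](@sqrtr0 R); apply: continuous_cvg; first exact: sqrt_continuous.
apply/gtr0_cvgV0 => //; near=> n; by rewrite ltr0n.
Unshelve. all: by end_near. Qed.

Lemma cvg_sum0 (I : Type) (r : seq I) (F : nat -> I -> R) :
  (forall i, F n i @[n --> \oo] --> (0 : R)) -> \sum_(i <- r) F n i @[n --> \oo] --> (0 : R).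
Proof.
move=> HF; elim: r => [|i r IH].
  under eq_fun do rewrite big_nil; exact: cvg_cst.
under eq_fun do rewrite big_cons.
have := cvgD (HF i) IH; rewrite addr0; exact.
Qed.

Lemma fdd_lipschitz k (t : 'I_k -> R) (L M : R) (f : 'rV[R]_k -> R) :
  0 <= L -> lipschitz_row L f -> (forall z, 0 <= f z <= M) ->
  (forall i, 0 <= t i) -> (forall i j : 'I_k, (i < j)%N -> t i < t j) ->
  \int[P n]_x f (\row_i lcm_process (@U n) n (m n) (a n) (t i) x) @[n --> \oo] -->
    \int[PB]_x f (\row_i B (t i) x).
Proof.
move=> L0 fL fM t0 tm; apply/cvgrPdist_le => eps eps0.
pose TT := \sum_i t i.
have TT0 : 0 <= TT by apply: sumr_ge0 => i _.
have tT i : 0 <= t i <= TT by rewrite t0 /TT (bigD1 i) //= lerDl sumr_ge0.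
(* The summand 1 keeps [C] positive when [k] or [L] is 0. *)
pose C := 4 * (k%:R * L) + 1.
have C0 : 0 < C by rewrite ltr_wpDl // mulr_ge0 // mulr_ge0.
pose e := eps / 2 / C; have e0 : 0 < e by rewrite !divr_gt0.
pose r n := L * (\sum_i D n (t i)) + k%:R * (TT * (L / e * `|(m n)%:R * v n - 1|
       + 4 * L / e ^+ 2 * ((m n)%:R * w n + 4 * q n))) + L * (k%:R * q n).
have qc := cvg_inv_sqrt.
have r0 : r n @[n --> \oo] --> (0 : R).
  have -> : 0 = L * 0 + k%:R * (TT * (L / e * `|1 - 1| + 4 * L / e ^+ 2 * (0 + 4 * 0))) + L * (k%:R * 0) :> R.
    by rewrite subrr normr0; ring.
  apply: cvgD; last by apply: cvgMr; apply: cvgMr.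
  apply: cvgD; first by apply: cvgMr; apply: cvg_sum0 => i; exact: xiD.
  apply: cvgMr; apply: cvgMr; apply: cvgD; apply: cvgMr.
    by apply: cvg_norm; apply: cvgB => //; exact: cvg_cst.
  by apply: cvgD => //; apply: cvgMr.
near=> n.
have n0 : (0 < n)%N by near: n; exact: nbhs_infty_gt.
rewrite distrC; apply: le_trans (fdd_lipschitz_bound n0 (xi0 n0) L0 fL fM tT tm e0 TT0) _.
rewrite -/(r n) (splitr eps); apply: lerD.
  apply: (@le_trans _ _ (C * e)); last by rewrite /e mulrC divfK ?gt_eqF.
  rewrite (_ : k%:R * (4 * L * e) = (4 * (k%:R * L)) * e); last by ring.
  by rewrite ler_wpM2r ?(ltW e0) // lerDl.
apply: le_trans (ler_norm _) _; rewrite -normrN -sub0r; near: n.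
by have /cvgrPdist_le := r0; apply; rewrite divr_gt0.
Unshelve. all: by end_near. Qed.

(** One pair [N], [Y] serves all bounded test functions, so that comparing integrals over [P n]
    amounts to comparing finite averages. *)
Lemma Rintegral_lcm_process k (t : 'I_k -> R) n (M : R) (f : 'rV[R]_k -> R) :
  (0 < n)%N -> (forall z, `|f z| <= M) -> (forall i, 0 <= t i) ->
  exists N, exists Y : seq nat -> 'rV[R]_k, forall (g : 'rV[R]_k -> R) M', (forall z, `|g z| <= M') ->
  (\int[P n]_x (g (\row_i lcm_process (@U n) n (m n) (a n) (t i) x))%:E)%E =
    (iterU n N (fun s => g (Y s)))%:E.
Proof.
move=> n0 _ t0; exists (\max_i Num.truncn ((m n)%:R * t i))%N.
exists (fun s => \row_i scaled_lcm (a n) n (take (Num.truncn ((m n)%:R * t i)) s)) => g M' gM.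
apply: iid_scaled_lcm gM _ => //; first exact: HU.
by move=> i; exact: leq_bigmax.
Qed.

Lemma fdd_liminf k (t : 'I_k -> R) (M : R) (g : 'rV[R]_k -> R) :
  continuous g -> (forall z, 0 <= g z <= M) ->
  (forall i, 0 <= t i) -> (forall i j : 'I_k, (i < j)%N -> t i < t j) ->
  forall eps, 0 < eps -> \forall n \near \oo,
  \int[PB]_x g (\row_i B (t i) x) - eps <=
    \int[P n]_x g (\row_i lcm_process (@U n) n (m n) (a n) (t i) x).
Proof.
move=> cg gM t0 tm eps eps0.
have bnd (h : 'rV[R]_k -> R) : (forall z, 0 <= h z <= M) -> forall z, `|h z| <= M.
  by move=> hM z; have /andP[h1 h2] := hM z; rewrite ger0_norm.
pose gl (j : nat) := inf_conv g j%:R.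
have glM j z : 0 <= gl j z <= M by apply: inf_conv_bounded.
have cgl j : continuous (gl j).
  by apply: lipschitz_row_continuous; exact: (inf_conv_lipschitz gM (ler0n _ j)).
have ig := BM_row_integrable HB cg (bnd _ gM) t0.
have igl j := BM_row_integrable HB (cgl j) (bnd _ (glM j)) t0.
have C1 : \int[PB]_x gl j (\row_i B (t i) x) @[j --> \oo] --> \int[PB]_x g (\row_i B (t i) x).
  apply: fine_cvg; rewrite fineK; last exact: integrable_fin_num ig.
  apply: (@dominated_cvg _ _ _ PB setT measurableT _ _ (cst M%:E)).
  - by move=> j; have /integrableP[] := igl j.
  - move=> x _; apply/fine_cvgP; split; first exact: nearW.
    exact: (inf_conv_cvg gM (cg _)).
  - by [].
  - exact: finite_measure_integrable_cst.
  - by move=> j x _ /=; rewrite lee_fin bnd.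
(* The index [j] is fixed on the Brownian side, by dominated convergence, before [n] grows. *)
have [j Hj] : exists j, \int[PB]_x g (\row_i B (t i) x) - eps / 2 <= \int[PB]_x gl j (\row_i B (t i) x).
  have /cvgrPdist_le /(_ (eps / 2)) := C1; rewrite divr_gt0 // => /(_ isT) [j _ /(_ j (leqnn j))] /= H.
  by exists j; move: H; rewrite ler_distlC => /andP[].
have C2 := fdd_lipschitz (ler0n _ j) (inf_conv_lipschitz gM (ler0n _ j)) (glM j) t0 tm.
near=> n.
have n0 : (0 < n)%N by near: n; exact: nbhs_infty_gt.
apply: (@le_trans _ _ (\int[P n]_x gl j (\row_i lcm_process (@U n) n (m n) (a n) (t i) x))).
  have : `|\int[PB]_x gl j (\row_i B (t i) x) -
     \int[P n]_x gl j (\row_i lcm_process (@U n) n (m n) (a n) (t i) x)| <= eps / 2.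
    by near: n; have /cvgrPdist_le := C2; apply; rewrite divr_gt0.
  rewrite ler_distlC => /andP[h1 h2]; rewrite (splitr eps) opprD addrA.
  by apply: le_trans h1; rewrite lerD2r.
have [N [Y HY]] := Rintegral_lcm_process n0 (bnd _ gM) t0.
rewrite /Rintegral (HY _ _ (bnd _ gM)) (HY _ _ (bnd _ (glM j))) /=.
by apply: ler_iterU => s _ _; apply: inf_conv_le.
Unshelve. all: by end_near. Qed.

Let near_shift (A A' M e : R) : A + M - e <= A' + M -> M - A - e <= M - A' -> `|A - A'| <= e.
Proof. by move=> h1 h2; rewrite ler_norml; apply/andP; split; lra. Qed.

(** Lower bounds for the nonnegative functions [f + M] and [M - f] give the two halves of the
    limit. *)
Lemma fdd_of_steps : fdd_cvg P (fun n => lcm_process (@U n) n (m n) (a n)) PB B.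
Proof.
move=> k t t0 tm f cf [M fM].
have iB := BM_row_integrable HB cf fM t0.
have fM1 z : 0 <= f z + M <= M + M by have := fM z; rewrite ler_norml => /andP[]; lra.
have fM2 z : 0 <= M - f z <= M + M by have := fM z; rewrite ler_norml => /andP[]; lra.
have c1 : continuous (fun z => f z + M).
  move=> z; apply: (@continuous_comp _ R R f (fun y => y + M)); first exact: cf.
  by apply: cvgD; [exact: cvg_id|exact: cvg_cst].
have c2 : continuous (fun z => M - f z).
  move=> z; apply: (@continuous_comp _ R R f (fun y => M - y)); first exact: cf.
  by apply: cvgB; [exact: cvg_cst|exact: cvg_id].
have iM : PB.-integrable setT (EFin \o (fun=> M)) by exact: finite_measure_integrable_cst.
have bnd (h : 'rV[R]_k -> R) : (forall z, 0 <= h z <= M + M) -> forall z, `|h z| <= M + M.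
  by move=> hM z; have /andP[h1 h2] := hM z; rewrite ger0_norm.
rewrite -(@fineK _ (\int[PB]_x _)%E); last exact: integrable_fin_num iB.
apply: cvg_EFin.
  near=> n; have n0 : (0 < n)%N by near: n; exact: nbhs_infty_gt.
  by have [N [Y HY]] := Rintegral_lcm_process n0 fM t0; rewrite (HY _ _ fM).
apply/cvgrPdist_le => eps eps0; near=> n.
have n0 : (0 < n)%N by near: n; exact: nbhs_infty_gt.
have [N [Y HY]] := Rintegral_lcm_process n0 fM t0.
have h1 : \int[PB]_x (f (\row_i B (t i) x) + M) - eps <=
    \int[P n]_x (f (\row_i lcm_process (@U n) n (m n) (a n) (t i) x) + M).
  near: n; exact: (fdd_liminf c1 fM1 t0 tm eps0).
have h2 : \int[PB]_x (M - f (\row_i B (t i) x)) - eps <=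
    \int[P n]_x (M - f (\row_i lcm_process (@U n) n (m n) (a n) (t i) x)).
  near: n; exact: (fdd_liminf c2 fM2 t0 tm eps0).
rewrite /= (HY _ _ fM) /=.
move: h1 h2; rewrite RintegralD // RintegralB // !Rintegral_cst1.
rewrite [in X in _ <= X -> _]/Rintegral (HY _ _ (bnd _ fM1)) /=.
rewrite [in X in _ -> _ <= X -> _]/Rintegral (HY _ _ (bnd _ fM2)) /=.
rewrite iterUD iterUB !iterU_cst // -/(Rintegral _ _ _) => h1 h2.
exact: (near_shift h1 h2).
Unshelve. all: by end_near. Qed.

End FddConvergence.

(** * The two regimes *)

Section StepApproximation.
Context {R : realType}.
Local Notation one := (fun _ : nat => 1 : R).
Local Notation large m := (fun p : nat => (m < p)%N%:R : R).

Lemma ppart_Wlcm m n s :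
  ppart n s = Wlcm m n s + \sum_(u <- s) padd n.+1 (large m) u.
Proof.
rewrite /ppart /Wlcm /padd exchange_big /= -big_split /=; apply: eq_bigr => p _.
rewrite -mulr_sumr (_ : (count (dvdn p) s)%:R = \sum_(u <- s) (p %| u)%:R :> R); first by ring.
by rewrite -sum1_count natr_sum big_mkcond; apply: eq_bigr => u _; case: (p %| u)%N.
Qed.

Lemma iterU_abs_le n N (G : seq nat -> R) : (0 < n)%N ->
  iterU n N (fun s => `|G s|) <= Num.sqrt (iterU n N (fun s => G s ^+ 2)).
Proof.
move=> n0; rewrite -[leLHS]ger0_norm ?iterU_ge0 // -sqrtr_sqr ler_wsqrtr //.
apply: le_trans (iterU_jensen _ _ n0) _; apply: ler_iterU => s _ _.
by rewrite real_normK ?num_real.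
Qed.

(** The prime-power part is nonnegative, so its mean bounds it in [L^1]; [W] is bounded through its
    variance. No bias remains, since [c_n] is exactly the mean of [W] plus that of the sum of the
    [h (U_j)]. *)
Lemma lcm_residual m n N (t : R) : (0 < m <= n)%N -> 1 <= t -> N%:R <= t * m%:R ->
  iterU n N (fun s => `|ln (lcms s)%:R - cn R n (size s)
    - \sum_(u <- s) (padd n.+1 (large m) u - avg n (padd n.+1 (large m)))|) <=
  80 * Num.sqrt (t * m%:R) + Num.sqrt (1200 * t ^+ 3 * (m%:R * (1 + ln m%:R))).
Proof.
move=> mn t1 Nt; have /andP[m0 mn'] := mn; have n0 : (0 < n)%N by exact: leq_trans mn'.
set h := padd n.+1 (large m).
have cnE : cn R n N = iterU n N (Wlcm m n) + N%:R * avg n h.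
  rewrite -iterU_ppart // -iterU_sumS // -iterUD; congr (iterE _ _ _).
  by apply/funext => s; exact: ppart_Wlcm.
have [N0|N0] := posnP N.
  have c0 : cn R n 0 = 0 by rewrite -iterU_ppart //= /ppart big1 // => p _; rewrite mulr0.
  rewrite N0 /= /lcms !big_nil ln1 c0 !subr0 normr0; apply: addr_ge0; last exact: sqrtr_ge0.
  by rewrite mulr_ge0 ?sqrtr_ge0.
apply: (@le_trans _ _ (iterU n N (fun s => (ln (lcms s)%:R - ppart n s) +
    `|Wlcm m n s - iterU n N (Wlcm m n)|))).
  apply: ler_iterU => s sN sn.
  have hp := @ppart_le_lnn_lcms R _ _ sn.
  rewrite -[X in _ <= X + _]ger0_norm ?subr_ge0 //; apply: le_trans (ler_normD _ _).
  apply/eq_ler; congr (`|_|); rewrite sN cnE sumrB big_const_seq count_predT sN iter_addr_0.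
  by rewrite (ppart_Wlcm m) -/h mulr_natl; ring.
rewrite iterUD; apply: lerD.
  apply: le_trans (iterU_lnn_lcms_sub n0 N0) _.
  by rewrite ler_wpM2l // ler_wsqrtr.
apply: le_trans (iterU_abs_le _ _ n0) _; apply: ler_wsqrtr.
have -> : iterU n N (fun s => (Wlcm m n s - iterU n N (Wlcm m n)) ^+ 2) =
   iterU n N (fun s => Wlcm m n s ^+ 2) - iterU n N (Wlcm m n) ^+ 2 :> R.
  under eq_fun do rewrite sqrrB.
  rewrite iterUD iterUB iterU_cst // (_ : iterU n N (fun s => Wlcm m n s * _ *+ 2) =
    2 * iterU n N (Wlcm m n) * iterU n N (Wlcm m n)); first by ring.
  rewrite -iterUZ; congr (iterE _ _ _); apply/funext => s; rewrite -mulr_natl; ring.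
exact: Wlcm_variance.
Qed.

Lemma avg_centered_sqr n (g : nat -> R) : (0 < n)%N ->
  avg n (fun u => (g u - avg n g) ^+ 2) = avg n (fun u => g u ^+ 2) - avg n g ^+ 2.
Proof.
move=> n0; under eq_fun do rewrite sqrrB.
rewrite avgD avgB avg_cst // (_ : avg n (fun u => g u * _ *+ 2) = 2 * avg n g * avg n g); first by ring.
by rewrite -avgZ; congr (avg n _); apply/funext => u; rewrite -mulr_natl; ring.
Qed.

Lemma iterU_centered_sum n N (g : nat -> R) (c : R) : (0 < n)%N ->
  iterU n N (fun s => `|\sum_(u <- s) (g u - avg n g)|) <=
  Num.sqrt (N%:R * avg n (fun u => (g u - c) ^+ 2)).
Proof.
move=> n0; apply: le_trans (iterU_abs_le _ _ n0) _; apply: ler_wsqrtr.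
rewrite (iterU_sum_sqr _ (fun u => g u - avg n g)) //.
rewrite (avgB n g (fun=> avg n g)) (avg_cst _ n0) subrr expr0n /= mulr0 addr0 ler_wpM2l //.
by rewrite avg_centered_sqr //; exact: avg_sqr_le.
Qed.

Lemma padd_split m n u : (m <= n)%N ->
  padd n.+1 one u = padd m.+1 one u + padd n.+1 (large m) u.
Proof.
move=> mn; rewrite /padd (@big_cat_nat _ _ _ m.+1) //= ?ltnS //.
rewrite [X in _ = _ + X](@big_cat_nat _ _ _ m.+1) //= ?ltnS //.
rewrite [X in _ = _ + (X + _)]big1_seq ?add0r; last first.
  by move=> p /andP[_]; rewrite mem_index_iota ltnS => /andP[_ pm]; rewrite ltnNge pm mulr0 mul0r.
congr (_ + _); apply: eq_big_nat => p /andP[mp _].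
by rewrite mp.
Qed.

Lemma cvgr_sub1 (f : nat -> R) (c : R) : f n - c @[n --> \oo] --> (0 : R) -> f n @[n --> \oo] --> c.
Proof. by move=> /cvg_sub0; apply; exact: cvg_cst. Qed.

Lemma cvg0_le (f g : nat -> R) : (\forall n \near \oo, `|f n| <= g n) ->
  g n @[n --> \oo] --> (0 : R) -> f n @[n --> \oo] --> (0 : R).
Proof.
move=> fg g0; apply/cvgrPdist_le => e e0; near=> n; rewrite sub0r normrN.
apply: (@le_trans _ _ (g n)); first by near: n.
apply: le_trans (ler_norm _) _; rewrite -normrN -sub0r; near: n.
by have /cvgrPdist_le := g0; apply.
Unshelve. all: by end_near. Qed.

Lemma cvg_div_pinfty (c : R) (x : nat -> R) : x n @[n --> \oo] --> +oo ->
  c / x n @[n --> \oo] --> (0 : R).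
Proof.
move=> xoo; rewrite -[X in _ --> X](mulr0 c); apply: cvgMr.
by apply/gtr0_cvgV0 => //; move/cvgryPgt : xoo; apply.
Qed.

Lemma cvg_sqrt_pinfty (x : nat -> R) : x n @[n --> \oo] --> +oo ->
  Num.sqrt (x n) @[n --> \oo] --> +oo.
Proof.
move=> xoo; apply/cvgryPge => A; near=> n.
have h : (`|A| ^+ 2) <= x n by near: n; move/cvgryPge : xoo; apply.
by apply: le_trans (ler_norm A) _; rewrite -[leLHS]ger0_norm // -sqrtr_sqr ler_wsqrtr.
Unshelve. all: by end_near. Qed.

Lemma cvg_ln_pinfty (x : nat -> R) : x n @[n --> \oo] --> +oo ->
  ln (x n) @[n --> \oo] --> +oo.
Proof.
move=> xoo; apply/cvgryPge => A; near=> n.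
have h : expR A <= x n by near: n; move/cvgryPge : xoo; apply.
by rewrite -(expRK A) ler_ln ?posrE ?expR_gt0 // (lt_le_trans (expR_gt0 A)).
Unshelve. all: by end_near. Qed.

(** For [g >= 0] with mean [c], [|g - c| ^ 3 <= g ^ 3 + c ^ 3], and the tangent line of the cube at
    [c] bounds [c ^ 3] by the third moment. *)
Lemma avg_cube_dev n (g : nat -> R) : (0 < n)%N -> (forall u, 0 <= g u) ->
  avg n (fun u => `|g u - avg n g| ^+ 3) <= 2 * avg n (fun u => g u ^+ 3).
Proof.
move=> n0 g0; set c := avg n g.
have c0 : 0 <= c by apply: avg_ge0.
have cube : c ^+ 3 <= avg n (fun u => g u ^+ 3).
  have -> : c ^+ 3 = avg n (fun u => 3 * c ^+ 2 * g u - 2 * c ^+ 3).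
    by rewrite avgB avgZ avg_cst // -/c; ring.
  apply: ler_avg => u _; rewrite -subr_ge0.
  have -> : g u ^+ 3 - (3 * c ^+ 2 * g u - 2 * c ^+ 3) = (g u - c) ^+ 2 * (g u + 2 * c) by ring.
  by rewrite mulr_ge0 ?sqr_ge0 // addr_ge0 // mulr_ge0.
apply: (@le_trans _ _ (avg n (fun u => g u ^+ 3 + c ^+ 3))); last by rewrite avgD avg_cst //; lra.
apply: ler_avg => u _; have gu := g0 u.
have [cg|gc] := leP c (g u).
  rewrite ger0_norm ?subr_ge0 //; apply: (@le_trans _ _ (g u ^+ 3)); last by rewrite lerDl exprn_ge0.
  by rewrite lerXn2r // ?nnegrE ?subr_ge0 // gerBl.
rewrite ltr0_norm ?subr_lt0 // opprB; apply: (@le_trans _ _ (c ^+ 3)); last by rewrite lerDr exprn_ge0.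
by rewrite lerXn2r // ?nnegrE ?subr_ge0 ?gerBl // ltW.
Qed.

End StepApproximation.

(** * Inequalities between the normalizations and the errors *)

Section Scalars.
Context {R : realType}.
Implicit Types m l s C X W L D : R.

Lemma small_scale_variance m l s X C : 0 < s -> m = 2 * s ^+ 2 -> 1 <= l -> 0 <= C ->
  `|X - l ^+ 2 / 2| <= C * (1 + l) -> `|m * (X / (s * l) ^+ 2) - 1| <= 4 * C / l.
Proof.
move=> s0 -> l1 C0 V; have l0 : 0 < l by lra.
have -> : 2 * s ^+ 2 * (X / (s * l) ^+ 2) - 1 = 2 / l ^+ 2 * (X - l ^+ 2 / 2).
  by field; rewrite !gt_eqF.
have l2 : 0 <= 2 / l ^+ 2 by rewrite divr_ge0 // exprn_ge0 // ltW.
rewrite normrM ger0_norm //; apply: (@le_trans _ _ (2 / l ^+ 2 * (C * (l + l)))).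
  by rewrite ler_wpM2l // (le_trans V) // ler_wpM2l // lerD2r.
by apply/eq_ler; field; rewrite gt_eqF.
Qed.

Lemma small_scale_third m l s W C : 0 < s -> m = 2 * s ^+ 2 -> 1 <= l -> 0 <= C ->
  W <= C * (1 + l) ^+ 3 -> m * (W / (s * l) ^+ 3) <= 16 * C / s.
Proof.
move=> s0 -> l1 C0 V; have l0 : 0 < l by lra.
have W2 : W <= C * (l + l) ^+ 3.
  by rewrite (le_trans V) // ler_wpM2l // lerXn2r ?nnegrE ?lerD2r //; lra.
apply: (@le_trans _ _ (2 * s ^+ 2 * (C * (l + l) ^+ 3 / (s * l) ^+ 3))).
  rewrite ler_wpM2l ?mulr_ge0 ?exprn_ge0 ?(ltW s0) // ler_wpM2r // invr_ge0 exprn_ge0 //.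
  by rewrite mulr_ge0 // ltW.
by apply/eq_ler; field; rewrite !gt_eqF.
Qed.

Lemma small_scale_residual m l s : 0 < s -> m = 2 * s ^+ 2 -> 1 <= l ->
  Num.sqrt (m * (1 + l)) / (s * l) <= 2 / Num.sqrt l.
Proof.
move=> s0 -> l1; have l0 : 0 < l by lra.
have sl : 0 < Num.sqrt l by rewrite sqrtr_gt0.
rewrite ler_pdivrMr ?mulr_gt0 //; set q := Num.sqrt l.
have -> : 2 / q * (s * l) = 2 * s * q.
  by rewrite -[l in s * l](@sqr_sqrtr _ l) ?(ltW l0) // -/q; field; rewrite gt_eqF.
have h : 0 <= 2 * s * q by rewrite !mulr_ge0 // ltW.
rewrite -[leRHS]ger0_norm // -sqrtr_sqr ler_wsqrtr // !exprMn sqr_sqrtr ?(ltW l0) //.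
rewrite -subr_ge0.
have -> : 2 ^+ 2 * s ^+ 2 * l - 2 * s ^+ 2 * (1 + l) = 2 * s ^+ 2 * (l - 1) by ring.
by rewrite mulr_ge0 ?subr_ge0 // mulr_ge0 // sqr_ge0.
Qed.

(** [L <= 2 l], which reflects [n <= m ^ 2], gives [3 l - L >= L / 2]. The squared normalization
    thus exceeds errors of order [m L] by a factor of order [L - l]. *)
Lemma large_scale_ge m l L : 0 < m -> 1 <= L -> 1 <= L - l -> L <= 2 * l ->
  m * ((L - l) * L) <= 4 * (m / 2 * (L - l) * (3 * l - L)).
Proof.
move=> m0 L1 D1 Ll; rewrite -subr_ge0.
have -> : 4 * (m / 2 * (L - l) * (3 * l - L)) - m * ((L - l) * L) = 3 * (m * ((L - l) * (2 * l - L))).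
  by field.
by rewrite !mulr_ge0 ?(ltW m0) ?subr_ge0 //; lra.
Qed.

Lemma large_scale_variance m l L X C : 0 < m -> 1 <= L -> 1 <= L - l -> L <= 2 * l -> 0 <= C ->
  `|X - (L - l) * (3 * l - L) / 2| <= C * (1 + L) ->
  `|m * (X / (m / 2 * (L - l) * (3 * l - L))) - 1| <= 8 * C / (L - l).
Proof.
move=> m0 L1 D1 Ll C0 V; have D0 : 0 < L - l by lra.
have e0 : 0 < 3 * l - L by lra.
have -> : m * (X / (m / 2 * (L - l) * (3 * l - L))) - 1 =
    2 / ((L - l) * (3 * l - L)) * (X - (L - l) * (3 * l - L) / 2).
  by field; rewrite !gt_eqF.
have h : 0 <= 2 / ((L - l) * (3 * l - L)) by rewrite divr_ge0 // mulr_ge0 // ltW.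
rewrite normrM ger0_norm //; apply: (@le_trans _ _ (2 / ((L - l) * (3 * l - L)) * (C * (L + L)))).
  by rewrite ler_wpM2l // (le_trans V) // ler_wpM2l // lerD2r.
rewrite -subr_ge0.
have -> : 8 * C / (L - l) - 2 / ((L - l) * (3 * l - L)) * (C * (L + L)) =
    12 * C * (2 * l - L) / ((L - l) * (3 * l - L)).
  by field; rewrite !gt_eqF.
by rewrite divr_ge0 ?mulr_ge0 ?(ltW D0) ?(ltW e0) //; lra.
Qed.

Lemma large_scale_residual m l L : 0 < m -> 1 <= L -> 1 <= L - l -> L <= 2 * l ->
  Num.sqrt (m * (1 + L)) / Num.sqrt (m / 2 * (L - l) * (3 * l - L)) <= 3 / Num.sqrt (L - l).
Proof.
move=> m0 L1 D1 Ll; have D0 : 0 < L - l by lra.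
have A0 : 0 < m / 2 * (L - l) * (3 * l - L) by rewrite !mulr_gt0 //; lra.
rewrite ler_pdivrMr ?sqrtr_gt0 // mulrAC ler_pdivlMr ?sqrtr_gt0 //.
have q3 : 3 = Num.sqrt (3 ^+ 2) :> R by rewrite sqrtr_sqr ger0_norm.
rewrite [X in X * Num.sqrt (m / 2 * _ * _)]q3 -!sqrtrM ?exprn_ge0 ?mulr_ge0 ?(ltW m0) //; last by lra.
apply: ler_wsqrtr; have := large_scale_ge m0 L1 D1 Ll; set A := m / 2 * _ * _ => hA.
apply: (@le_trans _ _ (2 * (m * ((L - l) * L)))).
  rewrite -subr_ge0; have -> : 2 * (m * ((L - l) * L)) - m * (1 + L) * (L - l) = m * ((L - l) * (L - 1)) by ring.
  by rewrite !mulr_ge0 ?(ltW m0) ?(ltW D0) // subr_ge0.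
by move: A0 hA; rewrite -/A; clear; lra.
Qed.

(** The left side will bound the steps uniformly. As [l = 2 ln (sqrt m) <= 2 sqrt m], also
    [L <= 4 sqrt m], while the normalization is at least of order [sqrt (m L)]. *)
Lemma large_scale_bound m l L : 1 <= m -> l = ln m -> 1 <= L -> 1 <= L - l -> L <= 2 * l ->
  L / Num.sqrt (m / 2 * (L - l) * (3 * l - L)) <= 4 / Num.sqrt (Num.sqrt m).
Proof.
move=> m1 lE L1 D1 Ll; have m0 : 0 < m by lra.
have D0 : 0 < L - l by lra.
have A0 : 0 < m / 2 * (L - l) * (3 * l - L) by rewrite !mulr_gt0 //; lra.
have sm : 0 < Num.sqrt m by rewrite sqrtr_gt0.
have ls : l <= 2 * Num.sqrt m.
  have -> : l = 2 * ln (Num.sqrt m) by rewrite lE mulr_natl -lnXn // sqr_sqrtr // ltW.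
  rewrite ler_wpM2l //.
  by apply: le_trans (ln_le_subr1 sm) _; rewrite gerBl.
rewrite ler_pdivrMr ?sqrtr_gt0 // mulrAC ler_pdivlMr ?sqrtr_gt0 //.
have q4 : 4 = Num.sqrt (4 ^+ 2) :> R by rewrite sqrtr_sqr ger0_norm.
have qL : L = Num.sqrt (L ^+ 2) by rewrite sqrtr_sqr ger0_norm //; lra.
rewrite [X in X * Num.sqrt (m / 2 * _ * _)]q4 [X in X * _ <= _]qL -!sqrtrM ?exprn_ge0 //; last lra.
apply: ler_wsqrtr; have := large_scale_ge m0 L1 D1 Ll; set A := m / 2 * _ * _ => hA.
set q := Num.sqrt m in sm ls *.
have mq : m = q * q by rewrite -expr2 sqr_sqrtr // ltW.
apply: (@le_trans _ _ (4 * (m * ((L - l) * L)))); last by move: hA; clear; lra.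
have L4 : L <= 4 * q by apply: le_trans Ll _; lra.
rewrite mq expr2 (_ : 4 * _ = (L * q) * ((L - l) * (4 * q))); last by ring.
rewrite -mulrA [X in X <= _](_ : _ = (L * q) * L); last by ring.
rewrite [leRHS]mulrA ler_wpM2l ?mulr_ge0 ?(ltW sm) //; first lra.
by apply: le_trans L4 _; rewrite ler_peMl // mulr_ge0 // ltW.
Qed.

Lemma residual_le c1 c2 t m M Q : 0 <= c1 -> 0 <= c2 -> 0 <= t -> 0 <= m -> m <= Q -> M <= Q ->
  c1 * Num.sqrt (t * m) + Num.sqrt (c2 * t ^+ 3 * M) <=
  (c1 * Num.sqrt t + Num.sqrt (c2 * t ^+ 3)) * Num.sqrt Q.
Proof.
move=> c10 c20 t0 m0 mQ MQ; rewrite mulrDl; apply: lerD.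
  by rewrite -mulrA -sqrtrM // ler_wpM2l // ler_wsqrtr // ler_wpM2l.
have h : 0 <= c2 * t ^+ 3 by rewrite mulr_ge0 // exprn_ge0.
by rewrite -sqrtrM // ler_wsqrtr // ler_wpM2l.
Qed.

Lemma centered_residual_le c t m N X Q : 0 <= N -> N <= t * m -> 0 <= X -> X <= c -> 0 <= t -> m <= Q ->
  Num.sqrt (N * X) <= Num.sqrt (c * t) * Num.sqrt Q.
Proof.
move=> N0 Nt X0 Xc t0 mQ; have c0 : 0 <= c by exact: le_trans Xc.
rewrite -sqrtrM ?mulr_ge0 // ler_wsqrtr //; apply: (@le_trans _ _ ((t * m) * c)).
  exact: ler_pM.
by rewrite mulrC mulrA ler_wpM2l // mulr_ge0.
Qed.

End Scalars.

(** * Verification of the one-step hypotheses *)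

Section Cases.
Context {R : realType}.
Context (d : nat -> measure_display) (T : forall n, measurableType (d n)).
Context (P : forall n, probability (T n) R) (U : forall n, nat -> T n -> nat).
Context (HU : forall n : nat, (0 < n)%N -> iid_uniform (P n) n (@U n)).
Context (dB : measure_display) (TB : measurableType dB) (PB : probability TB R).
Context (B : R -> TB -> R) (HB : standard_BM PB B).
Context (m : nat -> nat) (m_pos : forall n, (0 < m n)%N).
Local Notation one := (fun _ : nat => 1 : R).
Local Notation large m := (fun p : nat => (m < p)%N%:R : R).

Let mr n : R := (m n)%:R.
Let l n : R := ln (m n)%:R.

Let mr0 n : 0 < mr n. Proof. by rewrite ltr0n. Qed.

Lemma truncn_scale_le n (t : R) : 0 <= t -> (Num.truncn (mr n * t))%:R <= (t + 1) * mr n.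
Proof.
move=> t0; apply: (@le_trans _ _ (mr n * t)).
  by rewrite truncn_le mulr_ge0 // ltW.
by rewrite mulrC ler_wpM2r ?lerDl // ltW.
Qed.

Lemma iterU_scaled_lcm n N (a : R) (y : nat -> R) : 0 < a ->
  iterU n N (fun s => `|scaled_lcm a n s - \sum_(u <- s) y u / a|) =
  iterU n N (fun s => `|ln (lcms s)%:R - cn R n (size s) - \sum_(u <- s) y u|) / a.
Proof.
move=> a0; rewrite [RHS]mulrC -iterUZ; congr (iterE _ _ _); apply/funext => s.
rewrite /scaled_lcm -mulr_suml -mulrBl normrM mulrC.
by rewrite [X in X * _]gtr0_norm // invr_gt0.
Qed.

Lemma fdd_small : (\forall n \near \oo, mr n <= Num.sqrt (n%:R : R)) ->
  mr n @[n --> \oo] --> +oo ->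
  fdd_cvg P (fun n => lcm_process (@U n) n (m n) (Num.sqrt (mr n / 2) * l n)) PB B.
Proof.
move=> msmall moo.
pose s n := Num.sqrt (mr n / 2).
pose g n := padd (m n).+1 one.
(* The sign is reversed: up to an [L^2]-bounded error [h] is [ln n] minus the small-prime sum [g],
   so its centred version is [avg g - g]. *)
pose xi n u := (avg n (g n) - g n u) / (s n * l n).
have loo : l n @[n --> \oo] --> +oo by exact: cvg_ln_pinfty.
have l1 : \forall n \near \oo, 1 <= l n by move/cvgryPge : loo; apply.
have mn2 : \forall n \near \oo, (m n ^ 2 <= n)%N.
  near=> n; have h : mr n <= Num.sqrt (n%:R : R) by near: n.
  by rewrite -(@ler_nat R) natrX -(@sqr_sqrtr _ n%:R) // lerXn2r ?nnegrE ?sqrtr_ge0.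
have s0 n : 0 < s n by rewrite sqrtr_gt0 divr_gt0.
have ms n : mr n = 2 * s n ^+ 2 by rewrite sqr_sqrtr ?divr_ge0 ?(ltW (mr0 n)) //; field.
apply: (@fdd_of_steps R d T P U HU dB TB PB B HB m m_pos (fun n => s n * l n) xi) => //.
- move=> n n0; rewrite /xi; under eq_fun do rewrite mulrC.
  by rewrite avgZ avgB avg_cst // subrr mulr0.
- apply: cvgr_sub1; apply: (@cvg0_le R _ (fun n => 4 * 300 / l n)); last exact: cvg_div_pinfty.
  near=> n.
  have ln1 : 1 <= l n by near: n.
  have n0 : (0 < n)%N by near: n; exact: nbhs_infty_gt.
  have hm : (m n ^ 2 <= n)%N by near: n.
  have V := @small_primes_variance R _ _ (m_pos n) hm.
  have -> : avg n (fun u => xi n u ^+ 2) =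
      (avg n (fun u => g n u ^+ 2) - avg n (g n) ^+ 2) / (s n * l n) ^+ 2.
    rewrite -avg_centered_sqr // [RHS]mulrC -avgZ; congr (avg n _); apply/funext => u.
    by rewrite /xi -(opprB (g n u)) mulNr sqrrN expr_div_n mulrC.
  exact: small_scale_variance (s0 n) (ms n) ln1 (ler0n _ _) V.
- apply: (@cvg0_le R _ (fun n => 16 * (2 * 20000) / s n)); last first.
    apply/cvg_div_pinfty/cvg_sqrt_pinfty.
    apply/cvgryPge => A; near=> n; rewrite ler_pdivlMr //.
    by near: n; move/cvgryPge : moo; apply.
  near=> n.
  have ln1 : 1 <= l n by near: n.
  have l0 : 0 < l n by lra.
  have n0 : (0 < n)%N by near: n; exact: nbhs_infty_gt.
  have a0 : 0 < s n * l n by rewrite mulr_gt0.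
  have -> : avg n (fun u => `|xi n u| ^+ 3) = avg n (fun u => `|g n u - avg n (g n)| ^+ 3) / (s n * l n) ^+ 3.
    rewrite [RHS]mulrC -avgZ; congr (avg n _); apply/funext => u.
    by rewrite /xi normrM exprMn mulrC [X in X ^+ 3 * _]gtr0_norm ?invr_gt0 // -exprVn distrC.
  have g0 u : 0 <= g n u by apply: padd_ge0.
  have M3 : avg n (fun u => `|g n u - avg n (g n)| ^+ 3) <= 2 * 20000 * (1 + l n) ^+ 3.
    apply: le_trans (avg_cube_dev n0 g0) _; rewrite -mulrA ler_wpM2l //.
    exact: small_primes_moment3.
  rewrite ger0_norm; last first.
    rewrite mulr_ge0 ?(ltW (mr0 n)) // divr_ge0 ?exprn_ge0 ?(ltW a0) //.
    by apply: avg_ge0 => u _; rewrite exprn_ge0.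
  exact: small_scale_third (s0 n) (ms n) ln1 (mulr_ge0 (ler0n _ _) (ler0n _ _)) M3.
- move=> t t0; set N := fun n => Num.truncn (mr n * t).
  pose C := 80 * Num.sqrt (t + 1) + Num.sqrt (1200 * (t + 1) ^+ 3) + Num.sqrt (1300 * (t + 1)).
  have t1 : 1 <= t + 1 by rewrite lerDr.
  have t0' : 0 <= t + 1 by exact: le_trans t1.
  have C0 : 0 <= C by rewrite !addr_ge0 ?mulr_ge0 ?sqrtr_ge0.
  apply: (@cvg0_le R _ (fun n => C * 2 / Num.sqrt (l n))); last first.
    exact/cvg_div_pinfty/cvg_sqrt_pinfty.
  near=> n.
  have ln1 : 1 <= l n by near: n.
  have l0 : 0 < l n by lra.
  have n0 : (0 < n)%N by near: n; exact: nbhs_infty_gt.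
  have hm : (m n ^ 2 <= n)%N by near: n.
  have mn : (m n <= n)%N by apply: leq_trans hm; rewrite expnS leq_pmulr // expn1.
  have a0 : 0 < s n * l n by rewrite mulr_gt0.
  rewrite ger0_norm; last by apply: iterU_ge0.
  rewrite (iterU_scaled_lcm n _ (fun u => avg n (g n) - g n u) a0) -/(N n).
  have NT := truncn_scale_le n t0.
  have mn' : (0 < m n <= n)%N by rewrite m_pos.
  have H1 := lcm_residual mn' t1 NT.
  (* The price of exchanging [h] for [- g]: the sum over all primes dividing [u], whose mean square
     distance to the constant [ln n] is at most 1300. *)
  have H2 := @iterU_centered_sum R n (N n) (padd n.+1 one) (ln n%:R) n0.
  set Q := Num.sqrt (mr n * (1 + l n)).
  apply: (@le_trans _ _ (C * Q / (s n * l n))); last first.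
    by rewrite -!mulrA ler_wpM2l // small_scale_residual.
  rewrite ler_wpM2r ?invr_ge0 ?(ltW a0) //.
  have mQ : mr n <= mr n * (1 + l n) by rewrite ler_peMr ?(ltW (mr0 n)) // lerDl ltW.
  rewrite /C mulrDl; apply: le_trans (_ : _ <= _ + _) _; last first.
    apply: lerD; [apply: (le_trans H1)|apply: (le_trans H2)].
      exact: residual_le (ler0n _ _) (ler0n _ _) t0' (ltW (mr0 n)) mQ (lexx _).
    have X0 : 0 <= avg n (fun u => (padd n.+1 one u - ln (n%:R : R)) ^+ 2).
      by apply: avg_ge0 => u _; exact: sqr_ge0.
    exact: centered_residual_le (ler0n _ _) NT X0 (@avg_padd_dev R n n0) t0' mQ.
  rewrite -iterUD; apply: ler_iterU => r _ _.
  apply: le_trans (ler_normD _ _); apply/eq_ler; congr (`|_|).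
  rewrite -[RHS]addrA; congr (_ + _); rewrite -sumrN -sumrN -big_split /=; apply: eq_bigr => u _.
  have -> : avg n (padd n.+1 one) = avg n (g n) + avg n (padd n.+1 (large (m n))).
    by rewrite -avgD; congr (avg n _); apply/funext => v; exact: padd_split.
  by rewrite (padd_split u mn); rewrite /g; ring.
Unshelve. all: by end_near. Qed.

Lemma fdd_large : (\forall n \near \oo, Num.sqrt (n%:R : R) < mr n) ->
  mr n / n%:R @[n --> \oo] --> (0 : R) ->
  fdd_cvg P (fun n => lcm_process (@U n) n (m n)
    (Num.sqrt (mr n / 2 * (ln n%:R - l n) * (3 * l n - ln n%:R)))) PB B.
Proof.
move=> mlarge mo.
pose L n : R := ln n%:R.
pose a n := Num.sqrt (mr n / 2 * (L n - l n) * (3 * l n - L n)).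
pose h n := padd n.+1 (large (m n)).
pose xi n u := (h n u - avg n (h n)) / a n.
have noo : (n%:R : R) @[n --> \oo] --> +oo by exact: cvgr_idn.
have Loo : L n @[n --> \oo] --> +oo by exact: cvg_ln_pinfty.
have L1 : \forall n \near \oo, 1 <= L n by move/cvgryPge : Loo; apply.
have moo : mr n @[n --> \oo] --> +oo.
  apply/cvgryPge => A; near=> n; apply: (@le_trans _ _ (Num.sqrt n%:R)).
    by near: n; move/cvgryPge : (cvg_sqrt_pinfty noo); apply.
  by apply: ltW; near: n.
(* Here [m = o(n)] enters, as [ln (m / n)] tends to minus infinity; the relative errors of the
   variance and of the residual are negative powers of [L - l]. *)
have Doo : L n - l n @[n --> \oo] --> +oo.
  apply/cvgryPge => A; near=> n.
  have n0 : 0 < n%:R :> R by rewrite ltr0n; near: n; exact: nbhs_infty_gt.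
  have H : mr n / n%:R <= expR (- A).
    rewrite -[leLHS]ger0_norm ?divr_ge0 ?(ltW (mr0 n)) ?(ltW n0) // -normrN -sub0r; near: n.
    by move/cvgrPdist_le : mo; apply; exact: expR_gt0.
  have : ln (mr n / n%:R) <= - A.
    by rewrite -(expRK (- A)) ler_ln // posrE ?expR_gt0 // divr_gt0.
  by rewrite ln_div ?posrE // -/(l n) -/(L n); lra.
have D1 : \forall n \near \oo, 1 <= L n - l n by move/cvgryPge : Doo; apply.
have ml : \forall n \near \oo, [/\ (0 < n)%N, (0 < m n <= n)%N, (n < m n ^ 2)%N & L n <= 2 * l n].
  near=> n.
  have n0 : (0 < n)%N by near: n; exact: nbhs_infty_gt.
  have nr0 : 0 < n%:R :> R by rewrite ltr0n.
  have nm : n%:R < mr n ^+ 2.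
    have H : Num.sqrt (n%:R : R) < mr n by near: n.
    by rewrite -(@sqr_sqrtr _ n%:R) // ltrXn2r ?nnegrE ?sqrtr_ge0 ?(ltW (mr0 n)).
  have D1n : 1 <= L n - l n by near: n.
  split => //; last 2 first.
  - by rewrite -(@ltr_nat R) natrX.
  - have -> : 2 * l n = ln (mr n ^+ 2) by rewrite lnXn // mulr_natl.
    by rewrite /L ler_ln ?posrE ?exprn_gt0 // ltW.
  rewrite m_pos leqNgt; apply/negP => nm'.
  have : L n <= l n by apply: ler_lnn => //; exact: ltnW.
  by lra.
have V1 : mr n * avg n (fun u => xi n u ^+ 2) @[n --> \oo] --> (1 : R).
  apply: cvgr_sub1; apply: (@cvg0_le R _ (fun n => 8 * 10000 / (L n - l n))); last exact: cvg_div_pinfty.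
  near=> n.
  have L1n : 1 <= L n by near: n.
  have D1n : 1 <= L n - l n by near: n.
  have [n0 mn nm Ll] : [/\ (0 < n)%N, (0 < m n <= n)%N, (n < m n ^ 2)%N & L n <= 2 * l n] by near: n.
  have V := @large_primes_variance R _ _ mn nm.
  have a2 : a n ^+ 2 = mr n / 2 * (L n - l n) * (3 * l n - L n).
    rewrite sqr_sqrtr // !mulr_ge0 ?(ltW (mr0 n)) //; lra.
  have -> : avg n (fun u => xi n u ^+ 2) =
      (avg n (fun u => h n u ^+ 2) - avg n (h n) ^+ 2) / (mr n / 2 * (L n - l n) * (3 * l n - L n)).
    rewrite -avg_centered_sqr // -a2 [RHS]mulrC -avgZ; congr (avg n _); apply/funext => u.
    by rewrite /xi expr_div_n mulrC.
  exact: large_scale_variance (mr0 n) L1n D1n Ll (ler0n _ _) V.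
apply: (@fdd_of_steps R d T P U HU dB TB PB B HB m m_pos a xi) => //.
- move=> n n0; rewrite /xi; under eq_fun do rewrite mulrC.
  by rewrite avgZ avgB avg_cst // subrr mulr0.
(* The third moment is at most the uniform bound on the steps times the variance; [h] and its mean
   both lie in [[0, ln n]], so they differ by at most [ln n]. *)
- apply: (@cvg0_le R _ (fun n => 4 / Num.sqrt (Num.sqrt (mr n)) * (mr n * avg n (fun u => xi n u ^+ 2)))); last first.
    have /(_ 4) c1 := cvg_div_pinfty _ (cvg_sqrt_pinfty (cvg_sqrt_pinfty moo)).
    by have := cvgM c1 V1; rewrite mul0r; exact.
  near=> n.
  have L1n : 1 <= L n by near: n.
  have D1n : 1 <= L n - l n by near: n.
  have [n0 mn nm Ll] : [/\ (0 < n)%N, (0 < m n <= n)%N, (n < m n ^ 2)%N & L n <= 2 * l n] by near: n.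
  have m1 : 1 <= mr n by rewrite ler1n.
  have La := large_scale_bound m1 (erefl (l n)) L1n D1n Ll; rewrite -/(a n) in La.
  have a0 : 0 < a n by rewrite sqrtr_gt0 !mulr_gt0 //; lra.
  rewrite ger0_norm; last first.
    rewrite mulr_ge0 // ?(ltW (mr0 n)) //.
    by apply: avg_ge0 => u _; rewrite exprn_ge0.
  rewrite [leRHS]mulrCA ler_wpM2l ?(ltW (mr0 n)) // -avgZ; apply: ler_avg => u un.
  rewrite exprS real_normK ?num_real // ler_wpM2r ?sqr_ge0 // (le_trans _ La) //.
  have p01 p : 0 <= large (m n) p <= 1 by case: (m n < p)%N; rewrite ?lexx ?ler01.
  have hb v : (0 < v <= n)%N -> 0 <= h n v <= L n.
    move=> vn; rewrite padd_le_lnn // andbT; apply: padd_ge0 => p; by have /andP[] := p01 p.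
  have /andP[e1 e2] : 0 <= avg n (h n) <= L n.
    apply/andP; split; first by apply: avg_ge0 => v /hb/andP[].
    by rewrite -[leRHS](avg_cst (L n) n0); apply: ler_avg => v /hb/andP[].
  have /andP[f1 f2] := hb u un.
  rewrite /xi normrM [X in _ * X]gtr0_norm ?invr_gt0 // ler_wpM2r ?invr_ge0 ?(ltW a0) //.
  by rewrite ler_norml; apply/andP; split; lra.
- move=> t t0; set N := fun n => Num.truncn (mr n * t).
  pose C := 80 * Num.sqrt (t + 1) + Num.sqrt (1200 * (t + 1) ^+ 3).
  have t1 : 1 <= t + 1 by rewrite lerDr.
  have t0' : 0 <= t + 1 by exact: le_trans t1.
  have C0 : 0 <= C by rewrite !addr_ge0 ?mulr_ge0 ?sqrtr_ge0.
  apply: (@cvg0_le R _ (fun n => C * 3 / Num.sqrt (L n - l n))); last first.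
    exact/cvg_div_pinfty/cvg_sqrt_pinfty.
  near=> n.
  have L1n : 1 <= L n by near: n.
  have D1n : 1 <= L n - l n by near: n.
  have [n0 mn nm Ll] : [/\ (0 < n)%N, (0 < m n <= n)%N, (n < m n ^ 2)%N & L n <= 2 * l n] by near: n.
  have a0 : 0 < a n by rewrite sqrtr_gt0 !mulr_gt0 //; lra.
  rewrite ger0_norm; last by apply: iterU_ge0.
  rewrite (iterU_scaled_lcm n _ (fun u => h n u - avg n (h n)) a0) -/(N n).
  have H1 := lcm_residual mn t1 (truncn_scale_le n t0).
  set Q := Num.sqrt (mr n * (1 + L n)).
  apply: (@le_trans _ _ (C * Q / a n)); last first.
    by rewrite -!mulrA ler_wpM2l // large_scale_residual.
  rewrite ler_wpM2r ?invr_ge0 ?(ltW a0) //.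
  have mQ : mr n <= mr n * (1 + L n) by rewrite ler_peMr ?(ltW (mr0 n)) // lerDl; lra.
  have mQ' : mr n * (1 + l n) <= mr n * (1 + L n) by rewrite ler_wpM2l ?(ltW (mr0 n)) // lerD2l; lra.
  apply: (le_trans H1).
  exact: residual_le (ler0n _ _) (ler0n _ _) t0' (ltW (mr0 n)) mQ mQ'.
Unshelve. all: by end_near. Qed.

End Cases.

Unset Implicit Arguments.

Theorem theorem3p6 (R : realType)
  (d : nat -> measure_display) (T : forall n, measurableType (d n))
  (P : forall n, probability (T n) R) (U : forall n, nat -> T n -> nat)
  (HU : forall n : nat, (0 < n)%N -> iid_uniform (P n) n (U n))
  (dB : measure_display) (TB : measurableType dB) (PB : probability TB R)
  (B : R -> TB -> R) (HB : standard_BM PB B)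
  (m : nat -> nat) (m_pos : forall n, (0 < m n)%N) :
  ((\forall n \near \oo, (m n)%:R <= Num.sqrt (n%:R : R)) ->
   ((m n)%:R : R) @[n --> \oo] --> +oo ->
   fdd_cvg P
     (fun n => lcm_process (U n) n (m n)
        (Num.sqrt ((m n)%:R / 2) * ln ((m n)%:R)))
     PB B) /\
  ((\forall n \near \oo, Num.sqrt (n%:R : R) < (m n)%:R) ->
   ((m n)%:R / n%:R : R) @[n --> \oo] --> 0 ->
   fdd_cvg P
     (fun n => lcm_process (U n) n (m n)
        (Num.sqrt ((m n)%:R / 2 * (ln (n%:R) - ln ((m n)%:R))
                   * (3 * ln ((m n)%:R) - ln (n%:R)))))
     PB B).
Proof.
split=> [small oo|large small].
- exact: (@fdd_small R d T P U HU dB TB PB B HB m m_pos small oo).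
- exact: (@fdd_large R d T P U HU dB TB PB B HB m m_pos large small).
Qed.
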